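(* For every integer $n\ge1$ there is a positive integer $m_n$, depending only on $n$, such that the following holds. Let $\Omega\subseteq\mathbb{R}^n$ be open, let $k\in\{0,1,2,3\}$ and $0<\alpha\le 1$, and let $f\in C^{k,\alpha}_{\mathrm{loc}}(\Omega)$ be non-negative on $\Omega$. Then there exist functions $g_1,\dots,g_{m_n}\in C^{\frac{k+\alpha}{2}}_{\mathrm{loc}}(\Omega)$ such that $$f=\sum_{j=1}^{m_n}g_j^2 .$$
   Context: All functions are real-valued. For an integer $k\ge 0$, $0<\alpha\le 1$ and $\Omega\subseteq\mathbb{R}^n$ open, $C^{k,\alpha}_{\mathrm{loc}}(\Omega)$ is the set of $k$-times continuously differentiable functions $f$ on $\Omega$ such that $\sup_{x,y\in K,\,x\ne y}\frac{|\partial^\beta f(x)-\partial^\beta f(y)|}{|x-y|^\alpha}<\infty$ for every compact $K\subset\Omega$ and every multi-index $\beta$ with $|\beta|=k$. The half-regular space is $$C^{\frac{k+\alpha}{2}}_{\mathrm{loc}}(\Omega)=\begin{cases} C^{\frac{k}{2},\frac{\alpha}{2}}_{\mathrm{loc}}(\Omega) & k \text{ even},\\ C^{\frac{k-1}{2},\frac{1+\alpha}{2}}_{\mathrm{loc}}(\Omega) & k\text{ odd}.\end{cases}$$ *)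

(* Defs.v *)
From mathcomp Require Import all_boot all_order all_algebra.
From mathcomp Require Import all_classical all_reals all_analysis.

Set Implicit Arguments.
Unset Strict Implicit.
Unset Printing Implicit Defensive.

Import Order.TTheory GRing.Theory Num.Theory.
Import numFieldNormedType.Exports.

Local Open Scope classical_set_scope.
Local Open Scope ring_scope.

(* A function on an open set Omega of R^n is represented by a total function
   on 'rV[R]_n. All the predicates below, when Omega is open, depend only on
   the values taken on Omega. *)

(* The library norm `|x| on 'rV[R]_n is the sup norm. *)
Definition enorm (R : realType) (n : nat) (x : 'rV[R]_n) : R :=
  Num.sqrt (\sum_(i < n) x ord0 i ^+ 2).

Definition partial (R : realType) (n : nat) (i : 'I_n) (f : 'rV[R]_n -> R) :
    'rV[R]_n -> R :=
  fun x => 'D_(delta_mx ord0 i) f x.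

Definition mdegree (n : nat) (beta : 'I_n -> nat) : nat :=
  (\sum_(i < n) beta i)%N.

Definition mpartial (R : realType) (n : nat) (beta : 'I_n -> nat)
    (f : 'rV[R]_n -> R) : 'rV[R]_n -> R :=
  foldr (fun i g => iter (beta i) (partial i) g) f (enum 'I_n).

(* The partial derivatives of order at most k, taken in any order of the
   variables, exist and are continuous on Omega. The existence has to be
   required explicitly, since 'D_v f x is a total operator. *)
Fixpoint is_Ck (R : realType) (n k : nat) (Omega : set 'rV[R]_n)
    (f : 'rV[R]_n -> R) : Prop :=
  (forall x, Omega x -> {for x, continuous f}) /\
  match k with
  | 0 => True
  | k'.+1 => forall i : 'I_n,
      (forall x, Omega x -> derivable f x (delta_mx ord0 i)) /\
      is_Ck k' Omega (partial i f)
  end.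

Definition holder_quotients (R : realType) (n : nat) (alpha : R)
    (K : set 'rV[R]_n) (f : 'rV[R]_n -> R) : set R :=
  [set q | exists x y, [/\ K x, K y, x != y &
             q = `|f x - f y| / enorm (x - y) `^ alpha]].

Definition holder_loc (R : realType) (n k : nat) (alpha : R)
    (Omega : set 'rV[R]_n) (f : 'rV[R]_n -> R) : Prop :=
  is_Ck k Omega f /\
  forall K : set 'rV[R]_n, compact K -> K `<=` Omega ->
  forall beta : 'I_n -> nat, mdegree beta = k ->
  has_ubound (holder_quotients alpha K (mpartial beta f)).

Definition half_holder_loc (R : realType) (n k : nat) (alpha : R)
    (Omega : set 'rV[R]_n) (f : 'rV[R]_n -> R) : Prop :=
  if odd k then holder_loc k.-1./2 ((1 + alpha) / 2) Omega f
  else holder_loc k./2 (alpha / 2) Omega f.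

(* Main.v *)
Require Import Defs.
From mathcomp Require Import all_boot all_order all_algebra.
From mathcomp Require Import all_classical all_reals all_analysis.
From mathcomp Require Import ring lra zify.

(* Put s = k + alpha. For k <= 1 the square root of f is regular enough. For k >= 2, so that
   2 < s <= 4, regularity is measured by pointwise Taylor expansions with error O(|h|^s).
   Let r(x) be the maximum of f(x)^(1/s) and of the (q_i(x)/2)^(1/(s-2)), where q_i(x) is the
   coefficient of h_i^2 at x. Since f >= 0, every Taylor coefficient of f at x is controlled by
   r(x), and r varies slowly at distance O(r(x)) from x. Rescale by r(x). If f is bounded below
   there, sqrt f is as regular as f. Otherwise f is small and some q_i is bounded below, so f is
   strictly convex along the i-th axis and f = F + G^2, where F, the minimum of f along the
   lines parallel to that axis, does not depend on x_i and again has expansions with error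
   O(|h|^s), and G has first-order expansions with error O(|h|^(s/2)). Apply induction on the
   number of variables to F. The local decompositions are glued by functions psi_c with
   sum psi_c^2 = 1, supported on cubes of side comparable to r(x); cubes of the same colour are
   disjoint, so finitely many colours suffice. Where r vanishes, |g(x + h)| <= sqrt (f(x + h)) =
   O(|h|^(s/2)) is already the required expansion. A second gluing, with the distance to the
   complement of Omega instead of r, passes from cubes to Omega. *)

Set Implicit Arguments.
Unset Strict Implicit.
Unset Printing Implicit Defensive.

Import Order.TTheory GRing.Theory Num.Theory.
Import numFieldNormedType.Exports.

Local Open Scope classical_set_scope.
Local Open Scope ring_scope.

(** * Powers and the sup norm *)

(** Pointwise expansions are the notion of regularity that survives the minimisation. When [x] moves
    by h, the point where the minimum along a line is attained deviates by O(|h|^(s/2)) from a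
    linear motion; near a minimum an error of position enters the value squared, so F keeps the
    error O(|h|^s) although the minimiser itself is far less regular. Near its zero set G is an
    affine function up to O(|h|^(s/2)); away from it, G is the root of a perturbed affine square.
    The two regimes produce different affine functions, which are compared on a sphere. Since 2 < s
    <= 4, the order s/2 lies in (1, 2], so that first-order expansions of the summands are enough.
    The dimension n is fixed throughout the induction. What decreases is the number of coordinates
    on which the function depends, so that the same cells and the same colours serve at every stage.
    On the unit cube the constants must not depend on f, because f is rescaled differently at each
    point. On Omega they may depend on the point, since only local bounds are wanted there. *)

Ltac nng := repeat match goal with
  | |- is_true (0 <= _ * _) => apply: mulr_ge0
  | |- is_true (0 <= _ + _) => apply: addr_ge0
  | |- is_true (0 <= _%:R) => exact: ler0n
  | |- is_true (0 <= 1) => exact: ler01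
  | |- is_true (0 <= _^-1) => rewrite invr_ge0
  | |- is_true (0 <= _ ^+ _) => apply: exprn_ge0
  | |- is_true (0 <= _ `^ _) => apply: powR_ge0
  | |- is_true (0 <= `|_|) => apply: normr_ge0
  | |- is_true (0 <= Num.sqrt _) => apply: sqrtr_ge0
  | |- is_true (0 <= _) => first [assumption | apply: ltW; assumption]
  end.

Ltac psv := repeat match goal with
  | |- is_true (0 < _ * _) => apply: mulr_gt0
  | |- is_true (0 < _ + _) => apply: addr_gt0
  | |- is_true (0 < _%:R) => rewrite ltr0n; exact: isT
  | |- is_true (0 < 1) => exact: ltr01
  | |- is_true (0 < _^-1) => rewrite invr_gt0
  | |- is_true (0 < _ ^+ _) => apply: exprn_gt0
  | |- is_true (0 < _ `^ _) => apply: powR_gt0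
  | |- is_true (0 < Num.sqrt _) => rewrite sqrtr_gt0
  | |- is_true (0 < _) => assumption
  end.

Section Powers.
Context {R : realType}.
Implicit Types (a b s t x y : R).

Lemma powR_mono a b s : 0 <= s -> 0 <= a -> a <= b -> a `^ s <= b `^ s.
Proof.
move=> s0 a0 ab; apply: ge0_ler_powR => //; rewrite nnegrE //.
exact: le_trans ab.
Qed.

Lemma powR_antimono a s t : 0 <= a <= 1 -> 0 < t <= s -> a `^ s <= a `^ t.
Proof.
move=> /andP[a0 a1] /andP[t0 ts]; have [->|an0] := eqVneq a 0.
  by rewrite !powR0 // gt_eqF //; apply: lt_le_trans ts.
by apply: ger_powR => //; rewrite lt_neqAle eq_sym an0 a0.
Qed.

Lemma powR_le1 a s : 0 <= a <= 1 -> 0 <= s -> a `^ s <= 1.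
Proof.
by move=> /andP[a0 a1] s0; apply: le_trans (powR_mono s0 a0 a1) _; rewrite powR1.
Qed.

Lemma powR_addn a s t : 0 <= a -> s + t != 0 -> a `^ (s + t) = a `^ s * a `^ t.
Proof. by move=> a0 st; rewrite powRD // (negbTE st). Qed.

Lemma powR_nat a k : 0 <= a -> a `^ (k%:R) = a ^+ k.
Proof. exact: powR_mulrn. Qed.

Lemma powR_small t e : 0 < t -> 0 < e ->
  exists2 d : R, 0 < d <= 1 & forall a, 0 <= a <= d -> a `^ t <= e.
Proof.
move=> t0 e0; exists (Num.min 1 (e `^ t^-1)).
  by rewrite lt_min ltr01 powR_gt0 //= ge_min lexx.
move=> a /andP[a0]; rewrite le_min => /andP[_ ae].
apply: le_trans (powR_mono (ltW t0) a0 ae) _.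
by rewrite -powRrM mulVf ?gt_eqF // powRr1 // ltW.
Qed.

Lemma powR_sq a s : 0 <= a -> (a `^ (s / 2)) ^+ 2 = a `^ s.
Proof. by move=> a0; rewrite -powR_mulrn ?powR_ge0 // -powRrM divfK ?pnatr_eq0. Qed.

Lemma sqrt_powR a s : 0 <= a -> Num.sqrt (a `^ s) = a `^ (s / 2).
Proof. by move=> a0; rewrite -(powR_sq s a0) sqrtr_sqr ger0_norm ?powR_ge0. Qed.

End Powers.

Section RowNorm.
Context {R : realType} {n : nat}.
Implicit Types (x y h : 'rV[R]_n) (i : 'I_n).
Local Notation e_ i := (delta_mx ord0 i : 'rV[R]_n).

Lemma row_norm_coord x i : `|x ord0 i| <= `|x|.
Proof. by rewrite [leRHS]/Num.Def.normr /= mx_normrE; apply/bigmax_geP; right; exists (ord0, i). Qed.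

Lemma row_norm_le x (c : R) : 0 <= c -> (forall i, `|x ord0 i| <= c) -> `|x| <= c.
Proof.
move=> c0 H; rewrite [leLHS]/Num.Def.normr /= mx_normrE; apply: bigmax_le => // -[j i] _ /=.
by rewrite ord1.
Qed.

Lemma norm_delta i : `|e_ i| = 1.
Proof.
apply/eqP; rewrite eq_le; apply/andP; split.
  apply: row_norm_le => // j; rewrite mxE eqxx /=.
  by case: (j == i); rewrite ?normr1 ?normr0.
by apply: le_trans (row_norm_coord _ i); rewrite mxE !eqxx normr1.
Qed.

(** The staircase from 0 to [x], one coordinate at a time. In the sup norm it stays inside the cube
    of radius |x|, so properties that concern one axis at a time can be carried from 0 to [x]. *)
Definition rowtrunc x (k : nat) : 'rV[R]_n := \row_i (if (i < k)%N then x ord0 i else 0).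

Lemma rowtrunc0 x : rowtrunc x 0 = 0.
Proof. by apply/rowP => i; rewrite !mxE. Qed.

Lemma rowtrunc_all x : rowtrunc x n = x.
Proof. by apply/rowP => i; rewrite !mxE ltn_ord. Qed.

Lemma rowtruncS x i : rowtrunc x i.+1 = rowtrunc x i + x ord0 i *: e_ i.
Proof.
apply/rowP => j; rewrite !mxE eqxx /= ltnS leq_eqVlt.
have [->|ji] := eqVneq j i; first by rewrite eqxx ltnn /= add0r mulr1.
by rewrite val_eqE (negbTE ji) /= mulr0 addr0.
Qed.

Lemma norm_rowtrunc x k : `|rowtrunc x k| <= `|x|.
Proof.
apply: row_norm_le => // i; rewrite mxE; case: ifP => _; first exact: row_norm_coord.
by rewrite normr0.
Qed.

Lemma norm_rowtruncD x i t : `|t| <= `|x ord0 i| -> `|rowtrunc x i + t *: e_ i| <= `|x|.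
Proof.
move=> tx; apply: row_norm_le => // j; rewrite !mxE eqxx /=.
have [->|ji] := eqVneq j i.
  by rewrite ltnn add0r mulr1; apply: le_trans (row_norm_coord _ i).
rewrite mulr0 addr0; case: ifP => _; last by rewrite normr0.
exact: row_norm_coord.
Qed.

Lemma rowtrunc_ind x (P : 'rV[R]_n -> Prop) : P 0 ->
  (forall i, P (rowtrunc x i) -> P (rowtrunc x i + x ord0 i *: e_ i)) -> P x.
Proof.
move=> P0 PS; rewrite -[x]rowtrunc_all; set k := (X in rowtrunc x X).
have : (k <= n)%N by [].
elim: k => [|k IH] kn; first by rewrite rowtrunc0.
by have := PS (Ordinal kn) (IH (ltnW kn)); rewrite -rowtruncS.
Qed.

End RowNorm.

(** * Taylor polynomials and pointwise expansions *)

Section Linear.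
Context {R : realType} {n : nat}.
Local Notation V := 'rV[R]_n.

Definition lin (W : lmodType R) (l : V -> W) :=
  forall (c : R) u v, l (c *: u + v) = c *: l u + l v.

Section LinTheory.
Context {W : lmodType R} {l : V -> W} (ll : lin l).

Lemma linD u v : l (u + v) = l u + l v.
Proof. by rewrite -[u]scale1r ll !scale1r. Qed.

Lemma lin0 : l 0 = 0.
Proof. by apply: (addrI (l 0)); rewrite -linD !addr0. Qed.

Lemma linZ c u : l (c *: u) = c *: l u.
Proof. by rewrite -[c *: u]addr0 ll lin0 addr0. Qed.

Lemma linN u : l (- u) = - l u.
Proof. by rewrite -[- u]scaleN1r linZ scaleN1r. Qed.

Lemma linB u v : l (u - v) = l u - l v.
Proof. by rewrite linD linN. Qed.

End LinTheory.

(** The scaling of [R] is written as a product here, so that [ring] can finish after linearity has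
    been used. *)
Definition linr (l : V -> R) := forall (c : R) u v, l (c *: u + v) = c * l u + l v.

Lemma linrD l u v : linr l -> l (u + v) = l u + l v.
Proof. by move=> ll; exact: (@linD R^o l ll u v). Qed.
Lemma linr0 l : linr l -> l 0 = 0.
Proof. by move=> ll; exact: (@lin0 R^o l ll). Qed.
Lemma linrZ l c u : linr l -> l (c *: u) = c * l u.
Proof. by move=> ll; exact: (@linZ R^o l ll c u). Qed.
Lemma linrN l u : linr l -> l (- u) = - l u.
Proof. by move=> ll; exact: (@linN R^o l ll u). Qed.
Lemma linrB l u v : linr l -> l (u - v) = l u - l v.
Proof. by move=> ll; exact: (@linB R^o l ll u v). Qed.

Lemma lin_bound (l : V -> R) (B d : R) : 0 < d -> linr l ->
  (forall h, `|h| = d -> `|l h| <= B) -> forall h, `|l h| <= B * (`|h| / d).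
Proof.
move=> d0 ll H h; have [->|h0] := eqVneq h 0.
  by rewrite (linr0 ll) !normr0 mul0r mulr0.
have hp : 0 < `|h| by rewrite normr_gt0.
have c0 : 0 <= d / `|h| by rewrite divr_ge0 // ltW.
have /H : `|(d / `|h|) *: h| = d.
  by rewrite normrZ ger0_norm // divfK // gt_eqF.
rewrite (linrZ _ _ ll) normrM (ger0_norm c0) => H1.
have -> : `|l h| = (d / `|h| * `|l h|) * (`|h| / d).
  by field; rewrite !gt_eqF.
by apply: ler_wpM2r H1; rewrite divr_ge0 // ltW.
Qed.

(** A polynomial of degree at most 3 without constant term, stored as forms whose diagonal values
    are its homogeneous parts. The factorials are absorbed: [jq J e e] is half a second derivative.
    Non-symmetric forms are allowed, which keeps pullbacks and [int_jet] elementary. *)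
Record jet := Jet {
  jl : V -> R; jq : V -> V -> R; jt : V -> V -> V -> R;
  jl_lin : linr jl;
  jq_lin1 : forall v, linr (jq^~ v);
  jq_lin2 : forall u, linr (jq u);
  jt_lin1 : forall v w, linr (fun u => jt u v w);
  jt_lin2 : forall u w, linr (fun v => jt u v w);
  jt_lin3 : forall u v, linr (jt u v) }.

Definition tay (J : jet) (h : V) : R := jl J h + jq J h h + jt J h h h.

Definition jet_bounded (K : R) (J : jet) : Prop := forall h,
  [/\ `|jl J h| <= K * `|h|, `|jq J h h| <= K * `|h| ^+ 2 & `|jt J h h h| <= K * `|h| ^+ 3].

Lemma jqDl (J : jet) u v w : jq J (u + v) w = jq J u w + jq J v w.
Proof. exact: linrD (jq_lin1 J w). Qed.
Lemma jqDr (J : jet) u v w : jq J w (u + v) = jq J w u + jq J w v.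
Proof. exact: linrD (jq_lin2 J w). Qed.
Lemma jqZl (J : jet) c v w : jq J (c *: v) w = c * jq J v w.
Proof. exact: linrZ (jq_lin1 J w). Qed.
Lemma jqZr (J : jet) c v w : jq J w (c *: v) = c * jq J w v.
Proof. exact: linrZ (jq_lin2 J w). Qed.
Lemma jtD1 (J : jet) a b u v : jt J (a + b) u v = jt J a u v + jt J b u v.
Proof. exact: linrD (jt_lin1 J u v). Qed.
Lemma jtD2 (J : jet) a b u v : jt J u (a + b) v = jt J u a v + jt J u b v.
Proof. exact: linrD (jt_lin2 J u v). Qed.
Lemma jtD3 (J : jet) a b u v : jt J u v (a + b) = jt J u v a + jt J u v b.
Proof. exact: linrD (jt_lin3 J u v). Qed.
Lemma jtZ1 (J : jet) c a u v : jt J (c *: a) u v = c * jt J a u v.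
Proof. exact: linrZ (jt_lin1 J u v). Qed.
Lemma jtZ2 (J : jet) c a u v : jt J u (c *: a) v = c * jt J u a v.
Proof. exact: linrZ (jt_lin2 J u v). Qed.
Lemma jtZ3 (J : jet) c a u v : jt J u v (c *: a) = c * jt J u v a.
Proof. exact: linrZ (jt_lin3 J u v). Qed.
Lemma jlD (J : jet) u v : jl J (u + v) = jl J u + jl J v.
Proof. exact: linrD (jl_lin J). Qed.
Lemma jlZ (J : jet) c u : jl J (c *: u) = c * jl J u.
Proof. exact: linrZ (jl_lin J). Qed.

Definition jetE := (jlD, jlZ, jqDl, jqDr, jqZl, jqZr, jtD1, jtD2, jtD3, jtZ1, jtZ2, jtZ3).

Lemma tayZ (J : jet) c h :
  tay J (c *: h) = c * jl J h + c ^+ 2 * jq J h h + c ^+ 3 * jt J h h h.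
Proof. by rewrite /tay !jetE; ring. Qed.

Lemma tay0 J : tay J 0 = 0.
Proof. by rewrite -(scale0r 0) tayZ !expr0n /= !mul0r !addr0. Qed.

Definition jmap (c : R) (A : V -> V) (lA : lin A) (J : jet) : jet.
refine (@Jet (fun h => c * jl J (A h)) (fun u v => c * jq J (A u) (A v))
  (fun u v w => c * jt J (A u) (A v) (A w)) _ _ _ _ _ _);
  rewrite /linr; intros; rewrite ?lA !jetE /=; ring.
Defined.

Definition jcomb (c : R) (J1 J2 : jet) : jet.
refine (@Jet (fun h => c * jl J1 h + jl J2 h) (fun u v => c * jq J1 u v + jq J2 u v)
  (fun u v w => c * jt J1 u v w + jt J2 u v w) _ _ _ _ _ _);
  rewrite /linr; intros; rewrite !jetE /=; ring.
Defined.

Definition jaffsqr (c : R) (l : V -> R) (ll : linr l) : jet.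
refine (@Jet (fun h => 2 * c * l h) (fun u v => l u * l v) (fun _ _ _ => 0) _ _ _ _ _ _);
  rewrite /linr; intros; rewrite ?ll /=; ring.
Defined.

Lemma tay_jmap c A (lA : lin A) J h : tay (jmap c lA J) h = c * tay J (A h).
Proof. by rewrite /tay /=; ring. Qed.

Lemma tay_jcomb c J1 J2 h : tay (jcomb c J1 J2) h = c * tay J1 h + tay J2 h.
Proof. by rewrite /tay /=; ring. Qed.

Lemma tay_jaffsqr c l (ll : linr l) h : tay (jaffsqr c ll) h = (c + l h) ^+ 2 - c ^+ 2.
Proof. by rewrite /tay /=; ring. Qed.

Lemma lin_scale (c : R) : lin (fun v : V => c *: v).
Proof. by move=> a u v; rewrite scalerDr !scalerA mulrC. Qed.

(* The values at h, -h, h/2 and -h/2 determine the three homogeneous components. *)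
Lemma jet_coef (J : jet) (a B d : R) : 0 < d ->
  (forall h, `|h| <= d -> `|a + tay J h| <= B) -> forall h,
  [/\ `|jl J h| <= 8 * B * (`|h| / d), `|jq J h h| <= 8 * B * (`|h| / d) ^+ 2 &
      `|jt J h h h| <= 8 * B * (`|h| / d) ^+ 3].
Proof.
move=> d0 H h; have [->|h0] := eqVneq h 0.
  rewrite -(scale0r 0) !jetE !mul0r normr0 scale0r !normr0 !mul0r ?expr0n /= !mulr0.
  by split.
have hp : 0 < `|h| by rewrite normr_gt0.
pose c := d / `|h|; have c0 : 0 < c by rewrite divr_gt0.
have key e : `|e| <= 1 -> `|a + tay J ((e * c) *: h)| <= B.
  move=> e1; apply: H; rewrite normrZ normrM (ger0_norm (ltW c0)) /c -mulrA.
  by rewrite divfK ?gt_eqF // ler_piMl // ltW.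
have k1 := key 1 _; have k2 := key (-1) _.
have k3 := key (2^-1) _; have k4 := key (- 2^-1) _.
have kk : `|h| / d = c^-1 by rewrite /c invf_div.
have {}k1 : `|a + tay J ((1 * c) *: h)| <= B by apply: k1; rewrite normr1.
have {}k2 : `|a + tay J ((-1 * c) *: h)| <= B by apply: k2; rewrite normrN1.
have {}k3 : `|a + tay J ((2^-1 * c) *: h)| <= B by apply: k3; rewrite ger0_norm; lra.
have {}k4 : `|a + tay J ((- 2^-1 * c) *: h)| <= B.
  by apply: k4; rewrite normrN ger0_norm; lra.
have cn : c != 0 by rewrite gt_eqF.
pose L := c * jl J h; pose Q := c ^+ 2 * jq J h h; pose T := c ^+ 3 * jt J h h h.
have EL : jl J h = L * c^-1 by rewrite /L; field.
have EQ : jq J h h = Q * c^-1 ^+ 2 by rewrite /Q; field.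
have ET : jt J h h h = T * c^-1 ^+ 3 by rewrite /T; field.
have Ee e : tay J ((e * c) *: h) = e * L + e ^+ 2 * Q + e ^+ 3 * T.
  by rewrite tayZ /L /Q /T; ring.
rewrite !Ee in k1 k2 k3 k4.
move: k1 k2 k3 k4; do 4 (rewrite ler_norml => /andP[? ?]).
have ci : 0 <= c^-1 by rewrite invr_ge0 ltW.
rewrite kk EL EQ ET; split; rewrite normrM [X in _ * X <= _]ger0_norm ?exprn_ge0 //;
  apply: ler_wpM2r; rewrite ?exprn_ge0 //; rewrite ler_norml; lra.
Qed.

End Linear.

(** * Normalised first-order expansions and their calculus *)

Section Gap.
Context {R : realType} {n : nat}.
Local Notation V := 'rV[R]_n.

(* The first-order Taylor expansion of g at x with exponent sg, normalised to the length scale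
   rho: after rescaling rho to 1 all its constants are K. *)
Definition gap (K rho sg : R) (g : V -> R) (x : V) := exists l : V -> R,
  [/\ linr l, `|g x| <= K, (forall h, `|l h| <= K * (`|h| / rho)) &
      forall h, `|h| <= rho -> `|g (x + h) - g x - l h| <= K * (`|h| / rho) `^ sg].

Lemma div_itv (a b : R) : 0 < b -> 0 <= a -> a <= b -> 0 <= a / b <= 1.
Proof. move=> b0 a0 ab; apply/andP; split; first by apply: divr_ge0 => //; exact: ltW.
by rewrite ler_pdivrMr // mul1r. Qed.

Lemma gap_ge0 K rho sg g x : gap K rho sg g x -> 0 <= K.
Proof. by case=> l [_ gK _ _]; apply: le_trans gK. Qed.

Lemma gap_le K K' rho sg g x : 0 < rho -> K <= K' ->
  gap K rho sg g x -> gap K' rho sg g x.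
Proof.
move=> r0 KK [l [ll gK lK eK]]; exists l; split => // [|h|h hr].
- exact: le_trans KK.
- by apply: le_trans (lK h) _; apply: ler_wpM2r => //; rewrite divr_ge0 // ltW.
- by apply: le_trans (eK h hr) _; apply: ler_wpM2r => //; rewrite powR_ge0.
Qed.

Lemma gap_shrink K rho rho' sg g x : 0 < rho' <= rho -> 0 <= sg ->
  gap K rho sg g x -> gap K rho' sg g x.
Proof.
move=> /andP[r0 rr] s0 gp; have K0 := gap_ge0 gp.
case: gp => l [ll gK lK eK]; have r1 := lt_le_trans r0 rr.
have dv h : `|h : V| / rho <= `|h| / rho'.
  by apply: ler_wpM2l => //; rewrite lef_pV2.
exists l; split => // [h|h hr].
  by apply: le_trans (lK h) _; apply: ler_wpM2l.
apply: le_trans (eK h (le_trans hr rr)) _; apply: ler_wpM2l => //.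
by apply: powR_mono => //; rewrite divr_ge0 // ltW.
Qed.

Lemma gap_ord K rho sg sg' g x : 0 < rho -> 0 < sg' <= sg ->
  gap K rho sg g x -> gap K rho sg' g x.
Proof.
move=> r0 ss gp; have K0 := gap_ge0 gp.
case: gp => l [ll gK lK eK]; exists l; split => // h hr.
apply: le_trans (eK h hr) _; apply: ler_wpM2l => //.
by apply: powR_antimono => //; apply: div_itv.
Qed.

Lemma gap_ext K rho sg g g' x : 0 < rho -> (forall h, `|h| <= rho -> g (x + h) = g' (x + h)) ->
  gap K rho sg g x -> gap K rho sg g' x.
Proof.
move=> r0 E [l [ll gK lK eK]]; have E0 : g x = g' x by have := E 0; rewrite normr0 addr0 => ->; rewrite ?ltW.
by exists l; split => // [|h hr]; rewrite -E0 // -E // eK.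
Qed.

Lemma gap_const K rho sg (c : R) x : 0 < rho -> `|c| <= K -> gap K rho sg (fun=> c) x.
Proof.
move=> r0 cK; have K0 := le_trans (normr_ge0 c) cK.
exists (fun=> 0); split => // [a u v|h|h _]; first by rewrite mulr0 addr0.
  by rewrite normr0 mulr_ge0 // divr_ge0 // ltW.
by rewrite subrr subr0 normr0 mulr_ge0 // powR_ge0.
Qed.

Lemma gap_add K1 K2 rho sg g1 g2 x : gap K1 rho sg g1 x -> gap K2 rho sg g2 x ->
  gap (K1 + K2) rho sg (fun y => g1 y + g2 y) x.
Proof.
move=> [l1 [ll1 gK1 lK1 eK1]] [l2 [ll2 gK2 lK2 eK2]].
exists (fun h => l1 h + l2 h); split => [a u v||h|h hr].
- by rewrite ll1 ll2; ring.
- by apply: le_trans (ler_normD _ _) _; apply: lerD.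
- by apply: le_trans (ler_normD _ _) _; rewrite mulrDl; apply: lerD.
- have -> : g1 (x + h) + g2 (x + h) - (g1 x + g2 x) - (l1 h + l2 h) =
    (g1 (x + h) - g1 x - l1 h) + (g2 (x + h) - g2 x - l2 h) by ring.
  by apply: le_trans (ler_normD _ _) _; rewrite mulrDl; apply: lerD; auto.
Qed.

Lemma gap_sum (I : Type) (r : seq I) K rho sg (g : I -> V -> R) x : 0 < rho ->
  (forall i, gap K rho sg (g i) x) ->
  gap (K *+ size r) rho sg (fun y => \sum_(i <- r) g i y) x.
Proof.
move=> r0 H; elim: r => [|i r IH].
  apply: (gap_ext (g := fun=> 0)) => // [h _|]; first by rewrite big_nil.
  by apply: gap_const => //; rewrite normr0 mulr0n.
rewrite /= mulrS; apply: gap_ext (gap_add (H i) IH) => // h _.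
by rewrite big_cons.
Qed.

(** The remainder of a product is a sum of six products, each at most K1 K2 t^sg with t = |h|/rho <=
    1. For the product of the two linear parts this is t^2 <= t^sg, hence the condition
    [sg <= 2]. *)
Lemma gap_mul K1 K2 rho sg g1 g2 x : 0 < rho -> 0 < sg <= 2 ->
  gap K1 rho sg g1 x -> gap K2 rho sg g2 x ->
  gap (6 * (K1 * K2)) rho sg (fun y => g1 y * g2 y) x.
Proof.
move=> r0 s2 gp1 gp2; have K10 := gap_ge0 gp1; have K20 := gap_ge0 gp2.
case: gp1 gp2 => l1 [ll1 gK1 lK1 eK1] [l2 [ll2 gK2 lK2 eK2]].
have KK : 0 <= K1 * K2 by rewrite mulr_ge0.
have pm (a b u v : R) : `|a| <= u -> `|b| <= v -> `|a * b| <= u * v.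
  by move=> au bv; rewrite normrM; apply: ler_pM.
exists (fun h => g1 x * l2 h + g2 x * l1 h); split => [a u v||h|h hr].
- by rewrite ll1 ll2; ring.
- by apply: le_trans (pm _ _ _ _ gK1 gK2) _; lra.
- have t0 : 0 <= `|h| / rho by rewrite divr_ge0 // ltW.
  have p1 := pm _ _ _ _ gK1 (lK2 h); have p2 := pm _ _ _ _ gK2 (lK1 h).
  apply: le_trans (ler_normD _ _) _; apply: le_trans (lerD p1 p2) _.
  have : 0 <= K1 * K2 * (`|h| / rho) by rewrite mulr_ge0.
  set t := `|h| / rho; rewrite -subr_ge0 => H; rewrite -subr_ge0.
  have -> : 6 * (K1 * K2) * t - (K1 * (K2 * t) + K2 * (K1 * t)) = 4 * (K1 * K2 * t).
    by ring.
  by rewrite subr0 in H; lra.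
- have /andP[t0 t1] := div_itv r0 (normr_ge0 h) hr.
  have p2 : (`|h| / rho) ^+ 2 <= (`|h| / rho) `^ sg.
    by rewrite -powR_nat //; apply: powR_antimono; rewrite ?t0 ?t1.
  have p1 : (`|h| / rho) `^ sg <= 1.
    by apply: powR_le1; rewrite ?t0 ?t1 //; case/andP: s2 => /ltW.
  have p0 : 0 <= (`|h| / rho) `^ sg by rewrite powR_ge0.
  have {eK1} e1 := eK1 h hr; have {eK2} e2 := eK2 h hr.
  have {lK1} L1 := lK1 h; have {lK2} L2 := lK2 h.
  move: p2 p1 p0 t0 t1 e1 e2 L1 L2.
  set t := `|h| / rho; set p := t `^ sg => p2 p1 p0 t0 t1.
  set a1 := g1 x; set a2 := g2 x; set b1 := l1 h; set b2 := l2 h.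
  set E1 := _ - b1; set E2 := _ - b2 => e1 e2 L1 L2.
  have -> : g1 (x + h) * g2 (x + h) - a1 * a2 - (a1 * b2 + a2 * b1) =
    b1 * b2 + a1 * E2 + a2 * E1 + b1 * E2 + b2 * E1 + E1 * E2.
    by rewrite /E1 /E2 -/a1 -/a2; ring.
  have q1 := pm _ _ _ _ L1 L2; have q2 := pm _ _ _ _ gK1 e2.
  have q3 := pm _ _ _ _ gK2 e1; have q4 := pm _ _ _ _ L1 e2.
  have q5 := pm _ _ _ _ L2 e1; have q6 := pm _ _ _ _ e1 e2.
  do 5 (apply: le_trans (ler_normD _ _) _; rewrite -lerBrDr).
  apply: le_trans q1 _; rewrite -!lerBlDr.
  have w1 : 0 <= K1 * K2 * (p - t ^+ 2) by rewrite mulr_ge0 // subr_ge0.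
  have w2 : 0 <= K1 * K2 * (p * (1 - t)) by rewrite !mulr_ge0 // subr_ge0.
  have w3 : 0 <= K1 * K2 * (p * (1 - p)) by rewrite !mulr_ge0 // subr_ge0.
  nra.
Qed.

Lemma gap_scale K rho sg (c r : R) g (z u : V) : 0 < r -> 0 < rho ->
  gap K rho sg g u ->
  gap (`|c| * K) (r * rho) sg (fun x => c * g (r^-1 *: (x - z))) (z + r *: u).
Proof.
move=> r0 rr [l [ll gK lK eK]]; have rn : r != 0 by rewrite gt_eqF.
have nr h : `|r^-1 *: h : V| / rho = `|h| / (r * rho).
  by rewrite normrZ ger0_norm ?invr_ge0 ?ltW // invfM; ring.
have e0 : r^-1 *: (z + r *: u - z) = u by rewrite addrC addKr scalerA mulVf // scale1r.
exists (fun h => c * l (r^-1 *: h)); split => [a v w||h|h hr].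
- by rewrite scalerDr scalerA (mulrC r^-1 a) -scalerA ll; ring.
- by rewrite e0 normrM ler_wpM2l.
- by rewrite normrM -mulrA ler_wpM2l // -nr.
- rewrite e0.
  have -> : z + r *: u + h - z = r *: u + h by rewrite -[z + _ + h]addrA [LHS]addrC addKr.
  rewrite scalerDr scalerA mulVf // scale1r -!mulrBr normrM -mulrA ler_wpM2l // -nr.
  apply: eK; rewrite -[leRHS]mul1r -ler_pdivrMr // nr.
  by rewrite ler_pdivrMr ?mulr_gt0 // mul1r.
Qed.

(** [G] is the root of a perturbed square. Since [(u0 + l) ^+ 2] is kept whole, only the
    perturbation contributes to the error, which has size [ep / u0] and not [u0]. The proof compares
    [G] with the affine guess [A] through their squares and divides by [G + A], which is at least a
    multiple of [u0]. *)
Lemma sqrt_scalar (u0 l e0 e1 E2 ep t G0 G : R) : 0 < u0 -> 0 <= t <= 1 ->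
  `|l| <= u0 * t / 2 -> `|e0| <= ep -> `|e1| <= ep * t -> `|E2| <= ep * t ^+ 2 ->
  ep <= u0 ^+ 2 / 16 -> 0 <= G0 -> 0 <= G -> G0 ^+ 2 = u0 ^+ 2 + e0 ->
  G ^+ 2 = (u0 + l) ^+ 2 + e0 + e1 + E2 ->
  `|G - G0 - (2 * u0 * l + e1) / (2 * G0)| <= 8 * (ep / u0) * t ^+ 2.
Proof.
move=> u00 /andP[t0 t1] lb e0b e1b E2b epb G00 Gg0 HG0 HG.
have ep0 : 0 <= ep := le_trans (normr_ge0 _) e0b.
pose v := u0 ^+ 2; have v0 : 0 < v by rewrite exprn_gt0.
have G0v : 15 / 16 * v <= G0 ^+ 2 <= 17 / 16 * v.
  by rewrite HG0 -/v; move: e0b; rewrite ler_norml => /andP[? ?]; rewrite -/v in epb; lra.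
have [G0l G0u] : 9 / 10 * u0 <= G0 /\ G0 <= 11 / 10 * u0.
  case/andP: G0v; rewrite /v => A B.
  by split; [rewrite -(@ler_pXn2r _ 2%N) // ?nnegrE; nra|rewrite -(@ler_pXn2r _ 2%N) // ?nnegrE; nra].
have G0p : 0 < G0 by lra.
pose N := 2 * u0 * l + e1.
pose A := G0 + N / (2 * G0).
have Nb : `|N| <= v * t + ep * t.
  rewrite /N; apply: le_trans (ler_normD _ _) _; apply: lerD => //.
  rewrite normrM ger0_norm; last by lra.
  by rewrite /v; nra.
have Ab : 3 / 8 * u0 <= A.
  rewrite /A; have : `|N / (2 * G0)| <= 17 / 30 * G0.
    rewrite normrM normfV (ger0_norm (x := 2 * G0)); last by lra.
    rewrite ler_pdivrMr; last by lra.
    apply: le_trans Nb _; rewrite -/v in epb.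
    have : v * t + ep * t <= v + ep by nra.
    by move=> H; apply: le_trans H _; move/andP: G0v => [? _]; lra.
  by rewrite ler_norml => /andP[? ?]; lra.
have key : `|G ^+ 2 - A ^+ 2| <= 2 * ep * t ^+ 2.
  have G02 : 0 < G0 ^+ 2 by rewrite exprn_gt0.
  (* The terms that are quadratic in [l] alone cancel. What remains contains [e0], [e1] or [E2] and
     is therefore bounded by a multiple of [ep * t ^+ 2]. *)
  have -> : G ^+ 2 - A ^+ 2 = E2 + (l ^+ 2 * e0 - u0 * l * e1 - e1 ^+ 2 / 4) / G0 ^+ 2.
    have -> : A ^+ 2 = G0 ^+ 2 + N + N ^+ 2 / (4 * G0 ^+ 2).
      by rewrite /A; field; rewrite gt_eqF.
    have -> : e0 = G0 ^+ 2 - u0 ^+ 2 by rewrite HG0; ring.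
    by rewrite HG HG0 /N; rewrite HG0 in G02; field; rewrite gt_eqF.
  apply: le_trans (ler_normD _ _) _; rewrite normrM normfV (ger0_norm (ltW G02)).
  have ept : 0 <= ep * t ^+ 2 by rewrite mulr_ge0 // exprn_ge0.
  suff H : `|l ^+ 2 * e0 - u0 * l * e1 - e1 ^+ 2 / 4| <= ep * t ^+ 2 * G0 ^+ 2.
    by move: H; rewrite -ler_pdivrMr // => H; lra.
  have b1 : `|l ^+ 2 * e0| <= (u0 * t / 2) ^+ 2 * ep.
    by rewrite normrM normrX; apply: ler_pM => //; rewrite ?exprn_ge0 // lerXn2r // nnegrE // (le_trans _ lb).
  have b2 : `|u0 * l * e1| <= u0 * (u0 * t / 2) * (ep * t).
    rewrite !normrM (ger0_norm (ltW u00)); apply: ler_pM => //; first by rewrite mulr_ge0 // ltW.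
    by apply: ler_wpM2l => //; exact: ltW.
  have b3 : `|e1 ^+ 2 / 4| <= (ep * t) ^+ 2 / 4.
    rewrite normrM normrX (ger0_norm (x := 4^-1)) //; apply: ler_wpM2r => //.
    by rewrite lerXn2r // nnegrE // (le_trans _ e1b).
  apply: le_trans (ler_normB _ _) _; apply: le_trans (lerD (ler_normB _ _) (lexx _)) _.
  apply: le_trans (lerD (lerD b1 b2) b3) _.
  have -> : (u0 * t / 2) ^+ 2 * ep + u0 * (u0 * t / 2) * (ep * t) + (ep * t) ^+ 2 / 4 =
    ep * t ^+ 2 * (3 / 4 * v + ep / 4) by rewrite /v; field.
  by apply: ler_wpM2l => //; move/andP: G0v => [? _]; rewrite -/v in epb; lra.
have GA : `|G - A| * (3 / 8 * u0) <= 2 * ep * t ^+ 2.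
  apply: le_trans key; rewrite subr_sqr normrM; apply: ler_wpM2l => //.
  by rewrite ger0_norm; lra.
have -> : G - G0 - (2 * u0 * l + e1) / (2 * G0) = G - A by rewrite /A /N; ring.
have -> : 8 * (ep / u0) * t ^+ 2 = (8 * ep * t ^+ 2) / u0 by ring.
rewrite ler_pdivlMr //.
have : 0 <= ep * t ^+ 2 by rewrite mulr_ge0 // exprn_ge0.
lra.
Qed.

End Gap.

Section Gap2.
Context {R : realType} {n : nat}.
Local Notation V := 'rV[R]_n.

(** On the ball of radius [c * rho] the linear part and the remainder are each at most [b / 16], so
    the root is taken away from 0. [sqrt_scalar] applies without affine part, [l h] playing the role
    of [e1]. *)
Lemma gap_sqrt (K b : R) : 0 < b -> exists C c : R, 0 < c <= 1 /\
  forall (g : V -> R) (x : V) rho, 0 < rho -> gap K rho 2 g x -> b <= g x ->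
  (forall h, `|h| <= rho -> 0 <= g (x + h)) ->
  gap C (c * rho) 2 (fun y => Num.sqrt (g y)) x.
Proof.
move=> b0; pose K1 := `|K| + 1; have K10 : 0 < K1 by rewrite ltr_wpDl.
pose c := Num.min 1 (b / (16 * K1)).
have c0 : 0 < c by rewrite lt_min ltr01 divr_gt0 // mulr_gt0.
have c1 : c <= 1 by rewrite ge_min lexx.
have cK : K1 * c <= b / 16.
  have : c <= b / (16 * K1) by rewrite ge_min lexx orbT.
  by rewrite ler_pdivlMr ?mulr_gt0 // => ?; lra.
have sb0 : 0 < Num.sqrt b by rewrite sqrtr_gt0.
pose C := K1 + K1 / Num.sqrt b + 8 * (K1 / Num.sqrt b).
have Ksb : 0 <= K1 / Num.sqrt b by rewrite divr_ge0 // ltW.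
exists C, c; split => [|g x rho r0 gp bg gpos]; first by rewrite c0.
have gp1 : gap K1 rho 2 g x.
  by apply: gap_le gp => //; rewrite /K1; apply: le_trans (ler_norm K) _; rewrite lerDl.
case: gp1 => l [ll gK lK eK].
have gx0 : 0 < g x := lt_le_trans b0 bg.
have u0 : 0 < Num.sqrt (g x) by rewrite sqrtr_gt0.
have sbu : Num.sqrt b <= Num.sqrt (g x) by apply: ler_wsqrtr.
have cr0 : 0 < c * rho by rewrite mulr_gt0.
have scl h : `|h : V| / rho = c * (`|h| / (c * rho)) by field; rewrite !gt_eqF.
have inv : (Num.sqrt (g x))^-1 <= (Num.sqrt b)^-1 by rewrite lef_pV2.
exists (fun h => l h / (2 * Num.sqrt (g x))); split => [a u v||h|h hr].
- by rewrite ll; field; rewrite gt_eqF.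
- rewrite ger0_norm ?sqrtr_ge0 //; apply: (@le_trans _ _ (K1)).
    rewrite -(@ler_pXn2r _ 2%N) // ?nnegrE ?sqrtr_ge0 ?(ltW K10) // sqr_sqrtr ?(ltW gx0) //.
    apply: le_trans (ler_norm _) _; apply: le_trans gK _.
    by rewrite expr2 ler_peMl ?(ltW K10) // /K1 lerDr.
  by rewrite /C; lra.
- have t0 : 0 <= `|h| / (c * rho) by rewrite divr_ge0 // ltW.
  rewrite normrM normfV (ger0_norm (x := 2 * _)); last by rewrite mulr_ge0 // ltW.
  apply: (@le_trans _ _ (K1 / Num.sqrt b * (`|h| / (c * rho)))); last first.
    by apply: ler_wpM2r => //; rewrite /C; lra.
  rewrite mulrAC; apply: ler_pM; rewrite ?invr_ge0 ?mulr_ge0 ?(ltW u0) //.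
    apply: le_trans (lK h) _; rewrite scl; apply: ler_wpM2l; first exact: ltW.
    by rewrite ler_piMl.
  apply: le_trans inv; rewrite lef_pV2 ?posrE ?mulr_gt0 //.
  by rewrite ler_peMl ?(ltW u0) // ler1n.
- have hr1 : `|h| <= rho by apply: le_trans hr _; rewrite ler_piMl // ltW.
  have t01 := div_itv cr0 (normr_ge0 h) hr; have /andP[t0 t1] := t01.
  have gh0 := gpos h hr1.
  rewrite [X in _ <= _ * X]powR_nat //.
  set t := `|h| / (c * rho) in t0 t1 t01 *.
  pose E2 := g (x + h) - g x - l h.
  have H := @sqrt_scalar R (Num.sqrt (g x)) 0 0 (l h) E2 (K1 * c) t
     (Num.sqrt (g x)) (Num.sqrt (g (x + h))) u0 t01.
  have {}H : `|Num.sqrt (g (x + h)) - Num.sqrt (g x) - l h / (2 * Num.sqrt (g x))| <=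
     8 * (K1 * c / Num.sqrt (g x)) * t ^+ 2.
    rewrite -[l h in X in `|X|]add0r -[X in (X + l h) / _](mulr0 (2 * Num.sqrt (g x))).
    apply: H; rewrite ?normr0 ?sqrtr_ge0 ?addr0 ?sqr_sqrtr ?(ltW gx0) //.
    + by nng.
    + by nng.
    + by apply: le_trans (lK h) _; rewrite scl mulrA.
    + apply: le_trans (eK h hr1) _; rewrite powR_nat ?divr_ge0 ?(ltW r0) // scl -/t.
      rewrite exprMn mulrA; apply: ler_wpM2r; first by rewrite exprn_ge0.
      by apply: ler_wpM2l; [exact: ltW|rewrite expr2 ler_piMl // ltW].
    + by apply: le_trans cK _; apply: ler_wpM2r.
    + by rewrite /E2; ring.
  apply: le_trans H _; apply: ler_wpM2r; first by rewrite exprn_ge0.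
  apply: (@le_trans _ _ (8 * (K1 / Num.sqrt b))); last by rewrite /C; lra.
  apply: ler_wpM2l => //; apply: ler_pM; rewrite ?invr_ge0 ?mulr_ge0 ?(ltW u0) ?(ltW c0) ?(ltW K10) //.
  by rewrite ler_piMr // ltW.
Qed.

(** The scale is shrunk until [g] stays above [b / 2]; the exact formula for the difference of the
    inverses then isolates the remainder of [g] and the square of its increment. *)
Lemma gap_inv (K b : R) : 0 < b -> exists C c : R, 0 < c <= 1 /\
  forall (g : V -> R) (x : V) rho, 0 < rho -> gap K rho 2 g x -> b <= g x ->
  gap C (c * rho) 2 (fun y => (g y)^-1) x.
Proof.
move=> b0; pose K1 := `|K| + 1; have K10 : 0 < K1 by rewrite ltr_wpDl.
pose c := Num.min 1 (b / (4 * K1)).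
have c0 : 0 < c by rewrite lt_min ltr01 divr_gt0 // mulr_gt0.
have c1 : c <= 1 by rewrite ge_min lexx.
have cK : K1 * c <= b / 4.
  have : c <= b / (4 * K1) by rewrite ge_min lexx orbT.
  by rewrite ler_pdivlMr ?mulr_gt0 // => ?; lra.
pose C := b^-1 + K1 / b ^+ 2 + 8 * (K1 ^+ 2 / b ^+ 3).
have b10 : 0 <= b^-1 by rewrite invr_ge0 ltW.
have b20 : 0 <= K1 / b ^+ 2 by rewrite divr_ge0 ?exprn_ge0 // ltW.
have b30 : 0 <= K1 ^+ 2 / b ^+ 3 by rewrite divr_ge0 ?exprn_ge0 // ltW.
exists C, c; split => [|g x rho r0 gp bg]; first by rewrite c0.
have gp1 : gap K1 rho 2 g x.
  by apply: gap_le gp => //; rewrite /K1; apply: le_trans (ler_norm K) _; rewrite lerDl.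
case: gp1 => l [ll gK lK eK].
have gx0 : 0 < g x := lt_le_trans b0 bg.
have cr0 : 0 < c * rho by rewrite mulr_gt0.
have scl h : `|h : V| / rho = c * (`|h| / (c * rho)) by field; rewrite !gt_eqF.
have inv : (g x)^-1 <= b^-1 by rewrite lef_pV2.
have inv2 : (g x ^+ 2)^-1 <= (b ^+ 2)^-1.
  by rewrite lef_pV2 ?posrE ?exprn_gt0 // lerXn2r // nnegrE ltW.
exists (fun h => - (l h / g x ^+ 2)); split => [a u v||h|h hr].
- by rewrite ll; field; rewrite gt_eqF.
- by rewrite ger0_norm ?invr_ge0 ?(ltW gx0) //; apply: le_trans inv _; rewrite /C; lra.
- have t0 : 0 <= `|h| / (c * rho) by rewrite divr_ge0 // ltW.
  rewrite normrN normrM normfV (ger0_norm (x := g x ^+ 2)); last by rewrite exprn_ge0 // ltW.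
  apply: (@le_trans _ _ (K1 / b ^+ 2 * (`|h| / (c * rho)))); last first.
    by apply: ler_wpM2r => //; rewrite /C; lra.
  rewrite mulrAC; apply: ler_pM; rewrite ?invr_ge0 ?exprn_ge0 ?(ltW gx0) //.
  apply: le_trans (lK h) _; rewrite scl; apply: ler_wpM2l; first exact: ltW.
  by rewrite ler_piMl.
- have hr1 : `|h| <= rho by apply: le_trans hr _; rewrite ler_piMl // ltW.
  have t01 := div_itv cr0 (normr_ge0 h) hr; have /andP[t0 t1] := t01.
  rewrite [X in _ <= _ * X]powR_nat //.
  have eh := eK h hr1; have lh := lK h.
  rewrite powR_nat ?divr_ge0 ?(ltW r0) // in eh.
  rewrite !scl in eh lh; rewrite exprMn in eh.
  set t := `|h| / (c * rho) in t0 t1 t01 eh lh *.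
  set E2 := g (x + h) - g x - l h in eh.
  have dE : g (x + h) = g x + (l h + E2) by rewrite /E2; ring.
  have E2t : `|E2| <= K1 * t ^+ 2.
    apply: le_trans eh _; apply: ler_wpM2l; first exact: ltW.
    by rewrite ler_piMl ?exprn_ge0 // expr_le1 // ltW.
  have E2c : `|E2| <= K1 * c * t.
    apply: le_trans eh _; rewrite -mulrA; apply: ler_wpM2l; first exact: ltW.
    by apply: ler_pM; rewrite ?exprn_ge0 ?(ltW c0) // expr2 ler_piMl // ltW.
  have dlt : `|l h + E2| <= 2 * K1 * c * t.
    by apply: le_trans (ler_normD _ _) _; rewrite mulrA in lh; lra.
  have dlt2 : `|l h + E2| <= b / 2.
    apply: le_trans dlt _; have : K1 * c * t <= K1 * c.
      by rewrite ler_piMr // mulr_ge0 // ltW.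
    by lra.
  have gh : b / 2 <= g (x + h).
    by rewrite dE; move: dlt2; rewrite ler_norml => /andP[? _]; lra.
  have gh0 : 0 < g (x + h) by apply: lt_le_trans gh; rewrite divr_gt0.
  have -> : (g (x + h))^-1 - (g x)^-1 - - (l h / g x ^+ 2) =
     - (E2 / g x ^+ 2) + (l h + E2) ^+ 2 / (g x ^+ 2 * g (x + h)).
    by rewrite dE; field; rewrite -dE !gt_eqF.
  have nE2 : `|(l h + E2) ^+ 2| = `|l h + E2| ^+ 2 by rewrite normrX.
  have ng2 : `|g x ^+ 2| = g x ^+ 2 by rewrite ger0_norm // exprn_ge0 // ltW.
  apply: le_trans (ler_normD _ _) _; rewrite normrN (normrM E2) normfV ng2.
  rewrite (normrM ((l h + E2) ^+ 2)) normfV (normrM (g x ^+ 2)) nE2 ng2.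
  rewrite (ger0_norm (ltW gh0)).
  have A1 : `|E2| / g x ^+ 2 <= K1 * t ^+ 2 / b ^+ 2.
    by apply: ler_pM; rewrite ?invr_ge0 ?exprn_ge0 ?(ltW gx0).
  have A2 : `|l h + E2| ^+ 2 / (g x ^+ 2 * g (x + h)) <= (2 * K1 * t) ^+ 2 / (b ^+ 2 * (b / 2)).
    apply: ler_pM; rewrite ?invr_ge0 ?mulr_ge0 ?exprn_ge0 ?(ltW gx0) ?(ltW gh0) //.
      apply: lerXn2r; rewrite ?nnegrE; [by nng|by nng|].
      apply: le_trans dlt _; apply: ler_wpM2r => //.
      by rewrite ler_piMr //; nng.
    rewrite lef_pV2 ?posrE ?mulr_gt0 ?exprn_gt0 ?divr_gt0 //.
    apply: ler_pM => //; rewrite ?exprn_ge0 ?divr_ge0 ?(ltW b0) //.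
    by rewrite lerXn2r // nnegrE ltW.
  apply: le_trans (lerD A1 A2) _.
  have -> : K1 * t ^+ 2 / b ^+ 2 + (2 * K1 * t) ^+ 2 / (b ^+ 2 * (b / 2)) =
     (K1 / b ^+ 2 + 8 * (K1 ^+ 2 / b ^+ 3)) * t ^+ 2 by field; rewrite gt_eqF.
  by apply: ler_wpM2r; [rewrite exprn_ge0|rewrite /C; lra].
Qed.

(* An expansion known on |h| <= rho about one affine function and on |h| >= rho about another
   holds throughout with the first: the two affine functions are close on the sphere |h| = rho. *)
Lemma affine_patch (g : V -> R) x (M sg rho r1 a b : R) (l m : V -> R) :
  0 < rho <= r1 -> 1 <= sg -> linr l -> linr m ->
  (forall h, `|h| <= rho -> `|g (x + h) - (a + l h)| <= M * `|h| `^ sg) ->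
  (forall h, rho <= `|h| <= r1 -> `|g (x + h) - (b + m h)| <= M * `|h| `^ sg) ->
  forall h, `|h| <= r1 -> `|g (x + h) - (a + l h)| <= 5 * M * `|h| `^ sg.
Proof.
move=> /andP[r0 rr] s1 ll lm HA HB h hr1.
have s0 : 0 <= sg by lra.
have [hr|/ltW hr] := leP `|h| rho.
  have H := HA h hr; apply: le_trans H _.
  have : 0 <= M * `|h| `^ sg by exact: le_trans (HA h hr).
  by lra.
have hp : 0 < `|h| by apply: lt_le_trans hr.
have on u : `|u| = rho -> `|a - b + (l u - m u)| <= 2 * (M * rho `^ sg).
  move=> ur; have H1 := HA u; have H2 := HB u; rewrite ur lexx in H1 H2.
  have -> : a - b + (l u - m u) = (g (x + u) - (b + m u)) - (g (x + u) - (a + l u)) by ring.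
  by apply: le_trans (ler_normB _ _) _; have := H1 isT; have := H2 rr; lra.
(* Taking [u] and [- u] separates the difference of the constants from the difference of the linear
   parts. *)
have two u : `|u| = rho -> `|a - b| <= 2 * (M * rho `^ sg) /\ `|l u - m u| <= 2 * (M * rho `^ sg).
  move=> ur; have := on _ ur; have := on (- u); rewrite normrN => /(_ ur).
  rewrite (linrN _ ll) (linrN _ lm) !ler_norml => /andP[? ?] /andP[? ?].
  by split; apply/andP; split; lra.
have ab : `|a - b| <= 2 * (M * rho `^ sg).
  apply: (proj1 (two ((rho / `|h|) *: h) _)).
  by rewrite normrZ ger0_norm ?divr_ge0 ?(ltW r0) // divfK // gt_eqF.
have lm2 : `|l h - m h| <= 2 * (M * rho `^ sg) * (`|h| / rho).
  apply: (@lin_bound _ _ (fun u => l u - m u)) => // [|u /two[]//].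
  by move=> c u v; rewrite ll lm; ring.
have M0 : 0 <= M.
  have := le_trans (normr_ge0 _) (HA 0 _); rewrite normr0 => _.
  have := le_trans (normr_ge0 _) ab; rewrite pmulr_rge0 // pmulr_lge0 // powR_gt0 //.
have k1 : rho `^ sg <= `|h| `^ sg by apply: powR_mono => //; exact: ltW.
(* Here [1 <= sg] matters: for |h| >= rho the ratio |h|/rho is at most its power of exponent
   [sg]. *)
have k2 : rho `^ sg * (`|h| / rho) <= `|h| `^ sg.
  have -> : `|h| `^ sg = rho `^ sg * (`|h| / rho) `^ sg.
    by rewrite -powRM ?divr_ge0 ?(ltW r0) // mulrC divfK // gt_eqF.
  apply: ler_wpM2l; rewrite ?powR_ge0 //.
  by apply: le1r_powR => //; rewrite ler_pdivlMr // mul1r.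
have H := HB h; rewrite hr hr1 in H; have {}H := H isT.
have -> : g (x + h) - (a + l h) = (g (x + h) - (b + m h)) - ((a - b) + (l h - m h)) by ring.
apply: le_trans (ler_normB _ _) _; apply: le_trans (lerD H (ler_normD _ _)) _.
have q1 := ler_wpM2l M0 k1; have q2 := ler_wpM2l M0 k2.
lra.
Qed.

(** For |h| <= 1 the quadratic term, the cubic term and the Taylor remainder are all O(|h|^2), so
    they can be moved into a remainder of order 2. *)
Lemma gap_of_jet (f : V -> R) (x : V) (J : @jet R n) (K s : R) : 2 <= s -> `|f x| <= K ->
  (jet_bounded K J) ->
  (forall h, `|h| <= 1 -> `|f (x + h) - f x - tay J h| <= K * `|h| `^ s) ->
  gap (3 * K) 1 2 f x.
Proof.
move=> s2 fK JK eK; have K0 := le_trans (normr_ge0 _) fK.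
exists (jl J); split => [||h|h h1]; first exact: jl_lin.
- by lra.
- have [? _ _] := JK h; rewrite divr1; have : 0 <= K * `|h| by rewrite mulr_ge0.
  by lra.
have [_ q3 t3] := JK h; rewrite divr1 powR_nat //.
have -> : f (x + h) - f x - jl J h = (f (x + h) - f x - tay J h) + (jq J h h + jt J h h h).
  by rewrite /tay; ring.
have es : `|h| `^ s <= `|h| ^+ 2.
  by rewrite -powR_nat //; apply: powR_antimono; rewrite ?normr_ge0 ?h1 ?s2 ?ltr0n.
have e3 : `|h| ^+ 3 <= `|h| ^+ 2 by rewrite exprS ler_piMl // exprn_ge0.
have m1 := ler_wpM2l K0 es; have m2 := ler_wpM2l K0 e3.
apply: le_trans (ler_normD _ _) _; apply: le_trans (lerD (eK h h1) (ler_normD _ _)) _; lra.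
Qed.

End Gap2.

(** * Bounds for Taylor coefficients and their variation with the base point *)

Section JetBounds.
Context {R : realType} {n : nat}.
Local Notation V := 'rV[R]_n.
Local Notation e_ i := (delta_mx ord0 i : V).

(* Positivity makes the even part of the Taylor polynomial dominate its odd part and the
   quadratic part almost positive semidefinite, so that the diagonal second derivatives
   control everything. *)
Lemma jet_pos_bound (K : R) : 0 <= K -> exists2 C : R, 1 <= C &
  forall (phi : V -> R) (J : @jet R n),
  (forall h, `|h| <= 1 -> 0 <= phi h) -> phi 0 <= K ->
  (forall i, jq J (e_ i) (e_ i) <= K) ->
  (forall h, `|h| <= 1 -> `|phi h - phi 0 - tay J h| <= 1) ->
  jet_bounded C J.
Proof.
move=> K0; pose B := (3 * K + 1) * 2 ^+ n; pose C := 8 * (2 * (K + B) + 3).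
have B0 : 0 <= B by rewrite /B; nng; lra.
exists C => [|phi J pos p0 qK eK]; first by rewrite /C; lra.
have norm_opp h : `|h : V| <= 1 -> `|- h| <= 1 by rewrite normrN.
have tayN h : tay J (- h) = - jl J h + jq J h h - jt J h h h.
  by rewrite -scaleN1r tayZ; ring.
(* The inequalities phi >= 0 at [h] and at [- h] contain the odd part with opposite signs, so it is
   bounded by the even part plus constants. *)
have sym h : `|h| <= 1 -> [/\ - K - 1 <= jq J h h & `|jl J h + jt J h h h| <= K + jq J h h + 1].
  move=> h1; have := eK _ (norm_opp _ h1); have := eK _ h1.
  have := pos _ h1; have := pos _ (norm_opp _ h1); rewrite tayN /tay.
  rewrite !ler_norml => ? ? /andP[? ?] /andP[? ?]; split; first by lra.
  by apply/andP; split; lra.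
(* By the parallelogram identity and the lower bound for the form at [w - v], one more coordinate
   turns a bound B into 2 B + 3 K + 1; hence the factor [2 ^+ k - 1]. *)
have qtr h k : (k <= n)%N -> `|h| <= 1 -> jq J (rowtrunc h k) (rowtrunc h k) <= (3 * K + 1) * (2 ^+ k - 1).
  move=> kn h1; elim: k kn => [_|k IH kn].
    by rewrite rowtrunc0 -(scale0r 0) jqZl mul0r expr0 subrr mulr0.
  have {}IH := IH (ltnW kn); pose i := Ordinal kn.
  rewrite (rowtruncS h i) /=; set w := rowtrunc h k; set v := h ord0 i *: e_ i.
  have par : jq J (w + v) (w + v) = 2 * jq J w w + 2 * jq J v v - jq J (w - v) (w - v).
    by rewrite -[- v]scaleN1r !jetE; ring.
  have vK : jq J v v <= K.
    rewrite /v !jetE mulrA -expr2.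
    have hi : 0 <= h ord0 i ^+ 2 <= 1.
      rewrite sqr_ge0 /= -real_normK ?num_real // expr_le1 //.
      exact: le_trans (row_norm_coord h i) h1.
    by have := qK i; move: hi => /andP[? ?]; nra.
  have wv1 : `|w - v| <= 1.
    by apply: le_trans h1; rewrite /w /v -scaleNr; apply: (norm_rowtruncD (i := i)); rewrite normrN.
  have [wv _] := sym _ wv1.
  by rewrite par exprS; lra.
have qB h : `|h| <= 1 -> jq J h h <= B.
  move=> h1; have := qtr h n (leqnn n) h1; rewrite rowtrunc_all => H; apply: le_trans H _.
  by rewrite /B; apply: ler_wpM2l; lra.
have bnd h : `|h| <= 1 -> `|0 + tay J h| <= 2 * (K + B) + 3.
  move=> h1; have [q1 o1] := sym h h1; have q2 := qB h h1.
  by rewrite /tay; move: o1; rewrite !ler_norml => /andP[? ?]; apply/andP; split; lra.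
move=> h; have := jet_coef ltr01 bnd h.
by rewrite !divr1 -/C.
Qed.

(** Take the second difference of [f] along [e], centred at [x + h], with step |h|. The expansion at
    [x + h] gives 2 |h|^2 times the coefficient there; the expansion at [x] gives 2 |h|^2 times the
    coefficient at [x], up to cubic terms and remainders. Division by 2 |h|^2 leaves errors of order
    |h| and |h|^(s-2). *)
Lemma q_var (f : V -> R) (x h e : V) (J J' : @jet R n) (K s : R) :
  2 < s <= 4 -> `|e| = 1 -> 0 < `|h| <= 4^-1 ->
  (forall w, `|w| <= 2^-1 -> `|f (x + w) - f x - tay J w| <= K * `|w| `^ s) ->
  (forall w, `|w| <= 2^-1 -> `|f (x + h + w) - f (x + h) - tay J' w| <= K * `|w| `^ s) ->
  (forall w, `|jt J w w w| <= K * `|w| ^+ 3) ->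
  `|jq J' e e - jq J e e| <= 9 * K * `|h| + 33 * K * `|h| `^ (s - 2).
Proof.
move=> /andP[s2 s4] e1 /andP[h0 h4] HJ HJ' HT; set t := `|h|.
have t0 : 0 < t by [].
have t4 : t <= 4^-1 by [].
have t2 : 2 * t <= 2^-1 by lra.
have t21 : t <= 2^-1 by lra.
have nte : `|t *: e| = t by rewrite normrZ e1 mulr1 ger0_norm // ltW.
have K0 : 0 <= K.
  by have := le_trans (normr_ge0 _) (HT e); rewrite e1 expr1n mulr1.
have ts : t `^ s = t ^+ 2 * t `^ (s - 2).
  rewrite -powR_nat ?ltW // -powR_addn ?ltW //; first by congr (_ `^ _); ring.
  by rewrite gt_eqF //; lra.
set p := t `^ (s - 2); have p0 : 0 <= p by apply: powR_ge0.
have two_s w : `|w| <= 2 * t -> K * `|w : V| `^ s <= K * (16 * t `^ s).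
  move=> wt; apply: ler_wpM2l => //; apply: (@le_trans _ _ ((2 * t) `^ s)).
    by apply: powR_mono => //; lra.
  rewrite powRM //; last exact: ltW.
  apply: ler_wpM2r; first exact: powR_ge0.
  have -> : 16 = (2 : R) `^ 4%:R by rewrite powR_nat //; ring.
  by apply: ler_powR => //; lra.
have n1 : `|h + t *: e| <= 2 * t by apply: le_trans (ler_normD _ _) _; rewrite nte -/t; lra.
have n2 : `|h + (- t) *: e| <= 2 * t.
  by apply: le_trans (ler_normD _ _) _; rewrite scaleNr normrN nte -/t; lra.
have nte' : `|(- t) *: e| = t by rewrite scaleNr normrN.
have E1 := HJ (h + t *: e) _; have E2 := HJ (h + (- t) *: e) _; have E3 := HJ h _.
have E4 := HJ' (t *: e) _; have E5 := HJ' ((- t) *: e) _.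
have {}E1 : `|f (x + (h + t *: e)) - f x - tay J (h + t *: e)| <= K * (16 * t `^ s).
  by apply: le_trans (two_s _ n1); apply: E1; exact: le_trans n1 t2.
have {}E2 : `|f (x + (h + (- t) *: e)) - f x - tay J (h + (- t) *: e)| <= K * (16 * t `^ s).
  by apply: le_trans (two_s _ n2); apply: E2; exact: le_trans n2 t2.
have {}E3 : `|f (x + h) - f x - tay J h| <= K * t `^ s by exact: E3.
have {}E4 : `|f (x + h + t *: e) - f (x + h) - tay J' (t *: e)| <= K * t `^ s.
  by rewrite -[in leRHS]nte; apply: E4; rewrite nte.
have {}E5 : `|f (x + h + (- t) *: e) - f (x + h) - tay J' ((- t) *: e)| <= K * t `^ s.
  by rewrite -[t in leRHS]nte'; apply: E5; rewrite nte'.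
have T1 : `|jt J (h + t *: e) (h + t *: e) (h + t *: e)| <= K * (8 * t ^+ 3).
  apply: le_trans (HT _) _; apply: ler_wpM2l => //.
  have -> : 8 * t ^+ 3 = (2 * t) ^+ 3 by ring.
  by apply: lerXn2r; rewrite ?nnegrE //; lra.
have T2 : `|jt J (h + (- t) *: e) (h + (- t) *: e) (h + (- t) *: e)| <= K * (8 * t ^+ 3).
  apply: le_trans (HT _) _; apply: ler_wpM2l => //.
  have -> : 8 * t ^+ 3 = (2 * t) ^+ 3 by ring.
  by apply: lerXn2r; rewrite ?nnegrE //; lra.
have T3 : `|jt J h h h| <= K * t ^+ 3 := HT h.
rewrite !addrA in E1 E2 E4 E5.
move: E1 E2 E4 E5; rewrite !tayZ.
set T1' := jt J _ _ _ in T1; set T2' := jt J _ _ _ in T2.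
have EJ : tay J (h + t *: e) + tay J (h + (- t) *: e) - 2 * tay J h =
   2 * t ^+ 2 * jq J e e + (T1' + T2' - 2 * jt J h h h).
  by rewrite /tay -/T1' -/T2' !jqDl !jqDr !jlD !jlZ !jqZl !jqZr; ring.
move: E3 EJ; set X := tay J (h + t *: e); set Y := tay J (h + (- t) *: e); set Z := tay J h => E3 EJ.
rewrite ts -/p in E3 *; rewrite !ler_norml in T1 T2 T3 E3 *.
move=> /andP[? ?] /andP[? ?] /andP[? ?] /andP[? ?].
case/andP: T1 => ? ?; case/andP: T2 => ? ?; case/andP: T3 => ? ?; case/andP: E3 => ? ?.
have tt : 0 < t ^+ 2 by rewrite exprn_gt0.
have main : 2 * t ^+ 2 * (9 * K * t + 33 * K * p) = 18 * K * t ^+ 3 + 66 * (K * (t ^+ 2 * p)) by ring.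
apply/andP; split.
  rewrite -(@ler_pM2l _ (2 * t ^+ 2)); last by rewrite mulr_gt0.
  by rewrite mulrN main mulrBr; lra.
rewrite -(@ler_pM2l _ (2 * t ^+ 2)); last by rewrite mulr_gt0.
by rewrite main mulrBr; lra.
Qed.

Lemma tay_le (J : @jet R n) h : `|tay J h| <= `|jl J h| + `|jq J h h| + `|jt J h h h|.
Proof.
by rewrite /tay; apply: le_trans (ler_normD _ _) _; apply: lerD => //; exact: ler_normD.
Qed.

Lemma jet_lip (s K : R) (f : V -> R) (x h : V) (J : @jet R n) : 2 <= s -> 0 <= K -> jet_bounded K J ->
  `|h| <= 1 -> `|f (x + h) - f x - tay J h| <= K * `|h| `^ s -> `|f (x + h) - f x| <= 4 * K * `|h|.
Proof.
move=> s2 K0 J_b h1 f_jet; have [L1 L2 L3] := J_b h; have h0 := normr_ge0 h.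
have -> : f (x + h) - f x = (f (x + h) - f x - tay J h) + tay J h by ring.
have -> : 4 * K * `|h| = K * `|h| + (K * `|h| + K * `|h| + K * `|h|) by ring.
apply: le_trans (ler_normD _ _) _; apply: lerD.
  apply: le_trans f_jet _; apply: ler_wpM2l => //.
  rewrite -[leRHS]powRr1 //; apply: powR_antimono; first by rewrite h0.
  by rewrite ltr01 /=; lra.
apply: le_trans (tay_le _ _) _; apply: lerD; first apply: lerD => //.
  by apply: le_trans L2 _; apply: ler_wpM2l => //; rewrite expr2 ler_piMl.
by apply: le_trans L3 _; apply: ler_wpM2l => //; rewrite exprS ler_piMr // expr_le1.
Qed.

(** The increment of the cubic form at [v] is again a polynomial without constant term, so
    [jet_coef] applies to it. *)
Definition jshift (v : V) (J : @jet R n) : @jet R n.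
refine (@Jet R n (fun w => jt J w v v + jt J v w v + jt J v v w)
  (fun u w => jt J u w v + jt J u v w + jt J v u w)
  (jt J) _ _ _ _ _ _); rewrite /linr; intros; rewrite !jetE; ring.
Defined.

Lemma tay_jshift v J w : tay (jshift v J) w = jt J (v + w) (v + w) (v + w) - jt J v v v.
Proof. by rewrite /tay /= !jetE; ring. Qed.

(** On the ball of radius [r] the cubic form at [v + h] is at most K (2 r)^3. [jet_coef] turns this
    into bounds for the three homogeneous parts of the increment, each at most linear in |w|/r; thus
    192 = 3 x 8 x 8. *)
Lemma jt_lip (J : @jet R n) (K r : R) (v w : V) : 0 <= K -> 0 < r ->
  (forall h, `|jt J h h h| <= K * `|h| ^+ 3) -> `|v| <= r -> `|w| <= r ->
  `|jt J (v + w) (v + w) (v + w) - jt J v v v| <= 192 * K * r ^+ 2 * `|w|.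
Proof.
move=> K0 r0 HT vr wr.
have H h : `|h| <= r -> `|jt J v v v + tay (jshift v J) h| <= 8 * K * r ^+ 3.
  move=> hr; rewrite tay_jshift addrC subrK; apply: le_trans (HT _) _.
  have -> : 8 * K * r ^+ 3 = K * (2 * r) ^+ 3 by ring.
  apply: ler_wpM2l => //; apply: lerXn2r; rewrite ?nnegrE //; first by lra.
  by apply: le_trans (ler_normD _ _) _; lra.
have [h1 h2 h3] := jet_coef r0 H w; rewrite -tay_jshift /tay.
have /andP[t0 t1] := div_itv r0 (normr_ge0 w) wr.
set t := `|w| / r in h1 h2 h3 t0 t1; have M0 : 0 <= 8 * (8 * K * r ^+ 3) by nng; exact: ltW.
have -> : 192 * K * r ^+ 2 * `|w| = 3 * (8 * (8 * K * r ^+ 3) * t).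
  by rewrite /t; field; rewrite gt_eqF.
have a2 : t ^+ 2 <= t by rewrite expr2 ler_piMl.
have a3 : t ^+ 3 <= t by rewrite exprS ler_piMr // expr_le1.
have b2 := ler_wpM2l M0 a2; have b3 := ler_wpM2l M0 a3.
apply: le_trans (ler_normD _ _) _; apply: le_trans (lerD (ler_normD _ _) (lexx _)) _; lra.
Qed.

(** On the sphere |h| = r the linear part is an increment of the bounded [g] minus a remainder,
    which bounds it everywhere by homogeneity. *)
Lemma gap_of_affine (g l : V -> R) x (B M r sg : R) : 0 < r <= 1 -> 1 <= sg -> 0 <= M ->
  linr l -> (forall h, `|h| <= r -> `|g (x + h)| <= B) ->
  (forall h, `|h| <= r -> `|g (x + h) - (g x + l h)| <= M * `|h| `^ sg) ->
  gap (2 * B + M) r sg g x.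
Proof.
move=> /andP[r0 r1] s1 M0 ll gB eM.
have gx : `|g x| <= B by have := gB 0; rewrite normr0 addr0; apply; exact: ltW.
have B0 := le_trans (normr_ge0 _) gx.
exists l; split => // [|h|h hr].
- by lra.
- apply: lin_bound => // u ur.
  have u1 : `|u| <= r by rewrite ur.
  have -> : l u = g (x + u) - g x - (g (x + u) - (g x + l u)) by ring.
  apply: le_trans (ler_normB _ _) _; apply: le_trans (lerD (ler_normB _ _) (eM _ u1)) _.
  have : M * `|u| `^ sg <= M by rewrite ler_piMr // powR_le1 // ?ur ?(ltW r0) ?r1 //; lra.
  by have := gB _ u1; lra.
- have -> : g (x + h) - g x - l h = g (x + h) - (g x + l h) by ring.
  apply: le_trans (eM h hr) _.
  apply: (@le_trans _ _ (M * (`|h| / r) `^ sg)).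
    apply: ler_wpM2l => //; apply: powR_mono => //; first by lra.
    by rewrite ler_pdivlMr // ler_piMr.
  by apply: ler_wpM2r; [exact: powR_ge0|lra].
Qed.

End JetBounds.

(** * Splitting off a square *)

Lemma powR_cM {R : realType} (c x s : R) (k : nat) : 1 <= c -> 0 <= x -> 0 <= s <= k%:R ->
  (c * x) `^ s <= c ^+ k * x `^ s.
Proof.
move=> c1 x0 /andP[s0 sk]; have c0 : 0 <= c by lra.
rewrite powRM //; apply: ler_wpM2r; first exact: powR_ge0.
by rewrite -powR_nat //; apply: ler_powR.
Qed.

Lemma lip_continuous {R : realType} {U : normedModType R} (g : U -> R) (x : U) (d L : R) :
  0 < d -> (forall h, `|h| <= d -> `|g (x + h) - g x| <= L * `|h|) -> {for x, continuous g}.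
Proof.
move=> d0 H; apply/cvgrPdist_le => /= ep ep0.
have L1 : 0 < `|L| + 1 by rewrite ltr_wpDl.
have dd : 0 < Num.min d (ep / (`|L| + 1)) by rewrite lt_min d0 divr_gt0.
near=> y.
have : `|x - y| < Num.min d (ep / (`|L| + 1)) by near: y; exact: cvgr_dist_lt.
rewrite distrC lt_min => /andP[/ltW y1 /ltW y2].
have := H _ y1; rewrite (addrC x) subrK distrC => H1; apply: le_trans H1 _.
apply: (@le_trans _ _ ((`|L| + 1) * `|y - x|)).
  by apply: ler_wpM2r => //; apply: le_trans (ler_norm L) _; rewrite lerDl.
by rewrite mulrC -ler_pdivlMr.
Unshelve. all: by end_near.
Qed.

Lemma sgr_close {R : realType} (x y : R) : x != 0 -> `|y - x| <= `|x| / 2 -> Num.sg y = Num.sg x.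
Proof.
case: (ltgtP x 0) => [xl|xg|->]; rewrite ?eqxx // => _.
  by rewrite (ltr0_norm xl) ler_norml => /andP[_ u1]; rewrite !ltr0_sg //; lra.
by rewrite (gtr0_norm xg) ler_norml => /andP[u1 _]; rewrite !gtr0_sg //; lra.
Qed.

Section Arithmetic.
Context {R : realType}.
Implicit Types x y u v w M : R.

Lemma le_third_add x y : x <= 160 / 576 * y -> 0 <= y -> x + y / 16 <= 7 / 20 * y.
Proof. lra. Qed.

Lemma line_min_arith x1 x2 x3 x4 x5 x8 x9 x10 : - (2 * x8) <= x1 - (x2 + x4 + x5) ->
  x3 <= 7 / 20 * x9 -> x1 <= x2 -> - x3 <= x4 -> x10 <= x5 -> x9 < 2 * x10 -> 0 <= x10 ->
  x8 * 8 <= x10 -> False.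
Proof. lra. Qed.

Lemma foot_move_arith x1 x2 x3 x4 x5 x6 x8 M : x1 <= x2 + (x3 + x4) -> x2 <= x5 ->
  x3 <= 4 * x6 -> x4 <= 16 * x5 -> x8 <= x1 -> 17 * x5 + 4 * x6 + M <= x8 -> 0 < M -> False.
Proof. lra. Qed.

Lemma near_zero_bounds u v w : 48 * u <= w -> v <= u -> 0 <= u ->
  [/\ v <= w / 48, 3 * u <= w & 8 * u <= w].
Proof. by move=> *; split; lra. Qed.

Lemma le_quarter u w : 8 * u <= w -> 2 * u <= w / 4.
Proof. lra. Qed.

Lemma add_le_twice v w c : 1 <= c -> 0 <= w -> v <= w / c -> w + v <= 2 * w.
Proof.
move=> c1 w0 vw; rewrite mulrDl mul1r lerD2l; apply: le_trans vw _.
by rewrite ler_pdivrMr ?ler_peMr // (lt_le_trans ltr01).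
Qed.

Lemma ge48_half u w : 48 * u <= w -> 0 <= u -> 2 * u <= w / 2.
Proof. lra. Qed.

End Arithmetic.

(** * Removal of one variable from a function that is convex along an axis *)

Section SplitOff.
Context {R : realType} {n : nat}.
Local Notation V := 'rV[R]_n.
Variables (f : V -> R) (J : V -> @jet R n) (s K kap be b a ep : R) (i : 'I_n).
Local Notation e := (delta_mx ord0 i : V).
Let sg : R := s / 2.
Let p (t : R) := t `^ (sg - 1).

(** The constants are variables with defining equations, so that the arithmetic tactics see atoms.
    C1 bounds the cubic terms containing the axis, C2 the deviation of the minimiser, C3 the error
    of F, C4 and C5 the errors of G on a line and about a zero, C7 the error of f - F, C8 and C9 the
    perturbation under the root. [MM] dominates every multiple that has to be absorbed. *)
Variables C1 C2 C3 C4 C5 C7 C8 C9 MM : R.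
Hypothesis C1E : C1 = 12 * 12 * 12 * K ^+ 3.
Hypothesis C2E : C2 = 34 * K + 16 * C1 ^+ 2 + 1.
Hypothesis C3E : C3 = K * C2 ^+ 2 + 4 * C1 * C2 + 16 * K.
Hypothesis C4E : C4 = C1 + K.
Hypothesis C5E : C5 = 49 * K ^+ 2 * C4 + 95 * 95 * K ^+ 4 + 9 * K ^+ 3 * C2.
Hypothesis C7E : C7 = K + 81 * K ^+ 4 * C3.
Hypothesis C8E : C8 = 16 * C5 * (K + C5) + C7.
Hypothesis C9E : C9 = 16 * C8 + C7.
Hypothesis MME : MM = 16 * C9 + 17 * K + 4 * C1 + 8 * K + 4 * C2 + 2.

Hypothesis s24 : 2 < s <= 4.
Hypothesis K1 : 1 <= K.
Hypothesis kap01 : 0 < kap <= 4^-1.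
Hypothesis be0 : 0 < be <= kap.
(** Minima are sought on segments of half-length [b] over points with |x| <= a. A vector of length
    at most 2 b has axial component at most [be / 2]. The radius [a] is quadratic in [b], so that
    the values of [f] there, at most 5 a K, are small against b^2. *)
Hypothesis bE : b = be / (8 * K).
Hypothesis aE : a = b / (24 * K) * (b / (24 * K)).
Hypothesis epE : ep = a.
(** Since [p] tends to 0 with [t], an error term that carries the factor [p] is absorbed by the main
    quadratic term at distances below [be]. *)
Hypothesis small : forall t, 0 <= t <= be -> MM * p t <= 1.
Hypothesis f_ge0 : forall x, `|x| <= 1 -> 0 <= f x.
Hypothesis f_jet : forall x, `|x| <= kap -> forall h, `|h| <= 2^-1 ->
  `|f (x + h) - f x - tay (J x) h| <= K * `|h| `^ s.
Hypothesis J_bound : forall x, `|x| <= kap -> jet_bounded K (J x).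
Hypothesis q_ge1 : forall x, `|x| <= kap -> 1 <= jq (J x) e e.
Hypothesis f0ep : f 0 <= ep.

Let pr (x : V) : V := x - x ord0 i *: e.

Let s2 : 2 < s. Proof. by case/andP: s24. Qed.
Let s4 : s <= 4. Proof. by case/andP: s24. Qed.
Let sgE : s = sg + sg. Proof. by rewrite /sg; field. Qed.
Let sg1 : 1 < sg. Proof. by have := s2; rewrite sgE; lra. Qed.
Let sg2 : sg <= 2. Proof. by have := s4; rewrite sgE; lra. Qed.
Let K0 : 0 < K. Proof. have := K1; lra. Qed.
Let C1p : 0 <= C1. Proof. by rewrite C1E; nng. Qed.
Let C2p : 1 <= C2. Proof. by rewrite C2E lerDr; nng. Qed.
Let C2p0 : 0 <= C2. Proof. by have := C2p; lra. Qed.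
Let C3p : 0 <= C3. Proof. by rewrite C3E; have ? := C1p; have ? := C2p0; nng. Qed.
Let C4p : 0 <= C4. Proof. by rewrite C4E; have ? := C1p; nng. Qed.
Let C5p : 0 <= C5. Proof. by rewrite C5E; have ? := C4p; have ? := C2p0; nng. Qed.
Let C7p : 0 <= C7. Proof. by rewrite C7E; have ? := C3p; nng. Qed.
Let C8p : 0 <= C8. Proof. by rewrite C8E; have ? := C5p; have ? := C7p; nng. Qed.
Let C9p : 0 <= C9. Proof. by rewrite C9E; have ? := C8p; have ? := C7p; nng. Qed.
Let MMb : [/\ 16 * C9 <= MM, 17 * K + 4 * C1 + 1 <= MM, 8 * K <= MM & 4 * C2 <= MM].
Proof.
have := C9p; have := C1p; have := C2p0; have := K0; rewrite MME.
by split; lra.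
Qed.
Let b0 : 0 < b. Proof. by rewrite bE; psv; case/andP: be0. Qed.
Let bbe : b <= be / 8.
Proof.
have HK := K1; rewrite bE; apply: ler_wpM2l; first by case/andP: be0 => /ltW.
by rewrite lef_pV2 ?posrE; psv; lra.
Qed.
Let be1 : be <= 4^-1.
Proof. by case/andP: be0 => _; case/andP: kap01 => _; lra. Qed.
Let a0 : 0 < a. Proof. by rewrite aE; psv. Qed.
Let b24 : b / (24 * K) <= b / 24.
Proof. by have HK := K1; apply: ler_wpM2l; [exact: ltW|rewrite lef_pV2 ?posrE; psv; lra]. Qed.
Let aKE : a * K ^+ 2 = (b / 24) ^+ 2.
Proof. by rewrite aE; field; rewrite gt_eqF. Qed.
Let ab : a <= b / (24 * K).
Proof.
rewrite aE ler_piMr //; first by nng.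
by apply: le_trans b24 _; have := bbe; have := be1; lra.
Qed.

Let e1 : `|e| = 1. Proof. exact: norm_delta. Qed.
Let norm_te (t : R) : `|t *: e| = `|t|. Proof. by rewrite normrZ e1 mulr1. Qed.

Let prD x y : pr (x + y) = pr x + pr y.
Proof. by rewrite /pr mxE scalerDl opprD addrACA. Qed.
Let pr_e t : pr (t *: e) = 0.
Proof. by rewrite /pr !mxE !eqxx mulr1 subrr. Qed.
Let pr_i x : pr x ord0 i = 0.
Proof. by rewrite /pr !mxE !eqxx mulr1 subrr. Qed.
Let prE x : x = pr x + x ord0 i *: e. Proof. by rewrite /pr subrK. Qed.
Let coordD (y : V) (t : R) : (y + t *: e) ord0 i = y ord0 i + t.
Proof. by rewrite !mxE !eqxx mulr1. Qed.
Let pr_norm x : `|pr x| <= `|x|.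
Proof.
apply: row_norm_le => // j; rewrite /pr !mxE eqxx /=.
by have [->|ji] := eqVneq j i; rewrite ?mulr1 ?subrr ?normr0 // mulr0 subr0 row_norm_coord.
Qed.
Let pr_pr x : pr (pr x) = pr x.
Proof. by rewrite {1}/pr pr_i scale0r subr0. Qed.

(** [p] is a common modulus, dominating both the factor t left by cubic terms and the factor t^(s-2)
    left by remainders: s/2 - 1 is at most 1 and is half of s - 2. *)
Let pE t : 0 <= t <= 1 -> [/\ 0 <= p t, t <= p t & t `^ (s - 2) <= p t].
Proof.
move=> t01; split; first exact: powR_ge0.
  have /andP[t0 _] := t01; rewrite -[leLHS]powRr1 //; apply: powR_antimono => //.
  by apply/andP; split; have := sg1; have := sg2; lra.
by apply: powR_antimono => //; rewrite sgE; apply/andP; split; have := sg1; have := sg2; lra.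
Qed.

Let pow_s t : 0 <= t -> t `^ s = t ^+ 2 * t `^ (s - 2).
Proof.
move=> t0; rewrite -powR_nat // -powR_addn //; first by congr (_ `^ _); ring.
by rewrite gt_eqF //; have := s2; lra.
Qed.

Let pow_sg t : 0 <= t -> t `^ sg = t * p t.
Proof.
move=> t0; rewrite -[X in X * _](powRr1 t0) -powR_addn //; first by congr (_ `^ _); ring.
by rewrite gt_eqF //; have := sg1; lra.
Qed.

Let pow_ss t : 0 <= t -> t `^ s = (t `^ sg) ^+ 2.
Proof. by move=> t0; rewrite powR_sq. Qed.

Let pows t : 0 <= t <= 1 ->
  [/\ t ^+ 2 <= t, t ^+ 3 <= t ^+ 2, t `^ s <= t ^+ 2, t ^+ 3 <= t ^+ 2 * p t &
      t `^ s <= t ^+ 2 * p t].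
Proof.
move=> t01; have [p0 p1 p2] := pE t01; have /andP[t0 t1] := t01.
have t20 : 0 <= t ^+ 2 by nng.
split.
- by rewrite expr2 ler_piMl.
- by rewrite exprS ler_piMl.
- by rewrite pow_s // ler_piMr // powR_le1 // subr_ge0 ltW.
- by rewrite exprSr; apply: ler_wpM2l.
- by rewrite pow_s //; apply: ler_wpM2l.
Qed.

Let half1 (x : R) : 0 <= x -> x <= 2^-1 -> 0 <= x <= 1.
Proof. by move=> x0 x2; apply/andP; split; lra. Qed.

(** * The minimum along a line parallel to the axis *)

Let jet_step (y h : V) : `|y| <= kap -> `|h| <= 2^-1 -> `|f (y + h) - f y| <= 4 * K * `|h|.
Proof.
move=> yk h2; have h1 : `|h| <= 1 by lra.
exact: jet_lip (ltW s2) (ltW K0) (J_bound yk) h1 (f_jet yk h2).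
Qed.

Let line_exp (u : V) (x : R) : `|u| <= kap -> `|x| <= 2^-1 ->
  `|f (u + x *: e) - (f u + x * jl (J u) e + x ^+ 2 * jq (J u) e e)| <= 2 * K * (`|x| ^+ 2 * p `|x|).
Proof.
move=> yk x2; have x01 := half1 (normr_ge0 x) x2.
have [_ _ _ u4 u5] := pows x01.
have nx : `|x *: e| <= 2^-1 by rewrite norm_te.
have [_ _ L3] := J_bound yk (x *: e); have HA := f_jet yk nx.
rewrite norm_te in L3 HA; have K00 := ltW K0.
rewrite /tay !jlZ !jqZl !jqZr in HA.
have -> : f (u + x *: e) - (f u + x * jl (J u) e + x ^+ 2 * jq (J u) e e) =
  (f (u + x *: e) - f u - (x * jl (J u) e + x * (x * jq (J u) e e) + jt (J u) (x *: e) (x *: e) (x *: e)))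
   + jt (J u) (x *: e) (x *: e) (x *: e) by ring.
apply: le_trans (ler_normD _ _) _.
have -> : 2 * K * (`|x| ^+ 2 * p `|x|) = K * (`|x| ^+ 2 * p `|x|) + K * (`|x| ^+ 2 * p `|x|) by ring.
by apply: lerD; [apply: le_trans HA _|apply: le_trans L3 _]; apply: ler_wpM2l.
Qed.

Let small1 (x : R) : `|x| <= be -> 8 * K * p `|x| <= 1.
Proof.
move=> xb; have x0 := normr_ge0 x; have xx : 0 <= `|x| <= be by rewrite x0.
by apply: le_trans (small xx); apply: ler_wpM2r; [exact: powR_ge0|case: MMb].
Qed.

(** A minimum on the segment exists by continuity; the point is that it stays in the inner half.
    Positivity of [f] and the smallness of [f u] bound the slope at [u] by 7 b / 20, while the
    quadratic coefficient is at least 1. If |t| > b/2 the quadratic gain would exceed the linear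
    loss, and [u] itself would be better. The hypotheses stand under the existential so that [tau]
    can be chosen as a function. *)
Let line_min (u : V) : exists t, `|u| <= a -> u ord0 i = 0 ->
  `|t| <= b / 2 /\ forall t', `|t'| <= b -> f (u + t *: e) <= f (u + t' *: e).
Proof.
have [ua|nua] := pselect (`|u| <= a); last by exists 0.
have HK := K1; have K00 := K0; have b00 := b0.
have [kap0 kap4] := andP kap01; have [be00 bek] := andP be0.
have ab' : a <= b / 24 by apply: le_trans ab b24.
have bk : b <= kap / 8 by have := bbe; lra.
have uk : `|u| <= kap by lra.
have cont t : t \in `[(- b), b] -> {for t, continuous (fun t : R => f (u + t *: e))}.
  rewrite in_itv /= -ler_norml => tb.
  apply: (@lip_continuous _ _ _ _ 2^-1 (4 * K)) => [|h h2]; first by rewrite invr_gt0 ltr0n.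
  have yk : `|u + t *: e| <= kap.
    by apply: le_trans (ler_normD _ _) _; rewrite norm_te; lra.
  by rewrite scalerDl addrA -[in leRHS]norm_te; apply: jet_step => //; rewrite norm_te.
have [t tb tmin] : exists2 t, t \in `[(- b), b] & forall t', t' \in `[(- b), b] ->
    f (u + t *: e) <= f (u + t' *: e).
  apply: EVT_min; first by lra.
  by apply: continuous_in_subspaceT => x; rewrite inE => xb; apply: cont.
exists t => _ ui; split; last by move=> t' t'b; apply: tmin; rewrite in_itv /= -ler_norml.
rewrite leNgt; apply/negP => bt.
have t0b : f (u + t *: e) <= f u.
  have := tmin 0; rewrite scale0r addr0; apply.
  by rewrite in_itv /= -ler_norml normr0 ltW.
rewrite in_itv /= -ler_norml in tb.
have fu : f u <= 5 * a * K.
  have u2 : `|u| <= 2^-1 by lra.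
  have k0 : `|0 : V| <= kap by rewrite normr0; lra.
  have := jet_step k0 u2; rewrite add0r => HA.
  have q5 : 4 * K * `|u| <= 4 * K * a by apply: ler_wpM2l => //; lra.
  have q6 : a <= a * K by rewrite ler_peMr // ltW.
  have := f0ep; rewrite epE => f0a.
  move: HA; rewrite ler_norml => /andP[_]; move: (f u) (f 0) f0a => x y; lra.
have qK : jq (J u) e e <= K.
  have [_ L2 _] := J_bound uk e; apply: le_trans (ler_norm _) _.
  by rewrite e1 expr1n mulr1 in L2.
have q1 := q_ge1 uk.
have bbe8 := bbe.
(* The slope is tested at [u + t0 e] and [u - t0 e], where [f] is non-negative: it is at most
   f(u)/t0 + 2 K t0, and this [t0] makes both terms small multiples of [b]. *)
pose t0 := b / (32 * K).
have t00 : 0 < t0 by rewrite /t0; psv.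
have Kt0 : K * t0 = b / 32 by rewrite /t0; field; rewrite gt_eqF.
have t0b' : t0 <= b / 32.
  by apply: ler_wpM2l; [exact: ltW|rewrite lef_pV2 ?posrE; psv; lra].
have nt0 : `|t0| = t0 by rewrite ger0_norm // ltW.
have E1 : `|t0| <= 2^-1 by rewrite nt0; lra.
have E2 : `|- t0| <= 2^-1 by rewrite normrN.
have E3 : `|t| <= 2^-1 by lra.
have P1 : 0 <= f (u + t0 *: e).
  by apply: f_ge0; apply: le_trans (ler_normD _ _) _; rewrite norm_te nt0; lra.
have P2 : 0 <= f (u + (- t0) *: e).
  by apply: f_ge0; apply: le_trans (ler_normD _ _) _; rewrite norm_te normrN nt0; lra.
have X1 := line_exp uk E1; have X2 := line_exp uk E2; have X3 := line_exp uk E3.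
rewrite normrN nt0 in X2; rewrite nt0 in X1.
have S1 : 8 * K * p t0 <= 1 by rewrite -nt0; apply: small1; rewrite nt0; lra.
have S2 : 8 * K * p `|t| <= 1 by apply: small1; lra.
have S1' := ler_wpM2r (ltW (exprn_gt0 2 t00)) S1.
have S2' := ler_wpM2r (exprn_ge0 2 (normr_ge0 t)) S2.
have aKE' := aKE.
have nt2 : `|t| ^+ 2 = t ^+ 2 by rewrite real_normK ?num_real.
have T1 : `|t| * `|jl (J u) e| <= `|t| * (7 / 20 * b).
  apply: ler_wpM2l => //.
  have l1 : `|jl (J u) e| * t0 <= f u + 2 * K * t0 ^+ 2.
    rewrite -[X in _ * X <= _]nt0 -normrM ler_norml.
    move: X1 X2 S1' P1 P2 qK HK t00 Kt0; rewrite !ler_norml sqrrN.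
    move: (f (u + t0 *: e)) (f (u + - t0 *: e)) (f u) (jl (J u) e) (jq (J u) e e) (p t0).
    move=> A B F l q P /andP[? ?] /andP[? ?] S ? ? qK HK t00 _.
    have t20 : 0 < t0 ^+ 2 by rewrite exprn_gt0.
    have ? : t0 ^+ 2 * q <= t0 ^+ 2 * K by rewrite ler_pM2l.
    have ? : t0 ^+ 2 <= t0 ^+ 2 * K by rewrite ler_peMr // ltW.
    by apply/andP; split; lra.
  have l2 : `|jl (J u) e| * b <= 32 * K * f u + b ^+ 2 / 16.
    have -> : `|jl (J u) e| * b = 32 * K * (`|jl (J u) e| * t0) by rewrite /t0; field; rewrite gt_eqF.
    have -> : b ^+ 2 / 16 = 32 * K * (2 * K * t0 ^+ 2) by rewrite /t0; field; rewrite gt_eqF.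
    by rewrite -mulrDr; apply: ler_wpM2l => //; nng.
  have l3 : 32 * K * f u <= 160 / 576 * b ^+ 2.
    have -> : 160 / 576 * b ^+ 2 = 32 * K * (5 * a * K).
      have -> : 32 * K * (5 * a * K) = 160 * (a * K ^+ 2) by ring.
      by rewrite aKE; field.
    by apply: ler_wpM2l => //; nng.
  rewrite -(ler_pM2r b00); apply: le_trans l2 _.
  have -> : 7 / 20 * b * b = 7 / 20 * b ^+ 2 by ring.
  have : 0 <= b ^+ 2 by nng.
  by move: l3; exact: le_third_add.
move: X3; rewrite ler_norml nt2 => /andP[X3 _].
have tl : - (`|t| * `|jl (J u) e|) <= t * jl (J u) e by rewrite -normrM lerNl ler_normr lexx orbT.
have tq : t ^+ 2 <= t ^+ 2 * jq (J u) e e by rewrite ler_peMr // sqr_ge0.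
have tt : `|t| * b < 2 * t ^+ 2.
  have tp : 0 < `|t| by apply: lt_trans bt; psv.
  have -> : 2 * t ^+ 2 = `|t| * (2 * `|t|) by rewrite -nt2; ring.
  by rewrite ltr_pM2l // [2 * _]mulrC -ltr_pdivrMr.
have tt0 : 0 <= t ^+ 2 by exact: sqr_ge0.
have tt2 : K * (t ^+ 2 * p `|t|) * 8 <= t ^+ 2.
  by move: S2'; rewrite nt2 mul1r => H; apply: le_trans H; rewrite le_eqVlt; apply/orP; left; apply/eqP; ring.
move: X3 T1 t0b tl tq tt tt0 tt2.
move: (f (u + t *: e)) (f u) (`|t| * `|jl (J u) e|) (t * jl (J u) e) => x1 x2 x3 x4.
move: (t ^+ 2 * jq (J u) e e) (t ^+ 2 * p `|t|) => x5 x7.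
have -> : `|t| * (7 / 20 * b) = 7 / 20 * (`|t| * b) by ring.
have -> : 2 * K * x7 = 2 * (K * x7) by ring.
exact: line_min_arith.
Qed.


Let tau := projT1 (boolp.choice line_min).
Let tauP (u : V) : `|u| <= a -> u ord0 i = 0 ->
  `|tau u| <= b / 2 /\ forall t', `|t'| <= b -> f (u + tau u *: e) <= f (u + t' *: e).
Proof. exact: (projT2 (boolp.choice line_min)). Qed.

(** A point of minimum on the line through [x]. It is computed from [pr x], so that the minimal
    value is exactly constant along the axis. *)
Definition split_foot (x : V) : V := pr x + tau (pr x) *: e.
Local Notation Z := split_foot.
Definition split_min (x : V) : R := f (Z x).
Local Notation F := split_min.

Let Z_pr x y : pr x = pr y -> Z x = Z y. Proof. by rewrite /split_foot => ->. Qed.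

Let pr_Z x : pr (Z x) = pr x. Proof. by rewrite /split_foot prD pr_e addr0 pr_pr. Qed.

Let x_Z x : x = Z x + (x ord0 i - Z x ord0 i) *: e.
Proof. by have := pr_Z x; rewrite /pr => E; rewrite scalerBl addrCA E addrC subrK. Qed.

Let Z_i (x : V) : `|x| <= a -> `|Z x ord0 i| <= b / 2.
Proof.
move=> xa; rewrite /split_foot !mxE !eqxx /= mulr1 mulr1 subrr add0r.
by have [] := tauP (le_trans (pr_norm x) xa) (pr_i x).
Qed.

Let Z_norm (x : V) : `|x| <= a -> `|Z x| <= b.
Proof.
move=> xa; rewrite [X in `|X| <= _]prE; apply: le_trans (ler_normD _ _) _; rewrite norm_te pr_Z.
have := le_trans (pr_norm x) xa; have := Z_i xa; have := ab; have := b24; have := b0.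
by move: (`|pr x|) (`|Z x ord0 i|) (b / (24 * K)) => u v w; lra.
Qed.

Let Z_min (x y : V) : `|x| <= a -> pr y = pr x -> `|y ord0 i| <= b -> F x <= f y.
Proof.
move=> xa yx yb; rewrite /split_min /split_foot [in leRHS](prE y) yx.
by have [_] := tauP (le_trans (pr_norm x) xa) (pr_i x); apply.
Qed.

Let bkap : b <= kap / 8.
Proof. by have := bbe; have [_] := andP be0; move: kap be b => x y z; lra. Qed.
Let b4 : b <= 4^-1 / 8.
Proof. by have := bkap; have [_] := andP kap01; move: kap b => x y; lra. Qed.
Let bk : b <= kap.
Proof. by have := bkap; have [? _] := andP kap01; lra. Qed.

(** The minimum is interior: comparison with the points at axial distance t on either side bounds
    the slope by a multiple of K t, and t is arbitrarily small. *)
Let Z_crit (x : V) : `|x| <= a -> jl (J (Z x)) e = 0.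
Proof.
move=> xa; apply/eqP; rewrite -normr_le0; apply/ler_addgt0Pr => eps eps0; rewrite add0r.
have zk := le_trans (Z_norm xa) bk.
pose t := Num.min (b / 2) (eps / (4 * K)).
have t0 : 0 < t by rewrite lt_min; apply/andP; split; have := b0; have := K0 => ? ?; psv.
have tb : t <= b / 2 by rewrite ge_min lexx.
have te : K * t <= eps / 4.
  have : t <= eps / (4 * K) by rewrite ge_min lexx orbT.
  by rewrite ler_pdivlMr ?mulr_gt0 // => H; lra.
have t12 : t <= 2^-1 by have := b4; lra.
have ge (r : R) : `|r| = t -> F x <= f (Z x + r *: e).
  move=> rt; apply: Z_min => //; first by rewrite prD pr_Z pr_e addr0.
  rewrite coordD; apply: le_trans (ler_normD _ _) _; rewrite rt.
  by have := Z_i xa; lra.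
have nt : `|t| = t by rewrite ger0_norm // ltW.
have ntN : `|- t| = t by rewrite normrN.
have := ge _ nt; have := ge _ ntN.
have := line_exp zk (_ : `|t| <= 2^-1); have := line_exp zk (_ : `|- t| <= 2^-1).
rewrite !nt !ntN sqrrN => /(_ t12) X1 /(_ t12) X2 Y1 Y2.
have [_ L2 _] := J_bound zk e; rewrite e1 expr1n mulr1 in L2.
have tbe : `|t| <= be by rewrite nt; have := bbe; have [? _] := andP be0; have := b0; lra.
have := small1 tbe; rewrite nt => sm.
have t2 : 0 < t ^+ 2 by psv.
have sm2 : K * (t ^+ 2 * p t) <= K * t ^+ 2.
  have : p t <= 1.
    have : p t <= 8 * K * p t by rewrite ler_peMl // ?powR_ge0 //; have := K1; lra.
    by move=> H; apply: le_trans H sm.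
  by move=> p1; apply: ler_wpM2l; [exact: ltW|rewrite ler_piMr // ltW].
have L3 : t ^+ 2 * `|jq (J (Z x)) e e| <= t ^+ 2 * K by rewrite ler_pM2l.
have qn : - (t ^+ 2 * `|jq (J (Z x)) e e|) <= t ^+ 2 * jq (J (Z x)) e e <= t ^+ 2 * `|jq (J (Z x)) e e|.
  rewrite -mulrN !ler_pM2l //; rewrite -ler_norml; exact: lexx.
rewrite -(ler_pM2l t0) -[X in X * _ <= _]nt -normrM.
have E3 : t * eps >= 4 * (K * t ^+ 2).
  have -> : 4 * (K * t ^+ 2) = t * (4 * (K * t)) by ring.
  by apply: ler_wpM2l; [exact: ltW|lra].
move: X1 X2 Y1 Y2 qn; rewrite /split_min !ler_norml.
have -> : 2 * K * (t ^+ 2 * p t) = 2 * (K * (t ^+ 2 * p t)) by ring.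
rewrite mulNr; move: (f _) (f _) (f _) => f1 f2 f3.
move: (t * jl _ _) => l0 /andP[? ?] /andP[? ?] ? ? /andP[? ?].
by apply/andP; split; lra.
Qed.

(** * Completing the square at a foot *)

Let qz (z : V) : R := jq (J z) e e.
(** The axial component of [h] with respect to the quadratic form at [z]. Removing it leaves a
    vector orthogonal to [e] for the symmetrised form, so the form at [h] is its value at
    [split_proj z h] plus [qz z * split_lam z h ^+ 2]. *)
Definition split_lam (z h : V) : R := (jq (J z) h e + jq (J z) e h) / (2 * qz z).
Local Notation lam := split_lam.
Definition split_proj (z h : V) : V := h - lam z h *: e.
Local Notation AA := split_proj.

Let lam_lin z : linr (lam z).
Proof. by move=> c u v; rewrite /split_lam !jetE; ring. Qed.

Let AA_lin z : lin (AA z).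
Proof.
move=> c u v; rewrite /split_proj lam_lin scalerBr scalerDl scalerA opprD addrACA.
by [].
Qed.

Let qz_pos z : `|z| <= kap -> 0 < qz z. Proof. by move/q_ge1 => H; apply: lt_le_trans H; exact: ltr01. Qed.

Let qz_le z : `|z| <= kap -> qz z <= K.
Proof.
move=> zk; have [_ L2 _] := J_bound zk e; apply: le_trans (ler_norm _) _.
by rewrite e1 expr1n mulr1 in L2.
Qed.

Let lam_e z : `|z| <= kap -> lam z e = 1.
Proof. by move/qz_pos => q0; rewrite /split_lam -/(qz z); field; rewrite gt_eqF. Qed.

Let AA_e z : `|z| <= kap -> AA z e = 0.
Proof. by move=> zk; rewrite /split_proj lam_e // scale1r subrr. Qed.

Let lam_AA z h : `|z| <= kap -> lam z (AA z h) = 0.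
Proof.
move=> zk; rewrite /split_proj (linrB _ _ (@lam_lin z)) (linrZ _ _ (@lam_lin z)).
by rewrite lam_e // mulr1 subrr.
Qed.

Let AA_pr z h t : `|z| <= kap -> AA z (h + t *: e) = AA z h.
Proof. by move=> zk; rewrite (linD (@AA_lin z)) (linZ (@AA_lin z)) AA_e // scaler0 addr0. Qed.

Let AA_AA z h : `|z| <= kap -> AA z (AA z h) = AA z h.
Proof. by move=> zk; rewrite {1}/split_proj lam_AA // scale0r subr0. Qed.

Let h_AA z h : h = AA z h + lam z h *: e. Proof. by rewrite /split_proj subrK. Qed.

Let lam_bound z h : `|z| <= kap -> `|lam z h| <= 2 * K * `|h|.
Proof.
move=> zk; rewrite -[X in _ * X]divr1; apply: lin_bound => // u u1.
(* Only diagonal values of the form are bounded, hence the polarisation with [u + e] and [u - e]. *)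
have [_ L2 _] := J_bound zk (u + e); have [_ L2' _] := J_bound zk (u - e).
have n1 : `|u + e| ^+ 2 <= 2 ^+ 2.
  by apply: lerXn2r; rewrite ?nnegrE //; apply: le_trans (ler_normD _ _) _; rewrite u1 e1.
have n2 : `|u - e| ^+ 2 <= 2 ^+ 2.
  by apply: lerXn2r; rewrite ?nnegrE //; apply: le_trans (ler_normB _ _) _; rewrite u1 e1.
have m1 := ler_wpM2l (ltW K0) n1; have m2 := ler_wpM2l (ltW K0) n2.
have E : jq (J z) u e + jq (J z) e u = (jq (J z) (u + e) (u + e) - jq (J z) (u - e) (u - e)) / 2.
  by rewrite -[- e]scaleN1r !jetE; field.
have q1 := q_ge1 zk; have q0 := qz_pos zk.
rewrite /split_lam normrM normfV [X in _ / X]ger0_norm; last by nng.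
rewrite ler_pdivrMr; last by psv.
apply: (@le_trans _ _ (4 * K)).
  rewrite E; have := le_trans L2 m1; have := le_trans L2' m2.
  move: (jq _ _ _) (jq _ _ _) => x y; rewrite !ler_norml => /andP[? ?] /andP[? ?].
  by apply/andP; split; lra.
have -> : 2 * K * (2 * qz z) = 4 * K * qz z by ring.
by rewrite ler_peMr //; nng; exact: ltW K0.
Qed.

Let AA_bound z h : `|z| <= kap -> `|AA z h| <= 3 * K * `|h|.
Proof.
move=> zk; apply: le_trans (ler_normB _ _) _; rewrite norm_te.
have := lam_bound h zk; have : `|h| <= K * `|h| by rewrite ler_peMl.
by move: (`|h|) (`|_|) => x y; lra.
Qed.

(** At a critical point the linear term along [e] vanishes, and so does the mixed quadratic term by
    the choice of [lam]. By [jt_lip] the cubic forms at [h] and at [AA z h] differ by at most C1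
    |lam z h| |h|^2, with C1 = 192 K (3 K)^2. *)
Let foot_exp z h : `|z| <= kap -> jl (J z) e = 0 -> `|h| <= 2^-1 ->
  `|f (z + h) - f z - tay (J z) (AA z h) - qz z * lam z h ^+ 2| <=
  C1 * (`|lam z h| * `|h| ^+ 2) + K * `|h| `^ s.
Proof.
move=> zk le0 h2; have HA := f_jet zk h2.
have [v vd] : {v | AA z h = v} by exists (AA z h).
rewrite vd; set t := lam z h.
have vE : jq (J z) v e + jq (J z) e v = 0.
  have := lam_AA h zk; rewrite vd /split_lam => /eqP; rewrite mulf_eq0 => /orP[/eqP //|].
  by rewrite invr_eq0 mulf_eq0 pnatr_eq0 /= gt_eqF // qz_pos.
have E : tay (J z) h = tay (J z) v + qz z * t ^+ 2 +
   (jt (J z) (v + t *: e) (v + t *: e) (v + t *: e) - jt (J z) v v v).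
  rewrite [in LHS](h_AA z h) vd -/t /tay !jqDl !jqDr !jlD !jlZ !jqZl !jqZr le0 /qz.
  have -> : jq (J z) e v = - jq (J z) v e by apply/eqP; rewrite -addr_eq0 addrC; apply/eqP.
  by ring.
have T : `|jt (J z) (v + t *: e) (v + t *: e) (v + t *: e) - jt (J z) v v v| <=
    C1 * (`|t| * `|h| ^+ 2).
  have [h0|hn0] := eqVneq h 0.
    have -> : t = 0 by rewrite /t h0 (linr0 (@lam_lin z)).
    by rewrite scale0r addr0 subrr normr0 mul0r mulr0.
  have hp : 0 < `|h| by rewrite normr_gt0.
  have -> : C1 * (`|t| * `|h| ^+ 2) = 192 * K * (3 * K * `|h|) ^+ 2 * `|t *: e|.
    by rewrite norm_te C1E; ring.
  apply: jt_lip; rewrite ?(ltW K0) //.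
  - by have := K0 => ?; psv.
  - by move=> w; have [] := J_bound zk w.
  - by rewrite -vd; exact: AA_bound.
  - rewrite norm_te; apply: le_trans (lam_bound h zk) _; apply: ler_wpM2r => //.
    by apply: ler_wpM2r; [exact: ltW|rewrite ler_nat].
move: HA; rewrite E => HA.
set Tt := (X in `|X| <= C1 * _) in T.
have -> : f (z + h) - f z - tay (J z) v - qz z * t ^+ 2 =
   Tt + (f (z + h) - f z - (tay (J z) v + qz z * t ^+ 2 + Tt)) by ring.
by apply: le_trans (ler_normD _ _) _; apply: lerD.
Qed.

Let be2 : be / 2 <= be. Proof. by have [? _] := andP be0; lra. Qed.
Let be21 : be / 2 <= 1. Proof. by have [? _] := andP be0; have := be1; lra. Qed.

Let small4 (t : R) : 0 <= t <= be -> (17 * K + 4 * C1 + 1) * p t <= 1.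
Proof.
move=> tb; apply: le_trans (small tb); apply: ler_wpM2r; first exact: powR_ge0.
by case: MMb.
Qed.

Let s04 : 0 <= s <= 4%:R.
Proof. by have := s2; have := s4; move=> ? ?; apply/andP; split; lra. Qed.
Let s22 : 0 <= s - 2 <= 2%:R.
Proof. by have := s2; have := s4; move=> ? ?; apply/andP; split; lra. Qed.
Let K6 : 1 <= 6 * K. Proof. by have := K1; lra. Qed.
Let K7 : 1 <= 7 * K. Proof. by have := K1; lra. Qed.
Let K3 : 1 <= 3 * K. Proof. by have := K1; lra. Qed.
Let sg02 : 0 <= sg <= 2%:R.
Proof. by have := sg1; have := sg2; move=> ? ?; apply/andP; split; lra. Qed.

Let Kb : 4 * K * b = be / 2.
Proof. by rewrite bE; field; rewrite gt_eqF. Qed.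

(** The scalar inequality behind [foot_move]: the term linear in [m] is absorbed into half of
    [m ^+ 2] by Young's inequality. *)
Let foot_move_scal (S v2 v4 m w2 ws q P : R) : 0 <= S -> 1 <= q <= K ->
  P = q * m ^+ 2 -> P <= K * S + (C1 * (m * w2) + K * ws) -> 0 <= m ->
  v4 = v2 ^+ 2 -> v4 <= S -> w2 <= 4 * v2 -> ws <= 16 * S -> m ^+ 2 <= C2 ^+ 2 * S.
Proof.
move=> S0 /andP[q1 qK] -> H m0 -> v4S w2v wsS.
have K00 := K0; have C10 := C1p; have C21 := C2p.
have h1 : C1 * (m * w2) <= C1 * (m * (4 * v2)) by apply: ler_wpM2l => //; apply: ler_wpM2l.
have h2 : K * ws <= K * (16 * S) by apply: ler_wpM2l => //; exact: ltW.
have h3 : m ^+ 2 <= q * m ^+ 2 by rewrite ler_peMl // sqr_ge0.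
have h4 : C1 * (m * (4 * v2)) <= m ^+ 2 / 2 + 8 * C1 ^+ 2 * v2 ^+ 2.
  rewrite -subr_ge0.
  have -> : m ^+ 2 / 2 + 8 * C1 ^+ 2 * v2 ^+ 2 - C1 * (m * (4 * v2)) = (m - 4 * C1 * v2) ^+ 2 / 2 by field.
  by apply: divr_ge0; rewrite ?sqr_ge0 ?ler0n.
have h5 : C1 ^+ 2 * v2 ^+ 2 <= C1 ^+ 2 * S by apply: ler_wpM2l => //; nng.
have h6 : m ^+ 2 <= (34 * K + 16 * C1 ^+ 2) * S.
  move: H h1 h2 h3 h4 h5; move: (m ^+ 2) (q * m ^+ 2) (C1 * (m * w2)) (K * ws) => x1 x2 x3 x4.
  move: (C1 * (m * (4 * v2))) => x5.
  have -> : (34 * K + 16 * C1 ^+ 2) * S = 34 * (K * S) + 16 * (C1 ^+ 2 * S) by ring.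
  have -> : K * (16 * S) = 16 * (K * S) by ring.
  rewrite -[8 * _ * _]mulrA; move: (C1 ^+ 2 * v2 ^+ 2) (C1 ^+ 2 * S) (K * S) => x6 x7 x8; lra.
apply: le_trans h6 _; apply: ler_wpM2r => //; apply: (@le_trans _ _ C2); first by rewrite C2E lerDl.
by rewrite expr2 ler_peMl //; exact: C2p0.
Qed.

(** Let v be the projection of [y - x] and m the axial component of [Z y - Z x]. The point [Z x + v]
    lies on the line of [y], so f (Z y) <= f (Z x + v); expanding both sides at [Z x] bounds m^2 by
    errors that turn out to be O(|v|^s). Hence m = O(|v|^(s/2)), and m contributes only O(|v|^s) to
    F. *)
Let foot_move x y : `|x| <= a -> `|y| <= a ->
  [/\ `|AA (Z x) (y - x)| <= b / 4, AA (Z x) (Z y - Z x) = AA (Z x) (y - x),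
  `|Z y - Z x| <= 2 * `|AA (Z x) (y - x)|,
  `|lam (Z x) (Z y - Z x)| <= C2 * `|AA (Z x) (y - x)| `^ sg &
  `|F y - F x - tay (J (Z x)) (AA (Z x) (y - x))| <= C3 * `|AA (Z x) (y - x)| `^ s].
Proof.
move=> xa ya; have zb := Z_norm xa; have zk := le_trans zb bk.
have zb' := Z_norm ya; have crit := Z_crit xa.
have ti := Z_i xa.
have K00 := K0; have b00 := b0; have b44 := b4.
have [z zd] : {z | Z x = z} by exists (Z x).
have [z' zd'] : {z' | Z y = z'} by exists (Z y).
have Fx : F x = f z by rewrite /split_min zd.
have Fy : F y = f z' by rewrite /split_min zd'.
rewrite Fx Fy; rewrite zd in zb zk ti crit *; rewrite zd' in zb' *.
have Av : AA z (z' - z) = AA z (y - x).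
  rewrite [in RHS](x_Z x) [in RHS](x_Z y) zd zd' opprD addrACA -scalerBl.
  by rewrite AA_pr.
have [v vd] : {v | AA z (y - x) = v} by exists (AA z (y - x)).
rewrite vd in Av *.
have vb : `|v| <= b / 4.
  rewrite -vd; apply: le_trans (AA_bound _ zk) _.
  have yx : `|y - x| <= 2 * a by apply: le_trans (ler_normB _ _) _; lra.
  apply: (@le_trans _ _ (3 * K * (2 * (b / (24 * K))))).
    apply: ler_wpM2l; first by nng.
    by apply: le_trans yx _; apply: ler_wpM2l; rewrite ?ler0n // ab.
  by rewrite le_eqVlt; apply/orP; left; apply/eqP; field; rewrite gt_eqF.
set w := z' - z; set m := lam z w.
have wE : w = v + m *: e by rewrite {1}(h_AA z w) Av.
have wb : `|w| <= 2 * b by apply: le_trans (ler_normB _ _) _; lra.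
have mb : `|m| <= be / 2.
  apply: le_trans (lam_bound _ zk) _; rewrite -Kb.
  have -> : 4 * K * b = 2 * K * (2 * b) by ring.
  by apply: ler_wpM2l => //; nng.
have w12 : `|w| <= 2^-1 by apply: le_trans wb _; lra.
have v12 : `|v| <= 2^-1 by apply: le_trans vb _; lra.
have lv : lam z v = 0 by rewrite -vd lam_AA.
have Avv : AA z v = v by rewrite -vd AA_AA.
have X1 := foot_exp zk crit v12; have X2 := foot_exp zk crit w12.
rewrite Avv lv normr0 mul0r mulr0 add0r expr0n /= mulr0 subr0 in X1.
rewrite Av -/m in X2.
have zw : z + w = z' by rewrite /w addrC subrK.
rewrite zw in X2.
have Y1 : f z' <= f (z + v).
  rewrite -Fy; apply: Z_min => //.
    have -> : z + v = z' + (- m) *: e by rewrite -zw wE -addrA -addrA -scalerDl subrr scale0r addr0.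
    by rewrite prD pr_e addr0 -zd' pr_Z.
  rewrite mxE; apply: le_trans (ler_normD _ _) _.
  by have := row_norm_coord v i; move: ti vb; move: (`|v|) (`|_|) (`|_|) => x1 x2 x3; lra.
have v0 := normr_ge0 v; have m0 := normr_ge0 m.
have S0 : 0 <= `|v| `^ s by exact: powR_ge0.
have q1 := q_ge1 zk; have qK := qz_le zk.
have P1 : qz z * m ^+ 2 <= K * `|v| `^ s + (C1 * (`|m| * `|w| ^+ 2) + K * `|w| `^ s).
  move: X1 X2 Y1; move: (f z') (f (z + v)) (f z) (tay _ _) (qz z * m ^+ 2) => f1 f2 f3 t1 x0.
  move: (K * _) (C1 * _ + _) => u1 u2; rewrite !ler_norml => /andP[? ?] /andP[? ?] ?; lra.
have nm2 : `|m| ^+ 2 = m ^+ 2 by rewrite real_normK ?num_real.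
have wle : `|w| <= `|v| + `|m| by rewrite wE; apply: le_trans (ler_normD _ _) _; rewrite norm_te.
(* A first crude bound. If |m| > |v|, every error is a multiple of m^2 p(|m|), which [small4] makes
   smaller than m^2. *)
have mv : `|m| <= `|v|.
  rewrite leNgt; apply/negP => vm.
  have mp : 0 < `|m| by apply: le_lt_trans vm.
  have w2m : `|w| <= 2 * `|m| by apply: le_trans wle _; rewrite mulrDl mul1r lerD2r ltW.
  have m01 : 0 <= `|m| <= 1 by rewrite m0 /=; apply: le_trans mb be21.
  have [_ mp1 _] := pE m01; have [_ _ _ _ ms] := pows m01.
  have mbe : 0 <= `|m| <= be by rewrite m0 /=; apply: le_trans mb be2.
  have sm := small4 mbe.
  have pp : 0 < p `|m| by apply: powR_gt0.
  set M := `|m| ^+ 2 * p `|m| in ms *.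
  have w2' : `|w| ^+ 2 <= 4 * `|m| ^+ 2.
    have -> : 4 * `|m| ^+ 2 = (2 * `|m|) ^+ 2 by ring.
    by apply: lerXn2r => //; rewrite nnegrE; nng.
  have ws' : `|w| `^ s <= 16 * M.
    apply: (@le_trans _ _ ((2 * `|m|) `^ s)); first by apply: powR_mono; rewrite ?normr_ge0 //; case/andP: s04.
    have two1 : 1 <= (2 : R) by rewrite ler1n.
    apply: le_trans (powR_cM two1 m0 s04) _.
    have -> : (2 : R) ^+ 4 = 16 by ring.
    by apply: ler_wpM2l; rewrite ?ler0n.
  have vs' : `|v| `^ s <= M.
    by apply: le_trans ms; apply: powR_mono; [case/andP: s04|by []|exact: ltW].
  have mw : `|m| * `|w| ^+ 2 <= 4 * M.
    have -> : 4 * M = p `|m| * (4 * `|m| ^+ 2) by rewrite /M; ring.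
    by apply: ler_pM => //; nng.
  have M0 : 0 < M by rewrite /M; psv.
  have k1 := ler_wpM2l (ltW K0) vs'; have k2 := ler_wpM2l C1p mw; have k3 := ler_wpM2l (ltW K0) ws'.
  have k4 : `|m| ^+ 2 <= qz z * m ^+ 2 by rewrite nm2 ler_peMl // sqr_ge0.
  have k5 : (17 * K + 4 * C1 + 1) * M <= `|m| ^+ 2.
    have -> : (17 * K + 4 * C1 + 1) * M = `|m| ^+ 2 * ((17 * K + 4 * C1 + 1) * p `|m|) by rewrite /M; ring.
    by rewrite ler_piMr //; nng.
  move: P1 k1 k2 k3 k4 k5 M0.
  have -> : (17 * K + 4 * C1 + 1) * M = 17 * (K * M) + 4 * (C1 * M) + M by ring.
  have -> : K * (16 * M) = 16 * (K * M) by ring.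
  have -> : C1 * (4 * M) = 4 * (C1 * M) by ring.
  move: (qz z * _) (K * (`|v| `^ s)) (C1 * (`|m| * _)) (K * (`|w| `^ s)) (K * M) (C1 * M) (`|m| ^+ 2).
  by move=> x1 x2 x3 x4 x5 x6 x8; exact: foot_move_arith.
have w2v : `|w| <= 2 * `|v|.
  by apply: le_trans wle _; move: mv; move: (`|v|) (`|m|) => x1 x2; lra.
have w2' : `|w| ^+ 2 <= 4 * `|v| ^+ 2.
  have -> : 4 * `|v| ^+ 2 = (2 * `|v|) ^+ 2 by ring.
  by apply: lerXn2r => //; rewrite nnegrE; nng.
have ws' : `|w| `^ s <= 16 * `|v| `^ s.
  apply: (@le_trans _ _ ((2 * `|v|) `^ s)); first by apply: powR_mono; rewrite ?normr_ge0 //; case/andP: s04.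
  have two1 : 1 <= (2 : R) by rewrite ler1n.
  apply: le_trans (powR_cM two1 v0 s04) _.
  by have -> : (2 : R) ^+ 4 = 16 by ring.
have v01 := half1 v0 v12.
have v4 : (`|v| ^+ 2) ^+ 2 <= `|v| `^ s.
  rewrite -exprM -powR_nat //; apply: powR_antimono => //.
  by rewrite s4 andbT; apply: lt_trans s2; rewrite ltr0n.
have P2 : m ^+ 2 <= C2 ^+ 2 * `|v| `^ s.
  rewrite -nm2; apply: (foot_move_scal (q := qz z) S0 _ (erefl _) _ m0 (erefl _) v4 w2' ws').
    by apply/andP; split.
  by rewrite nm2.
have P3 : `|m| <= C2 * `|v| `^ sg.
  rewrite -(@ler_pXn2r _ 2%N) // ?nnegrE; last by have := C2p0 => ?; nng.
  by rewrite nm2 [leRHS]exprMn -(pow_ss v0).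
split => //.
set T := tay _ _ in X2 *.
have -> : f z' - f z - T = (f z' - f z - T - qz z * m ^+ 2) + qz z * m ^+ 2 by ring.
(* The mixed error |m| |w|^2 has order s/2 + 2 in |v|, and s/2 + 2 >= s because s <= 4. *)
have vv : `|v| `^ sg * `|v| ^+ 2 <= `|v| `^ s.
  rewrite [leRHS]pow_ss // [leRHS]expr2; apply: ler_wpM2l; first exact: powR_ge0.
  rewrite -powR_nat //; apply: powR_antimono => //.
  by apply/andP; split; [exact: lt_trans sg1|exact: sg2].
have k1 : qz z * m ^+ 2 <= K * (C2 ^+ 2 * `|v| `^ s).
  by apply: ler_pM => //; [apply: le_trans q1|exact: sqr_ge0].
have k2 : `|m| * `|w| ^+ 2 <= C2 * `|v| `^ sg * (4 * `|v| ^+ 2).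
  by apply: ler_pM => //; nng.
have k3 : C2 * `|v| `^ sg * (4 * `|v| ^+ 2) <= 4 * (C2 * `|v| `^ s).
  have -> : C2 * `|v| `^ sg * (4 * `|v| ^+ 2) = 4 * (C2 * (`|v| `^ sg * `|v| ^+ 2)) by ring.
  by apply: ler_wpM2l; rewrite ?ler0n //; apply: ler_wpM2l => //; exact: C2p0.
have k4 := ler_wpM2l C1p (le_trans k2 k3); have k5 := ler_wpM2l (ltW K0) ws'.
apply: le_trans (ler_normD _ _) _; apply: le_trans (lerD X2 (lexx _)) _.
rewrite [`|qz z * _|]ger0_norm; last by apply: mulr_ge0; [apply: le_trans q1|exact: sqr_ge0].
rewrite C3E.
have -> : (K * C2 ^+ 2 + 4 * C1 * C2 + 16 * K) * `|v| `^ s =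
  (C1 * (4 * (C2 * `|v| `^ s)) + K * (16 * `|v| `^ s)) + K * (C2 ^+ 2 * `|v| `^ s) by ring.
exact: (lerD (lerD k4 k5) k1).
Qed.

(** * The signed square root of f - F *)

Let dd (x : V) : R := x ord0 i - Z x ord0 i.
(** The sign makes the root change sign across the set of minima; the non-negative root would have a
    kink there. *)
Definition split_root (x : V) : R := Num.sg (dd x) * Num.sqrt (f x - F x).
Local Notation G := split_root.

Let aleb : a <= b.
Proof. by have := ab; have := b24; have := b0; move: (b / (24 * K)) => x; lra. Qed.

Let D_ge0 (x : V) : `|x| <= a -> 0 <= f x - F x.
Proof.
move=> xa; rewrite subr_ge0; apply: Z_min => //.
by apply: le_trans (row_norm_coord x i) _; apply: le_trans aleb.
Qed.

Let dd_b (x : V) : `|x| <= a -> `|dd x| <= b.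
Proof.
move=> xa; apply: le_trans (ler_normB _ _) _.
have := Z_i xa; have := le_trans (row_norm_coord x i) xa; have := ab; have := b24; have := b0.
by move: (b / (24 * K)) (`|x _ _|) (`|Z x _ _|) => u v w; lra.
Qed.

Let sqrtq z : `|z| <= kap -> 1 <= Num.sqrt (qz z) <= K.
Proof.
move=> zk; have q1 := q_ge1 zk; have q0 := qz_pos zk.
have s1 : 1 <= Num.sqrt (qz z) by rewrite -sqrtr1; apply: ler_wsqrtr.
rewrite s1 /=; apply: le_trans (qz_le zk).
by rewrite -[leRHS]sqr_sqrtr ?(ltW q0) // expr2 ler_peMl // (le_trans ler01).
Qed.

Let sqrt_diff (X Y c : R) : 0 <= Y -> 0 < c -> c <= Num.sqrt X -> `|Num.sqrt Y - Num.sqrt X| * c <= `|Y - X|.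
Proof.
move=> Y0 c0 cX; have X0 : 0 < X by rewrite -sqrtr_gt0; apply: lt_le_trans cX.
rewrite -[in leRHS](sqr_sqrtr Y0) -[in leRHS](sqr_sqrtr (ltW X0)) subr_sqr normrM.
apply: ler_wpM2l => //; apply: le_trans cX _; apply: le_trans (ler_norm _).
by rewrite lerDr sqrtr_ge0.
Qed.

(** With d = [dd x], the expansion at the foot gives f - F = q d^2 + O(|d|^(1 + s/2)). Taking the
    root divides the error by |d|. *)
Let line_zero (x : V) : `|x| <= a ->
  `|G x - Num.sqrt (qz (Z x)) * dd x| <= C4 * `|dd x| `^ sg.
Proof.
move=> xa; have zb := Z_norm xa; have zk := le_trans zb bk.
have crit := Z_crit xa; have db := dd_b xa; have D0 := D_ge0 xa.
have xE : x = Z x + dd x *: e by exact: x_Z.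
rewrite /split_root; have [t td] : {t | dd x = t} by exists (dd x).
rewrite td in db xE *.
have [->|t0] := eqVneq t 0.
  by rewrite sgr0 mul0r mulr0 subrr normr0 mulr_ge0 ?powR_ge0 ?C4p.
have tp : 0 < `|t| by rewrite normr_gt0.
have t01 : 0 <= `|t| <= 1 by rewrite normr_ge0 /=; apply: le_trans db _; have := b4; lra.
have t2 : `|t *: e| <= 2^-1 by rewrite norm_te; apply: le_trans db _; have := b4; lra.
have := foot_exp zk crit t2; rewrite -xE -/(split_min x).
have -> : AA (Z x) (t *: e) = 0 by rewrite (linZ (@AA_lin _)) AA_e // scaler0.
have -> : lam (Z x) (t *: e) = t by rewrite (linrZ _ _ (@lam_lin _)) lam_e // mulr1.
rewrite tay0 subr0 norm_te => H.
have [_ _ _ u4 u5] := pows t01.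
have H2 : `|f x - F x - qz (Z x) * t ^+ 2| <= C4 * (`|t| * `|t| `^ sg).
  apply: le_trans H _; rewrite C4E mulrDl pow_sg //.
  have -> : `|t| * `|t| ^+ 2 = `|t| ^+ 3 by ring.
  have -> : `|t| * (`|t| * p `|t|) = `|t| ^+ 2 * p `|t| by ring.
  by apply: lerD; [apply: ler_wpM2l u4; exact: C1p|apply: ler_wpM2l u5; exact: ltW K0].
have q0 := qz_pos zk; have /andP[sq1 _] := sqrtq zk.
have qt : Num.sqrt (qz (Z x) * t ^+ 2) = Num.sqrt (qz (Z x)) * `|t|.
  by rewrite sqrtrM ?(ltW q0) // sqrtr_sqr.
have -> : Num.sg t * Num.sqrt (f x - F x) - Num.sqrt (qz (Z x)) * t =
    Num.sg t * (Num.sqrt (f x - F x) - Num.sqrt (qz (Z x) * t ^+ 2)).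
  by rewrite qt mulrBr [Num.sg t * (_ * _)]mulrCA -numEsg.
rewrite normrM normr_sg t0 mul1r -(ler_pM2r tp).
have -> : C4 * `|t| `^ sg * `|t| = C4 * (`|t| * `|t| `^ sg) by ring.
apply: le_trans H2; apply: sqrt_diff => //.
by rewrite qt ler_peMl.
Qed.

Let pow_cM c t : 1 <= c -> 0 <= t -> (c * t) `^ sg <= c ^+ 2 * t `^ sg.
Proof. by move=> c1 t0; apply: powR_cM => //; exact: sg02. Qed.

Let q_diff (x y : V) : `|x| <= a -> `|y| <= a ->
  `|qz (Z y) - qz (Z x)| <= 9 * K * `|Z y - Z x| + 33 * K * `|Z y - Z x| `^ (s - 2).
Proof.
move=> xa ya; have zk := le_trans (Z_norm xa) bk; have zk' := le_trans (Z_norm ya) bk.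
have K00 := ltW K0.
have [zz|zn] := eqVneq (Z y) (Z x).
  by rewrite zz subrr normr0; nng.
have zE : Z y = Z x + (Z y - Z x) by rewrite addrC subrK.
have w0 : 0 < `|Z y - Z x| by rewrite normr_gt0 subr_eq0.
apply: (@q_var _ _ f (Z x)); rewrite -?zE //.
- rewrite w0 /=; apply: le_trans (ler_normB _ _) _.
  have := Z_norm xa; have := Z_norm ya; have := b4.
  by move: (`|Z x|) (`|Z y|) => u v; lra.
- by move=> w w2; apply: f_jet.
- by move=> w w2; apply: f_jet.
- by move=> w; have [] := J_bound zk w.
Qed.

(** An affine expansion of [G] about the foot of [x], where [G] vanishes. The three terms of C5 come
    from [line_zero] at [y], from the change of the quadratic coefficient between the two feet, and
    from the deviation of the foot of [y] from a linear motion. *)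
Let zero_exp (x y : V) : `|x| <= a -> `|y| <= a ->
  `|G y - Num.sqrt (qz (Z x)) * lam (Z x) (y - Z x)| <= C5 * `|y - Z x| `^ sg.
Proof.
move=> xa ya; have zk := le_trans (Z_norm xa) bk; have zk' := le_trans (Z_norm ya) bk.
have K00 := ltW K0; have HK := K1.
have [vb Aw wv lw _] := foot_move xa ya.
have hE : AA (Z x) (y - x) = AA (Z x) (y - Z x).
  have -> : y - x = (y - Z x) + (- dd x) *: e.
    by rewrite [in LHS](x_Z x) -/(dd x) opprD addrA scaleNr.
  by rewrite AA_pr.
rewrite hE in vb Aw wv lw.
set h := y - Z x in hE vb Aw wv lw *; set w := Z y - Z x in Aw wv lw *.
have hw : h = w + dd y *: e.
  by rewrite /h {1}(x_Z y) -/(dd y) /w addrAC.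
have h2b : `|h| <= 2 * b.
  apply: le_trans (ler_normB _ _) _; have := Z_norm xa; have := aleb.
  by move: ya; move: (`|y|) (`|Z x|) => u v; lra.
have h01 : 0 <= `|h| <= 1 by rewrite normr_ge0 /=; apply: le_trans h2b _; have := b4; lra.
have v3 : `|AA (Z x) h| <= 3 * K * `|h| by exact: AA_bound.
have w6 : `|w| <= 6 * K * `|h|.
  apply: le_trans wv _; have -> : 6 * K * `|h| = 2 * (3 * K * `|h|) by ring.
  by apply: ler_wpM2l; rewrite ?ler0n.
have t7 : `|dd y| <= 7 * K * `|h|.
  rewrite -norm_te; have -> : dd y *: e = h - w by rewrite hw addrC addKr.
  apply: le_trans (ler_normB _ _) _.
  have -> : 7 * K * `|h| = K * `|h| + 6 * K * `|h| by ring.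
  by apply: lerD => //; rewrite ler_peMl.
have lh : lam (Z x) h = lam (Z x) w + dd y.
  by rewrite hw (linrD _ _ (@lam_lin _)) (linrZ _ _ (@lam_lin _)) lam_e // mulr1.
have sg0 : 0 <= sg by case/andP: sg02.
have hn := normr_ge0 h.
have X1 : C4 * `|dd y| `^ sg <= 49 * K ^+ 2 * C4 * `|h| `^ sg.
  have -> : 49 * K ^+ 2 * C4 * `|h| `^ sg = C4 * ((7 * K) ^+ 2 * `|h| `^ sg) by ring.
  apply: ler_wpM2l; first exact: C4p.
  apply: (@le_trans _ _ ((7 * K * `|h|) `^ sg)); first exact: powR_mono.
  exact: pow_cM K7 hn.
have hs : `|h| `^ sg = `|h| * p `|h| by exact: pow_sg.
have [p0 p1 p2] := pE h01.
have hh : `|h| * `|h| <= `|h| `^ sg by rewrite hs; apply: ler_wpM2l.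
have hh2 : `|h| * `|h| `^ (s - 2) <= `|h| `^ sg by rewrite hs; apply: ler_wpM2l.
have X2 : `|Num.sqrt (qz (Z y)) - Num.sqrt (qz (Z x))| * `|dd y| <= 95 * 95 * K ^+ 4 * `|h| `^ sg.
  have /andP[sq1 _] := sqrtq zk.
  have := sqrt_diff (ltW (qz_pos zk')) ltr01 sq1; rewrite mulr1 => H.
  have H2 := le_trans H (q_diff xa ya); rewrite -/w in H2.
  have ws : `|w| `^ (s - 2) <= 36 * K ^+ 2 * `|h| `^ (s - 2).
    apply: (@le_trans _ _ ((6 * K * `|h|) `^ (s - 2))).
      by apply: powR_mono; rewrite ?normr_ge0 // subr_ge0; exact: ltW s2.
    have -> : 36 * K ^+ 2 = (6 * K) ^+ 2 by ring.
    exact: (powR_cM K6 hn s22).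
  have k1 : 9 * K * `|w| <= 54 * K ^+ 2 * `|h|.
    have -> : 54 * K ^+ 2 * `|h| = 9 * K * (6 * K * `|h|) by ring.
    by apply: ler_wpM2l => //; nng.
  have k2 : 33 * K * `|w| `^ (s - 2) <= 33 * K * (36 * K ^+ 2 * `|h| `^ (s - 2)).
    by apply: ler_wpM2l => //; nng.
  apply: (@le_trans _ _ ((54 * K ^+ 2 * `|h| + 33 * K * (36 * K ^+ 2 * `|h| `^ (s - 2))) * (7 * K * `|h|))).
    by apply: ler_pM => //; apply: le_trans H2 _; apply: lerD.
  have -> : (54 * K ^+ 2 * `|h| + 33 * K * (36 * K ^+ 2 * `|h| `^ (s - 2))) * (7 * K * `|h|) =
    7 * 54 * K ^+ 3 * (`|h| * `|h|) + 33 * 36 * 7 * K ^+ 4 * (`|h| * `|h| `^ (s - 2)) by ring.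
  have K34 : K ^+ 3 <= K ^+ 4 by rewrite [leRHS]exprS ler_peMl //; nng.
  have k3 : 7 * 54 * K ^+ 3 * (`|h| * `|h|) <= 7 * 54 * K ^+ 4 * `|h| `^ sg.
    apply: ler_pM; [by nng|by nng| |exact: hh].
    by apply: ler_wpM2l K34; nng.
  have k4 : 33 * 36 * 7 * K ^+ 4 * (`|h| * `|h| `^ (s - 2)) <= 33 * 36 * 7 * K ^+ 4 * `|h| `^ sg.
    by apply: ler_wpM2l hh2; nng.
  (* 7 x 54 + 33 x 36 x 7 = 8694 is at most 95 x 95. *)
  apply: le_trans (lerD k3 k4) _; rewrite -!mulrDl; apply: ler_wpM2r; first by nng.
  apply: ler_wpM2r; first by nng.
  by rewrite -!natrM -natrD ler_nat.
have X3 : Num.sqrt (qz (Z x)) * `|lam (Z x) w| <= 9 * K ^+ 3 * C2 * `|h| `^ sg.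
  have /andP[_ sqK] := sqrtq zk.
  have -> : 9 * K ^+ 3 * C2 * `|h| `^ sg = K * (C2 * ((3 * K) ^+ 2 * `|h| `^ sg)) by ring.
  apply: ler_pM; rewrite ?sqrtr_ge0 //; apply: le_trans lw _.
  apply: ler_wpM2l; first exact: C2p0.
  apply: (@le_trans _ _ ((3 * K * `|h|) `^ sg)); first exact: powR_mono.
  exact: pow_cM K3 hn.
rewrite lh.
have -> : G y - Num.sqrt (qz (Z x)) * (lam (Z x) w + dd y) =
  (G y - Num.sqrt (qz (Z y)) * dd y) + (Num.sqrt (qz (Z y)) - Num.sqrt (qz (Z x))) * dd y
    - Num.sqrt (qz (Z x)) * lam (Z x) w by ring.
rewrite C5E [leRHS]mulrDl [X in _ <= X + _]mulrDl.
apply: le_trans (ler_normB _ _) _; apply: lerD.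
  apply: le_trans (ler_normD _ _) _; apply: lerD; first exact: le_trans (line_zero ya) X1.
  by rewrite normrM.
by rewrite normrM ger0_norm ?sqrtr_ge0.
Qed.

(** The region near a point with [dd x != 0] is |h| <= |dd x|/N. As |dd x| <= b, its radius is at
    most a/2; as [N] is at least 48 K, axial components of such h are small against [dd x]. *)
Let N : R := 2 * b / a.
Let CM : R := 8 * C9 * N ^+ 2 + C5 * (1 + N) ^+ 2.

Let N48 : 48 * K <= N.
Proof.
rewrite /N ler_pdivlMr //; have -> : 2 * b = 48 * K * (b / (24 * K)) by field; rewrite gt_eqF.
by apply: ler_wpM2l; [have := K0 => ?; nng|exact: ab].
Qed.
Let N1 : 1 <= N. Proof. by apply: le_trans N48; have := K1; lra. Qed.
Let N0 : 0 < N. Proof. by apply: lt_le_trans N1. Qed.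

Let F_exp (x h : V) : `|x| <= a -> `|x + h| <= a ->
  `|F (x + h) - F x - tay (J (Z x)) (AA (Z x) h)| <= 81 * K ^+ 4 * C3 * `|h| `^ s.
Proof.
move=> xa ya; have zk := le_trans (Z_norm xa) bk.
have [_ _ _ _] := foot_move xa ya.
have -> : x + h - x = h by rewrite addrC addKr.
move=> H; apply: le_trans H _.
have -> : 81 * K ^+ 4 * C3 * `|h| `^ s = C3 * ((3 * K) ^+ 4 * `|h| `^ s) by ring.
apply: ler_wpM2l; first exact: C3p.
apply: (@le_trans _ _ ((3 * K * `|h|) `^ s)).
  by apply: powR_mono => //; [case/andP: s04|exact: AA_bound].
exact: powR_cM K3 (normr_ge0 h) s04.
Qed.

Let ah : a / 2 <= 2^-1. Proof. have := aleb; have := b4; lra. Qed.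

(** Put d = [dd x]. On the ball of radius |d|/N the root keeps its sign, and f - F is the square of
    the affine function [u] of [zero_exp] plus a perturbation [E]. As G - u is O(|d|^(s/2)), [E] is
    O(|d|^(1 + s/2)) on the whole ball. It also has an expansion of order s, so [jet_coef] bounds
    its coefficients, and [sqrt_scalar] yields the expansion of the root. *)
Let near_zero (x : V) : `|x| <= a / 2 -> dd x != 0 -> exists m : V -> R, linr m /\
  forall h, `|h| <= `|dd x| / N -> `|G (x + h) - (G x + m h)| <= CM * `|h| `^ sg.
Proof.
move=> xa2 dn0.
have a00 := a0; have xa : `|x| <= a by apply: le_trans xa2 _; lra.
have zk := le_trans (Z_norm xa) bk; have db := dd_b xa.
have NN := N0; have NN1 := N1.
have K00 := K0.
have /andP[sq1 sqK] := sqrtq zk.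
have [sq sqd] : {sq | Num.sqrt (qz (Z x)) = sq} by exists (Num.sqrt (qz (Z x))).
have [z zd] : {z | Z x = z} by exists (Z x).
have xz : x = z + dd x *: e by rewrite -zd; exact: x_Z.
have [d dE] : {d | dd x = d} by exists (dd x).
have dp : 0 < `|d| by rewrite -dE normr_gt0.
have GxE : G x = Num.sg d * Num.sqrt (f x - F x) by rewrite /split_root dE.
rewrite sqd in sq1 sqK; rewrite dE in dn0 db xz *; rewrite zd in zk.
pose rho := `|d| / N; have r0 : 0 < rho by rewrite /rho; psv.
have ra : rho <= a / 2.
  rewrite /rho ler_pdivrMr // /N; have -> : a / 2 * (2 * b / a) = b by field; rewrite gt_eqF.
  by [].
have dbe : 0 <= `|d| <= be.
  by rewrite normr_ge0 /=; apply: le_trans db _; apply: le_trans bbe _; have [? _] := andP be0; lra.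
have d01 : 0 <= `|d| <= 1 by rewrite normr_ge0 /=; apply: le_trans db _; have := b4; lra.
have [_ p1 _] := pE d01; have p0 : 0 <= p `|d| by exact: powR_ge0.
have dsg : `|d| `^ sg = `|d| * p `|d| by exact: pow_sg.
have sm := small dbe; have [M9 _ _ M2] := MMb.
have sm9 : 16 * C9 * p `|d| <= 1 by apply: le_trans sm; apply: ler_wpM2r.
have sm2 : 4 * C2 * p `|d| <= 1 by apply: le_trans sm; apply: ler_wpM2r.
have pp1 : p `|d| <= 1 by apply: powR_le1 => //; rewrite subr_ge0; exact: ltW sg1.
pose T := `|d| * `|d| `^ sg; have T0 : 0 <= T by rewrite /T; nng.
have dsd : `|d| `^ sg <= `|d| by rewrite dsg ler_piMr.
have dsT : `|d| `^ s <= T by rewrite /T pow_ss // expr2; apply: ler_wpM2r => //; exact: powR_ge0.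
have hd h : `|h : V| <= rho -> [/\ `|h| <= `|d| / 48, 3 * K * `|h| <= `|d| & 8 * K * `|h| <= `|d|].
  move=> hr; have hK : 48 * K * `|h| <= `|d|.
    apply: le_trans (_ : N * `|h| <= _); first by apply: ler_wpM2r => //; exact: N48.
    by move: hr; rewrite /rho ler_pdivlMr // mulrC.
  have hKh : `|h| <= K * `|h| by rewrite ler_peMl.
  have : 0 <= K * `|h| by nng.
  by move: hK hKh; rewrite -!mulrA; exact: near_zero_bounds.
have ya h : `|h : V| <= rho -> `|x + h| <= a.
  by move=> hr; apply: le_trans (ler_normD _ _) _; rewrite [leRHS]splitr lerD // (le_trans hr).
pose lm h := lam z h.
have lm_lin : linr lm by exact: lam_lin.
have lm_b h : `|h : V| <= rho -> `|lm h| <= `|d| / 4.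
  move=> hr; apply: le_trans (lam_bound h zk) _; have [_ _] := hd h hr.
  by rewrite -!mulrA; exact: le_quarter.
have lmd h : lam z (x + h - z) = d + lm h.
  have -> : x + h - z = h + d *: e by rewrite {1}xz -[z + _ + h]addrA [LHS]addrC addKr addrC.
  by rewrite (linrD _ _ (@lam_lin _)) (linrZ _ _ (@lam_lin _)) lam_e // mulr1 addrC.
have yz h : `|h : V| <= rho -> `|x + h - z| <= 2 * `|d|.
  move=> hr; have -> : x + h - z = h + d *: e by rewrite {1}xz -[z + _ + h]addrA [LHS]addrC addKr addrC.
  apply: le_trans (ler_normD _ _) _; rewrite norm_te; have [H _ _] := hd h hr.
  by rewrite addrC (@add_le_twice _ _ _ 48) // ler1n.
pose u h := sq * (d + lm h).
have near1 h : `|h : V| <= rho -> `|G (x + h) - u h| <= 4 * C5 * `|d| `^ sg.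
  move=> hr; have := zero_exp xa (ya h hr); rewrite zd -/(qz _) lmd -zd sqd zd => H.
  apply: le_trans H _; have -> : 4 * C5 * `|d| `^ sg = C5 * (2 ^+ 2 * `|d| `^ sg) by ring.
  apply: ler_wpM2l; first exact: C5p.
  apply: (@le_trans _ _ ((2 * `|d|) `^ sg)).
    by apply: powR_mono; [case/andP: sg02|by []|exact: yz].
  by apply: pow_cM; rewrite ?ler1n.
(* The displacement from the foot changes by [lm h] and by the axial deviation of the foot, each at
   most |d|/4. *)
have sgn h : `|h : V| <= rho -> Num.sg (dd (x + h)) = Num.sg d.
  move=> hr; have [_ _ _ lw _] := foot_move xa (ya h hr).
  have E : dd (x + h) = d + lm h - lam z (Z (x + h) - z).
    have yE : x + h - z = (Z (x + h) - z) + dd (x + h) *: e.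
      by rewrite {1}(x_Z (x + h)) -/(dd _) addrAC.
    rewrite -lmd yE (linrD _ _ (@lam_lin _)) (linrZ _ _ (@lam_lin _)) lam_e // mulr1.
    by rewrite [RHS]addrC addKr.
  have mu : `|lam z (Z (x + h) - z)| <= `|d| / 4.
    rewrite -zd; apply: le_trans lw _.
    have -> : x + h - x = h by rewrite addrC addKr.
    apply: (@le_trans _ _ (C2 * `|d| `^ sg)).
      apply: ler_wpM2l; first exact: C2p0.
      apply: powR_mono => //; first by case/andP: sg02.
      rewrite zd; apply: le_trans (AA_bound h zk) _; by have [] := hd h hr.
    rewrite dsg; have -> : C2 * (`|d| * p `|d|) = `|d| / 4 * (4 * C2 * p `|d|) by field.
    by rewrite ler_piMr //; nng.
  have dif : `|dd (x + h) - d| <= `|d| / 2.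
    rewrite E; have -> : d + lm h - lam z (Z (x + h) - z) - d = lm h - lam z (Z (x + h) - z) by ring.
    apply: le_trans (ler_normB _ _) _; have := lm_b h hr.
    have <- : `|d| / 4 + `|d| / 4 = `|d| / 2 by field.
    by move=> lmh; exact: lerD.
  exact: sgr_close.
have Gy h : `|h : V| <= rho -> G (x + h) = Num.sg d * Num.sqrt (f (x + h) - F (x + h)).
  by move=> hr; rewrite {1}/split_root sgn.
have sd2 : Num.sg d * Num.sg d = 1 by rewrite -expr2 sqr_sg dn0.
pose E h := f (x + h) - F (x + h) - u h ^+ 2.
have u_lin : linr (fun h => sq * lm h) by move=> c v w; rewrite lm_lin; ring.
have EB h : `|h : V| <= rho -> `|E h| <= 16 * C5 * (K + C5) * T.
  move=> hr.
  have -> : E h = (G (x + h) - u h) * (G (x + h) + u h).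
    rewrite -subr_sqr /E; congr (_ - _ ^+ 2); rewrite Gy // [RHS]exprMn sqr_sqrtr ?D_ge0 ?ya //.
    by rewrite (expr2 (Num.sg d)) sd2 mul1r.
  have n1 := near1 h hr.
  have ub : `|u h| <= 2 * K * `|d|.
    rewrite /u normrM ger0_norm; last by apply: le_trans sq1.
    have -> : 2 * K * `|d| = K * (2 * `|d|) by ring.
    apply: ler_pM => //; first by apply: le_trans sq1.
    apply: le_trans (ler_normD _ _) _; move: (lm_b h hr) (normr_ge0 d).
    by move=> lmh d_ge0; apply: (@add_le_twice _ _ _ 4) => //; rewrite ler1n.
  have gu : `|G (x + h) + u h| <= 4 * (K + C5) * `|d|.
    have -> : G (x + h) + u h = (G (x + h) - u h) + (u h + u h) by ring.
    apply: le_trans (ler_normD _ _) _.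
    have -> : 4 * (K + C5) * `|d| = 4 * C5 * `|d| + (2 * K * `|d| + 2 * K * `|d|) by ring.
    apply: lerD; last by apply: le_trans (ler_normD _ _) _; apply: lerD.
    by apply: le_trans n1 _; apply: ler_wpM2l => //; have := C5p => ?; nng.
  rewrite normrM; have -> : 16 * C5 * (K + C5) * T = 4 * C5 * `|d| `^ sg * (4 * (K + C5) * `|d|) by rewrite /T; ring.
  exact: ler_pM.
pose JE := jcomb (-1) (jaffsqr (sq * d) u_lin)
   (jcomb (-1) (jmap 1 (@AA_lin z) (J z)) (J x)).
have JEt h : tay JE h = tay (J x) h - tay (J z) (AA z h) - (u h ^+ 2 - u 0 ^+ 2).
  rewrite !tay_jcomb tay_jaffsqr tay_jmap /u (linr0 lm_lin); ring.
have h12 h : `|h : V| <= rho -> `|h| <= 2^-1.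
  by move=> hr; apply: le_trans hr (le_trans ra ah).
have xk : `|x| <= kap by apply: le_trans bk; apply: le_trans aleb.
have Eerr h : `|h : V| <= rho -> `|E h - E 0 - tay JE h| <= C7 * `|h| `^ s.
  move=> hr; rewrite JEt /E addr0.
  have -> : f (x + h) - F (x + h) - u h ^+ 2 - (f x - F x - u 0 ^+ 2) -
     (tay (J x) h - tay (J z) (AA z h) - (u h ^+ 2 - u 0 ^+ 2)) =
     (f (x + h) - f x - tay (J x) h) - (F (x + h) - F x - tay (J z) (AA z h)) by ring.
  rewrite C7E mulrDl; apply: le_trans (ler_normB _ _) _; apply: lerD.
    by apply: f_jet => //; exact: h12.
  by rewrite -zd; apply: F_exp => //; exact: ya.
have hsT h : `|h : V| <= rho -> `|h| `^ s <= T.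
  move=> hr; apply: le_trans dsT; apply: powR_mono => //; first by case/andP: s04.
  by have [H _ _] := hd h hr; apply: le_trans H _; rewrite ler_piMr // invf_le1 ?ltr0n // ler1n.
have C8b h : `|h : V| <= rho -> `|E 0 + tay JE h| <= C8 * T.
  move=> hr; have -> : E 0 + tay JE h = E h - (E h - E 0 - tay JE h) by ring.
  rewrite C8E mulrDl; apply: le_trans (ler_normB _ _) _; apply: lerD; first exact: EB.
  by apply: le_trans (Eerr h hr) _; apply: ler_wpM2l; [exact: C7p|exact: hsT].
have coef := jet_coef r0 C8b.
have C9p' := C9p; have C8p' := C8p; have C7p' := C7p.
have C89 : 8 * C8 <= C9.
  by rewrite C9E; apply: ler_wpDr => //; apply: ler_wpM2r => //; rewrite ler_nat.
exists (fun h => Num.sg d * ((2 * (sq * `|d|) * (Num.sg d * (sq * lm h)) + jl JE h) / (2 * Num.sqrt (f x - F x)))).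
split; first by move=> c v w; rewrite lm_lin jlD jlZ; ring.
move=> h hr.
have -> : G (x + h) - (G x + Num.sg d * ((2 * (sq * `|d|) * (Num.sg d * (sq * lm h)) + jl JE h) / (2 * Num.sqrt (f x - F x)))) =
  Num.sg d * (Num.sqrt (f (x + h) - F (x + h)) - Num.sqrt (f x - F x) -
   (2 * (sq * `|d|) * (Num.sg d * (sq * lm h)) + jl JE h) / (2 * Num.sqrt (f x - F x))).
  by rewrite Gy // GxE; ring.
rewrite normrM normr_sg dn0 mul1r.
have t01 := div_itv r0 (normr_ge0 h) hr.
have [c1 c2 c3] := coef h.
pose t := `|h| / rho.
have t0 : 0 <= t by case/andP: t01.
have htd : `|h| <= t * `|d|.
  rewrite /t /rho; have -> : `|h| / (`|d| / N) * `|d| = N * `|h| by field; rewrite !gt_eqF.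
  by rewrite ler_peMl.
have tdN : `|d| * t = N * `|h| by rewrite /t /rho; field; rewrite !gt_eqF.
have u0p : 0 < sq * `|d| by apply: mulr_gt0 => //; apply: lt_le_trans sq1.
have ts : `|h| `^ s <= T * t ^+ 2.
  apply: (@le_trans _ _ ((t * `|d|) `^ s)); first by apply: powR_mono => //; case/andP: s04.
  rewrite powRM // mulrC; apply: ler_pM; rewrite ?powR_ge0 //.
  by have [_ _ ->] := pows t01.
have CT0 : 0 <= C8 * T by nng.
(* With u0 = sq |d| and ep = C9 T, the resulting error is at most 8 C9 |d|^(s/2) t^2, hence at most
   8 C9 (|d| t)^(s/2), and |d| t = N |h|. *)
have main := sqrt_scalar (l := Num.sg d * (sq * lm h)) (e0 := E 0) (e1 := jl JE h)
   (E2 := E h - E 0 - jl JE h) (ep := C9 * T) (G0 := Num.sqrt (f x - F x))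
   (G := Num.sqrt (f (x + h) - F (x + h))) u0p t01.
apply: le_trans (main _ _ _ _ _ _ _ _ _) _; rewrite ?sqrtr_ge0 //.
- rewrite normrM normr_sg dn0 mul1r normrM ger0_norm; last by apply: le_trans sq1.
  have -> : sq * `|d| * t / 2 = sq * (`|d| * t / 2) by ring.
  apply: ler_wpM2l; first by apply: le_trans sq1.
  apply: le_trans (lam_bound h zk) _; rewrite tdN.
  have -> : N * `|h| / 2 = N / 2 * `|h| by ring.
  by apply: ler_wpM2r => //; apply: ge48_half; [exact: N48|exact: ltW].
- have := C8b 0; rewrite normr0 tay0 addr0 => H; apply: le_trans (H (ltW r0)) _.
  by apply: ler_wpM2r => //; apply: le_trans C89; rewrite ler_peMl // ler1n.
- by apply: le_trans c1 _; rewrite mulrA; apply: ler_wpM2r => //; apply: ler_wpM2r.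
- have -> : E h - E 0 - jl JE h = (E h - E 0 - tay JE h) + (jq JE h h + jt JE h h h) by rewrite /tay; ring.
  rewrite C9E; have -> : (16 * C8 + C7) * T * t ^+ 2 = C7 * (T * t ^+ 2) + (8 * (C8 * T) * t ^+ 2 + 8 * (C8 * T) * t ^+ 2) by ring.
  apply: le_trans (ler_normD _ _) _; apply: lerD.
    by apply: le_trans (Eerr h hr) _; apply: ler_wpM2l.
  apply: le_trans (ler_normD _ _) _; apply: lerD; first exact: c2.
  apply: le_trans c3 _; apply: ler_wpM2l; first by nng.
  by have [_ -> _] := pows t01.
- rewrite /T dsg; have -> : C9 * (`|d| * (`|d| * p `|d|)) = `|d| ^+ 2 / 16 * (16 * C9 * p `|d|) by field.
  apply: (@le_trans _ _ (`|d| ^+ 2 / 16)); first by rewrite ler_piMr //; nng.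
  rewrite exprMn; apply: ler_wpM2r; first by rewrite invr_ge0 ler0n.
  by rewrite ler_peMl ?sqr_ge0 // exprn_ege1.
- rewrite sqr_sqrtr; last exact: D_ge0.
  rewrite /E /u addr0 (linr0 lm_lin) addr0 !exprMn real_normK ?num_real //; ring.
- rewrite sqr_sqrtr; last by apply: D_ge0; exact: ya.
  have -> : (sq * `|d| + Num.sg d * (sq * lm h)) ^+ 2 = u h ^+ 2.
    have -> : sq * `|d| + Num.sg d * (sq * lm h) = Num.sg d * u h by rewrite normrEsg /u; ring.
    by rewrite exprMn expr2 sd2 mul1r.
  by rewrite /E; ring.
apply: (@le_trans _ _ (8 * C9 * N ^+ 2 * `|h| `^ sg)); last first.
  apply: ler_wpM2r; first exact: powR_ge0.
  by rewrite /CM lerDl; have := C5p => ?; nng.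
apply: (@le_trans _ _ (8 * C9 * (`|d| * t) `^ sg)); last first.
  rewrite tdN; have -> : 8 * C9 * N ^+ 2 * `|h| `^ sg = 8 * C9 * (N ^+ 2 * `|h| `^ sg) by ring.
  by apply: ler_wpM2l; [nng|exact: (pow_cM NN1 (normr_ge0 h))].
have -> : 8 * (C9 * T / (sq * `|d|)) * (`|h| / rho) ^+ 2 = 8 * ((C9 * T / (sq * `|d|)) * t ^+ 2) by rewrite /t; ring.
rewrite -[8 * C9 * _]mulrA; apply: ler_wpM2l; rewrite ?ler0n //.
rewrite powRM // mulrA; apply: ler_pM.
- by apply: divr_ge0; [nng|exact: ltW u0p].
- by rewrite sqr_ge0.
- rewrite /T ler_pdivrMr // -!mulrA; apply: ler_wpM2l => //.
  rewrite mulrC; apply: ler_wpM2l; first exact: powR_ge0.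
  by rewrite ler_peMl.
- rewrite -powR_nat //; apply: powR_antimono => //.
  by rewrite sg2 andbT; apply: lt_trans sg1; rewrite ltr01.
Qed.

(** For |h| >= |dd x|/N one has |h| + |dd x| <= (1 + N) |h|, so the expansion about the foot already
    has error O(|h|^(s/2)), but with another affine function than [near_zero]; [affine_patch]
    reconciles the two. If [dd x = 0] the expansion about the foot suffices. *)
Let split_gap (x : V) : `|x| <= a / 2 -> exists m : V -> R, linr m /\
  forall h, `|h| <= a / 2 -> `|G (x + h) - (G x + m h)| <= 5 * CM * `|h| `^ sg.
Proof.
move=> xa2; have a00 := a0; have xa : `|x| <= a by apply: le_trans xa2 _; lra.
have zk := le_trans (Z_norm xa) bk.
have ya h : `|h : V| <= a / 2 -> `|x + h| <= a.
  by move=> hr; apply: le_trans (ler_normD _ _) _; move: xa2 hr; move: (`|x|) (`|h|) => u v; lra.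
have C50 := C5p; have C90 := C9p; have NN1 := N1; have NN0 := N0.
have far h : `|h : V| <= a / 2 -> `|G (x + h) - (Num.sqrt (qz (Z x)) * dd x + Num.sqrt (qz (Z x)) * lam (Z x) h)|
    <= C5 * (`|h| + `|dd x|) `^ sg.
  move=> hr; have H := zero_exp xa (ya h hr).
  have E : Num.sqrt (qz (Z x)) * lam (Z x) (x + h - Z x) =
      Num.sqrt (qz (Z x)) * dd x + Num.sqrt (qz (Z x)) * lam (Z x) h.
    have -> : x + h - Z x = h + dd x *: e.
      by rewrite {1}(x_Z x) -[Z x + _ + h]addrA [LHS]addrC addKr addrC.
    by rewrite (linrD _ _ (@lam_lin _)) (linrZ _ _ (@lam_lin _)) lam_e // mulr1 mulrDr addrC.
  rewrite -E; apply: le_trans H _; apply: ler_wpM2l => //.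
  apply: powR_mono; [by case/andP: sg02|by []|].
  have -> : x + h - Z x = h + dd x *: e.
    by rewrite {1}(x_Z x) -[Z x + _ + h]addrA [LHS]addrC addKr addrC.
  by apply: le_trans (ler_normD _ _) _; rewrite norm_te.
have CM5 : C5 * (1 + N) ^+ 2 <= CM by rewrite /CM lerDr; nng.
have N11 : 1 <= 1 + N by rewrite lerDl; exact: ltW.
have CM0 : 0 <= CM by apply: le_trans CM5; nng.
have sql_lin : linr (fun h => Num.sqrt (qz (Z x)) * lam (Z x) h).
  by move=> c u v; rewrite lam_lin; ring.
have [d0|dn0] := eqVneq (dd x) 0.
  exists (fun h => Num.sqrt (qz (Z x)) * lam (Z x) h); split => // h hr.
  have := far h hr; rewrite d0 mulr0 add0r normr0 addr0.
  have -> : G x = 0 by rewrite /split_root d0 sgr0 mul0r.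
  rewrite add0r => H; apply: le_trans H _; apply: ler_wpM2r; first exact: powR_ge0.
  apply: le_trans (_ : CM <= _); last by rewrite ler_peMl // ler1n.
  apply: le_trans CM5; rewrite ler_peMr //; exact: exprn_ege1.
have [m [ml mb]] := near_zero xa2 dn0; exists m; split => // h hr.
have dp : 0 < `|dd x| by rewrite normr_gt0.
have r0 : 0 < `|dd x| / N by psv.
have ra : `|dd x| / N <= a / 2.
  rewrite ler_pdivrMr // /N; have -> : a / 2 * (2 * b / a) = b by field; rewrite gt_eqF.
  exact: dd_b.
apply: (@affine_patch _ _ G x CM sg (`|dd x| / N) (a / 2) (G x) (Num.sqrt (qz (Z x)) * dd x) m _ _ _ ml sql_lin) => //.
- by rewrite r0.
- exact: ltW sg1.
- move=> u /andP[ru ua]; apply: le_trans (far u ua) _.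
  apply: (@le_trans _ _ (C5 * ((1 + N) ^+ 2 * `|u| `^ sg))); last first.
    by rewrite mulrA; apply: ler_wpM2r => //; exact: powR_ge0.
  apply: ler_wpM2l => //; apply: (@le_trans _ _ (((1 + N) * `|u|) `^ sg)).
    apply: powR_mono; [by case/andP: sg02|by nng|].
    by rewrite mulrDl mul1r lerD2l mulrC -ler_pdivrMr.
  exact: pow_cM.
Qed.

Let F_ge0 (x : V) : `|x| <= a -> 0 <= F x.
Proof.
move=> xa; apply: f_ge0; apply: le_trans (Z_norm xa) _.
by have := b4; move: b => u; lra.
Qed.

Let G_sqr (x : V) : `|x| <= a -> f x = F x + G x ^+ 2.
Proof.
move=> xa; rewrite /split_root exprMn sqr_sqrtr ?D_ge0 // sqr_sg.
have [d0|_] := eqVneq (dd x) 0; last by rewrite /= mul1r addrC subrK.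
by rewrite /= mul0r addr0 /split_min {1}(x_Z x) -/(dd x) d0 scale0r addr0.
Qed.

Let F_inv (x : V) t : F (x + t *: e) = F x.
Proof. by congr (f _); apply: Z_pr; rewrite prD pr_e addr0. Qed.

(** The translate of the foot of [x] competes for the minimum on the line of [x + v]. Used for [v]
    and for [- v] it gives equality, so independence of another variable passes from [f] to [F]. *)
Let F_le (x v : V) : (forall y, `|y| <= 1 -> `|y + v| <= 1 -> f (y + v) = f y) ->
  v ord0 i = 0 -> `|x| <= a -> `|x + v| <= a -> `|v| <= 2^-1 -> F (x + v) <= F x.
Proof.
move=> finv vi xa xva v2.
have zb := Z_norm xa; have b4' := b4.
have -> : F x = f (Z x + v).
  rewrite finv //; first by apply: le_trans zb _; lra.
  by apply: le_trans (ler_normD _ _) _; lra.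
apply: Z_min => //; first by rewrite prD pr_Z prD.
by rewrite mxE vi addr0; apply: le_trans (Z_i xa) _; have := b0; move: b => u; lra.
Qed.

Lemma split_off_in : exists F0 G0 : V -> R,
  [/\ (forall x, `|x| <= a -> f x = F0 x + G0 x ^+ 2 /\ 0 <= F0 x),
      (forall x t, F0 (x + t *: e) = F0 x),
      (forall j, (forall x t, `|x| <= 1 -> `|x + t *: (delta_mx ord0 j : V)| <= 1 ->
          f (x + t *: (delta_mx ord0 j : V)) = f x) ->
        forall x t, `|x| <= a -> `|x + t *: (delta_mx ord0 j : V)| <= a ->
          F0 (x + t *: (delta_mx ord0 j : V)) = F0 x),
      (forall x, `|x| <= a / 2 -> exists J' : @jet R n, forall h, `|h| <= a / 2 ->
         `|F0 (x + h) - F0 x - tay J' h| <= 81 * K ^+ 4 * C3 * `|h| `^ s) &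
      (forall x, `|x| <= a / 2 -> exists m : V -> R, linr m /\
  forall h, `|h| <= a / 2 -> `|G0 (x + h) - (G0 x + m h)| <= 5 * CM * `|h| `^ sg)].
Proof.
exists split_min, split_root.
have a00 := a0; have aa : a <= 4^-1 by apply: le_trans aleb _; have := b4; lra.
split => //.
- by move=> x xa; split; [exact: G_sqr|exact: F_ge0].
- move=> j finv x t xa xta.
  have [->|ji] := eqVneq j i; first exact: F_inv.
  set v := t *: (delta_mx ord0 j : V).
  have vi : v ord0 i = 0 by rewrite /v !mxE eqxx eq_sym (negbTE ji) mulr0.
  have v2 : `|v| <= 2^-1.
    have -> : v = (x + v) - x by rewrite addrC addKr.
    by apply: le_trans (ler_normB _ _) _; lra.
  apply/eqP; rewrite eq_le F_le //=; last by move=> y; exact: finv.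
  have xE : x = x + v + (- v) by rewrite addrK.
  rewrite [in leLHS]xE F_le //.
  + move=> y y1; rewrite /v -scaleNr; exact: finv.
  + by rewrite mxE vi oppr0.
  + by rewrite -xE.
  + by rewrite normrN.
- move=> x xa2; have xa : `|x| <= a by apply: le_trans xa2 _; lra.
  exists (jmap 1 (@AA_lin (Z x)) (J (Z x))) => h ha2.
  rewrite tay_jmap mul1r; apply: F_exp => //.
  by apply: le_trans (ler_normD _ _) _; move: xa2 ha2; move: (`|x|) (`|h|) => u v; lra.
Qed.

End SplitOff.

Section SplitOffPackaged.
Context {R : realType} {n : nat}.
Local Notation V := 'rV[R]_n.
Local Notation e_ i := (delta_mx ord0 i : V).

(** The constants are fixed before [f], [J] and [i], so that one choice serves all rescaled
    functions and all axes. *)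
Lemma split_off (K kap s : R) : 1 <= K -> 0 < kap <= 4^-1 -> 2 < s <= 4 ->
  exists ep r C : R, [/\ 0 < ep, 0 < r <= 4^-1, 0 <= C & forall (f : V -> R) (J : V -> @jet R n) (i : 'I_n),
  (forall x, `|x| <= 1 -> 0 <= f x) ->
  (forall x, `|x| <= kap -> forall h, `|h| <= 2^-1 ->
     `|f (x + h) - f x - tay (J x) h| <= K * `|h| `^ s) ->
  (forall x, `|x| <= kap -> jet_bounded K (J x)) ->
  (forall x, `|x| <= kap -> 1 <= jq (J x) (e_ i) (e_ i)) ->
  f 0 <= ep ->
  exists F G : V -> R,
  [/\ (forall x, `|x| <= r -> f x = F x + G x ^+ 2 /\ 0 <= F x),
      (forall x t, F (x + t *: e_ i) = F x),
      (forall j, (forall x t, `|x| <= 1 -> `|x + t *: e_ j| <= 1 -> f (x + t *: e_ j) = f x) ->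
        forall x t, `|x| <= r -> `|x + t *: e_ j| <= r -> F (x + t *: e_ j) = F x),
      (forall x, `|x| <= r -> exists J' : @jet R n, forall h, `|h| <= r ->
         `|F (x + h) - F x - tay J' h| <= C * `|h| `^ s) &
      (forall x, `|x| <= r -> exists m : V -> R, linr m /\
         forall h, `|h| <= r -> `|G (x + h) - (G x + m h)| <= C * `|h| `^ (s / 2))]].
Proof.
move=> K1 kap01 s24; have /andP[kap0 kap4] := kap01; have /andP[s2 s4] := s24.
have K0 : 0 < K by lra.
have [C1 E1] : {C1 : R | C1 = 12 * 12 * 12 * K ^+ 3} by eexists.
have p1 : 0 <= C1 by rewrite E1; nng.
have [C2 E2] : {C2 : R | C2 = 34 * K + 16 * C1 ^+ 2 + 1} by eexists.
have p2 : 0 <= C2 by rewrite E2; nng.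
have [C3 E3] : {C3 : R | C3 = K * C2 ^+ 2 + 4 * C1 * C2 + 16 * K} by eexists.
have p3 : 0 <= C3 by rewrite E3; nng.
have [C4 E4] : {C4 : R | C4 = C1 + K} by eexists.
have p4 : 0 <= C4 by rewrite E4; nng.
have [C5 E5] : {C5 : R | C5 = 49 * K ^+ 2 * C4 + 95 * 95 * K ^+ 4 + 9 * K ^+ 3 * C2} by eexists.
have p5 : 0 <= C5 by rewrite E5; nng.
have [C7 E7] : {C7 : R | C7 = K + 81 * K ^+ 4 * C3} by eexists.
have p7 : 0 <= C7 by rewrite E7; nng.
have [C8 E8] : {C8 : R | C8 = 16 * C5 * (K + C5) + C7} by eexists.
have p8 : 0 <= C8 by rewrite E8; nng.
have [C9 E9] : {C9 : R | C9 = 16 * C8 + C7} by eexists.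
have p9 : 0 <= C9 by rewrite E9; nng.
have [MM EM] : {MM : R | MM = 16 * C9 + 17 * K + 4 * C1 + 8 * K + 4 * C2 + 2} by eexists.
have pM : 0 < MM.
  by rewrite EM; apply: ltr_wpDl; [nng|rewrite ltr0n].
have sg0 : 0 < s / 2 - 1 by lra.
have Mi : 0 < MM^-1 by rewrite invr_gt0.
have [d /andP[d0 d1] small] := powR_small sg0 Mi.
pose be := Num.min d kap.
have be0 : 0 < be <= kap by rewrite /be lt_min d0 kap0 /= ge_min lexx orbT.
have bed : be <= d by rewrite /be ge_min lexx.
have /andP[be00 _] := be0.
pose b := be / (8 * K); have b0 : 0 < b by rewrite /b; psv.
pose a := b / (24 * K) * (b / (24 * K)); have a0 : 0 < a by rewrite /a; psv.
have a4 : a / 2 <= 4^-1.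
  have b8 : b <= 4^-1.
    apply: (@le_trans _ _ kap) => //; case/andP: be0 => _; apply: le_trans.
    rewrite /b ler_pdivrMr; last by psv.
    by rewrite ler_peMr ?(ltW be00) //; lra.
  have b24 : b / (24 * K) <= b.
    rewrite ler_pdivrMr; last by psv.
    by rewrite ler_peMr ?(ltW b0) //; lra.
  have : a <= b * b by apply: ler_pM => //; nng.
  have : b * b <= 4^-1 * 1 by apply: ler_pM; rewrite ?(ltW b0) //; lra.
  move=> h1 h2; apply: (@le_trans _ _ a); first by rewrite ler_pdivrMr ?ltr0n // ler_peMr ?ltr1n ?ler1n ?(ltW a0).
  by apply: le_trans h2 _; apply: le_trans h1 _; rewrite mulr1.
pose N := 2 * b / a; pose CM := 8 * C9 * N ^+ 2 + C5 * (1 + N) ^+ 2.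
have N0 : 0 <= N by rewrite /N; nng.
have CM0 : 0 <= CM by rewrite /CM; nng.
have CF0 : 0 <= 81 * K ^+ 4 * C3 by nng.
exists a, (a / 2), (81 * K ^+ 4 * C3 + 5 * CM); split => //.
- by apply/andP; split => //; psv.
- by nng.
move=> f J i H0 H1 H2 H3 H4.
have sm t : 0 <= t <= be -> MM * t `^ (s / 2 - 1) <= 1.
  move=> /andP[t0 tb]; rewrite mulrC -ler_pdivlMr // mul1r; apply: small.
  by rewrite t0 /=; apply: le_trans bed.
have [F [G [HF HFi HFj HFJ HG]]] := @split_off_in R n f J s K kap be b a a i C1 C2 C3 C4 C5 C7 C8 C9 MM
  E1 E2 E3 E4 E5 E7 E8 E9 EM s24 K1 kap01 be0 erefl erefl erefl sm H0 H1 H2 H3 H4.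
have aa x : x <= a / 2 -> x <= a by move=> H; apply: le_trans H _; rewrite ler_pdivrMr ?ltr0n // ler_peMr ?ler1n ?(ltW a0).
exists F, G; split => //.
- by move=> x xa; apply: HF; apply: aa.
- by move=> j Hj x t xa xta; apply: HFj => //; apply: aa.
- move=> x xa; have [J' HJ'] := HFJ x xa; exists J' => h ha.
  apply: le_trans (HJ' h ha) _; apply: ler_wpM2r; first exact: powR_ge0.
  by rewrite lerDl; nng.
- move=> x xa; have [m [ml Hm]] := HG x xa; exists m; split => // h ha.
  apply: le_trans (Hm h ha) _; apply: ler_wpM2r; first exact: powR_ge0.
  by rewrite lerDr.
Qed.

End SplitOffPackaged.

(** * Gluing local decompositions *)

Section Bump.
Context {R : realType} {n : nat} (hn : (0 < n)%N).
Local Notation V := 'rV[R]_n.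

(** The square of a positive part has an expansion of order 2 at every point, and no summand is
    asked for a higher order. For |u| <= 1/2 the difference is at least 3 n / 4, and (3/4)^2 exceeds
    1/2. *)
Definition qbump (u : V) : R := (Num.max 0 (n%:R - \sum_(i < n) u ord0 i ^+ 2)) ^+ 2.

Let nR1 : 1 <= n%:R :> R. Proof. by rewrite ler1n. Qed.

Lemma bump_neq0 u : qbump u != 0 -> `|u| <= n%:R.
Proof.
move=> b0; apply: row_norm_le => // i.
have qp : 0 < n%:R - \sum_(j < n) u ord0 j ^+ 2.
  rewrite ltNge; apply: contra b0 => q0; rewrite /qbump max_l //.
  by rewrite expr0n.
have : u ord0 i ^+ 2 <= n%:R.
  apply: ltW; apply: le_lt_trans (_ : \sum_(j < n) u ord0 j ^+ 2 < n%:R); last by lra.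
  rewrite (bigD1 i) //= lerDl; apply: sumr_ge0 => j _; exact: sqr_ge0.
move=> H; rewrite -(@ler_pXn2r _ 2%N) // ?nnegrE // real_normK ?num_real //.
by apply: le_trans H _; rewrite expr2 ler_peMl.
Qed.

Lemma bump_half u : `|u| <= 2^-1 -> 2^-1 <= qbump u.
Proof.
move=> u2; have S : \sum_(i < n) u ord0 i ^+ 2 <= n%:R / 4.
  have -> : n%:R / 4 = \sum_(i < n) (4^-1 : R).
    by rewrite sumr_const card_ord -[RHS]mulr_natl.
  apply: ler_sum => i _; have H := le_trans (row_norm_coord u i) u2.
  have : `|u ord0 i| ^+ 2 <= 2^-1 ^+ 2 by apply: lerXn2r; rewrite ?nnegrE.
  by rewrite real_normK ?num_real // => H2; apply: le_trans H2 _; rewrite expr2; lra.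
rewrite /qbump; set q := n%:R - _.
have q34 : 3 / 4 <= q.
  by rewrite /q; move: S nR1; move: (\sum_(i < n) _) (n%:R) => x y; lra.
rewrite max_r; last by lra.
apply: (@le_trans _ _ ((3 / 4) ^+ 2)); first by rewrite expr2; lra.
by apply: lerXn2r; rewrite ?nnegrE //; lra.
Qed.

Let pos_sq (q d : R) : `|Num.max 0 (q + d) ^+ 2 - Num.max 0 q ^+ 2 - 2 * Num.max 0 q * d| <= d ^+ 2.
Proof.
rewrite ler_norml.
by case: (leP 0 (q + d)) => h1; case: (leP 0 q) => h2; apply/andP; split; nra.
Qed.

Lemma gap_bump : exists2 C : R, 0 <= C & forall u, gap C 1 2 qbump u.
Proof.
pose m : R := n%:R; pose Q := m + m * (m + 1) ^+ 2.
have m1 : 1 <= m := nR1; have m0 : 0 <= m by lra.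
pose B := 2 * m * (m + 1); have B0 : 0 <= B by rewrite /B; nng; lra.
have Q0 : 0 <= Q by rewrite /Q; nng; lra.
pose C := Q ^+ 2 + 2 * Q * B + (B + m) ^+ 2 + 2 * Q * m.
have C0 : 0 <= C by rewrite /C; nng.
exists C => // u; have [um|um] := leP `|u| (m + 1); last first.
  apply: (gap_ext (g := fun=> 0)) => //; last by apply: gap_const => //; rewrite normr0.
  move=> h h1; apply/esym/eqP; apply/negPn/negP => /bump_neq0.
  rewrite leNgt => /negP; apply; rewrite -/m.
  have : `|u| <= `|u + h| + `|h| by rewrite -[X in `|X| <= _](addrK h); exact: ler_normB.
  lra.
pose q := m - \sum_(i < n) u ord0 i ^+ 2.
pose l (h : V) := - 2 * \sum_(i < n) (u ord0 i * h ord0 i).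
have l_lin : linr l.
  move=> c v w; rewrite /l.
  have -> : \sum_(i < n) (u ord0 i * (c *: v + w) ord0 i) =
     c * \sum_(i < n) (u ord0 i * v ord0 i) + \sum_(i < n) (u ord0 i * w ord0 i).
    by rewrite mulr_sumr -big_split /=; apply: eq_bigr => i _; rewrite !mxE; ring.
  by ring.
have sumle (F : 'I_n -> R) c : (forall i, `|F i| <= c) -> `|\sum_(i < n) F i| <= m * c.
  move=> H; apply: le_trans (ler_norm_sum _ _ _) _.
  apply: le_trans (ler_sum _ (fun i _ => H i)) _.
  by rewrite sumr_const card_ord -[leLHS]mulr_natl.
have lb h : `|l h| <= B * `|h|.
  rewrite /l normrM normrN (ger0_norm (x := 2)) // /B -!mulrA; apply: ler_wpM2l => //.
  apply: sumle => i; rewrite normrM; apply: ler_pM => //; last exact: row_norm_coord.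
  by apply: le_trans um; exact: row_norm_coord.
have sqb (v : V) : `|\sum_(i < n) v ord0 i ^+ 2| <= m * `|v| ^+ 2.
  apply: sumle => i; rewrite normrX; apply: lerXn2r; rewrite ?nnegrE //.
  exact: row_norm_coord.
have qb : `|Num.max 0 q| <= Q.
  have : `|q| <= Q.
    apply: le_trans (ler_normB _ _) _; rewrite ger0_norm //; apply: lerD => //.
    apply: le_trans (sqb u) _; apply: ler_wpM2l => //.
    by apply: lerXn2r; rewrite ?nnegrE //; lra.
  by case: (leP 0 q) => h; rewrite ?normr0.
have P0 : 0 <= Num.max 0 q by rewrite le_max lexx.
rewrite ger0_norm // in qb.
exists (fun h => 2 * Num.max 0 q * l h); split => [c v w||h|h h1].
- by rewrite l_lin; ring.
- rewrite /qbump -/m -/q normrX ger0_norm //.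
  apply: (@le_trans _ _ (Q ^+ 2)); first by apply: lerXn2r; rewrite ?nnegrE.
  by rewrite /C -!addrA lerDl; nng.
- rewrite divr1 (normrM (2 * Num.max 0 q)) (normrM 2) (ger0_norm P0) (ger0_norm (x := 2)) //.
  apply: (@le_trans _ _ (2 * Q * (B * `|h|))).
    by apply: ler_pM => //; [nng|apply: ler_wpM2l].
  rewrite mulrA; apply: ler_wpM2r => //; rewrite /C.
  have := sqr_ge0 Q; have := sqr_ge0 (B + m); have : 0 <= 2 * Q * m by nng.
  by move: (Q ^+ 2) (2 * Q * B) (2 * Q * m) ((B + m) ^+ 2) => ? ? ? ?; lra.
- rewrite divr1 powR_nat //; pose d := l h - \sum_(i < n) h ord0 i ^+ 2.
  have -> : qbump (u + h) = Num.max 0 (q + d) ^+ 2.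
    rewrite /qbump; congr (Num.max 0 _ ^+ 2); rewrite /q /d /l -/m.
    have -> : \sum_(i < n) (u + h) ord0 i ^+ 2 = \sum_(i < n) u ord0 i ^+ 2
       + 2 * \sum_(i < n) (u ord0 i * h ord0 i) + \sum_(i < n) h ord0 i ^+ 2.
      by rewrite mulr_sumr -!big_split /=; apply: eq_bigr => i _; rewrite !mxE; ring.
    by ring.
  rewrite /qbump -/m -/q.
  have -> : Num.max 0 (q + d) ^+ 2 - Num.max 0 q ^+ 2 - 2 * Num.max 0 q * l h =
     (Num.max 0 (q + d) ^+ 2 - Num.max 0 q ^+ 2 - 2 * Num.max 0 q * d) -
     2 * Num.max 0 q * \sum_(i < n) h ord0 i ^+ 2 by rewrite /d; ring.
  apply: le_trans (ler_normB _ _) _; apply: le_trans (lerD (pos_sq q d) (lexx _)) _.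
  have db : d ^+ 2 <= (B + m) ^+ 2 * `|h| ^+ 2.
    rewrite -exprMn -real_normK ?num_real //; apply: lerXn2r; rewrite ?nnegrE //; first by nng.
    apply: le_trans (ler_normB _ _) _; rewrite mulrDl; apply: lerD; first exact: lb.
    apply: le_trans (sqb h) _; apply: ler_wpM2l => //.
    by rewrite expr2 ler_piMl.
  have eb : `|2 * Num.max 0 q * \sum_(i < n) h ord0 i ^+ 2| <= 2 * Q * m * `|h| ^+ 2.
    rewrite (normrM (2 * Num.max 0 q)) (normrM 2) (ger0_norm P0) (ger0_norm (x := 2)) // -(mulrA (2 * Q)).
    by apply: ler_pM => //; [nng|apply: ler_wpM2l].
  apply: le_trans (lerD db eb) _; rewrite -mulrDl; apply: ler_wpM2r; first by nng.
  rewrite /C; have := sqr_ge0 Q; have : 0 <= 2 * Q * B by nng.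
  by move: (Q ^+ 2) (2 * Q * B) (2 * Q * m) ((B + m) ^+ 2) => ? ? ? ?; lra.
Qed.

End Bump.

Lemma mod8_inj (k l : nat) : k = l %[mod 8] -> (l < k + 3)%N -> (k < l + 3)%N -> k = l.
Proof. lia. Qed.

(** * Coloured cells adapted to a slowly varying scale *)

Section Glue.
Context {R : realType} {n : nat} (hn : (0 < n)%N).
Local Notation V := 'rV[R]_n.

Definition cell := (nat * {ffun 'I_n -> int})%type.
(** By [bump_neq0] the support of a bump has radius at most n sides, which is 2^-k / 8, a small
    fraction of the scale 2^-k. *)
Definition cell_side (k : nat) : R := (8 * n%:R * 2 ^+ k)^-1.
Definition cell_ctr (q : cell) : V := cell_side q.1 *: \row_i (q.2 i)%:~R.
(** Exponents are recorded modulo 8 and positions modulo 4 n. Cells felt near one point have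
    exponents that differ by less than 3, so congruent exponents are equal; then distinct congruent
    positions have centres at least 4 n sides apart, too far for two supports. The form [.-1.+1]
    exhibits the successor that [inord] expects. *)
Definition colour := ('I_8 * {ffun 'I_n -> 'I_(4 * n).-1.+1})%type.
Definition cell_colour (q : cell) : colour :=
  (inord (q.1 %% 8), [ffun i => inord `|(q.2 i %% (4 * n)%:Z)%Z|%N]).
Definition cell_bump (q : cell) (x : V) : R := qbump ((cell_side q.1)^-1 *: (x - cell_ctr q)).

Let nR0 : 0 < n%:R :> R. Proof. by rewrite ltr0n. Qed.
Let nR1 : 1 <= n%:R :> R. Proof. by rewrite ler1n. Qed.
Let side0 k : 0 < cell_side k. Proof. by rewrite invr_gt0; psv. Qed.

Let sidei0 k : 0 < (cell_side k)^-1. Proof. by rewrite invr_gt0. Qed.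

Lemma cell_sideE k : 8 * n%:R * cell_side k = (2 ^+ k)^-1.
Proof. by rewrite /cell_side; field; rewrite expf_neq0 // gt_eqF. Qed.

Lemma cell_colour_eq q q' : cell_colour q = cell_colour q' ->
  q.1 = q'.1 %[mod 8] /\ forall i, q.2 i != q'.2 i -> 4 * n%:R <= `|(q.2 i)%:~R - (q'.2 i)%:~R : R|.
Proof.
case=> /(congr1 (@nat_of_ord _)); rewrite !inordK ?ltn_pmod // => E1 E2; split => // i pn.
have := congr1 (fun g : {ffun _ -> _} => nat_of_ord (g i)) E2.
have n4 : ((4 * n)%:Z != 0)%R by rewrite eqz_nat; lia.
have bnd (p : int) : (`|(p %% (4 * n)%:Z)%Z| < (4 * n).-1.+1)%N.
  have := ltz_mod p n4; have := modz_ge0 p n4; lia.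
rewrite !ffunE !inordK // => E.
have {}E : (q.2 i %% (4 * n)%:Z = q'.2 i %% (4 * n)%:Z)%Z.
  have := modz_ge0 (q.2 i) n4; have := modz_ge0 (q'.2 i) n4; lia.
have : ((4 * n)%:Z %| q.2 i - q'.2 i)%Z by rewrite -eqz_mod_dvd E.
rewrite dvdzE => /dvdn_leq; rewrite absz_gt0 subr_eq0 => /(_ pn) H.
rewrite -intrB -intr_norm -natrM -[(4 * n)%:R]/((4 * n)%:Z%:~R) ler_int.
lia.
Qed.

Lemma cell_bump_neq0 q x : cell_bump q x != 0 -> `|x - cell_ctr q| <= n%:R * cell_side q.1.
Proof.
move/(bump_neq0 hn); rewrite normrZ (gtr0_norm (sidei0 _)).
by rewrite mulrC ler_pdivrMr.
Qed.

Lemma gap_cell_bump : exists2 C : R, 0 <= C & forall q x, gap C (cell_side q.1) 2 (cell_bump q) x.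
Proof.
have [C C0 HC] := @gap_bump R n hn; exists C => // q x.
have s0 := side0 q.1.
have := gap_scale 1 (cell_ctr q) s0 ltr01 (HC ((cell_side q.1)^-1 *: (x - cell_ctr q))).
rewrite normr1 mul1r mulr1 scalerA divff ?gt_eqF // scale1r addrC subrK => H.
by apply: (gap_ext s0 _ H) => h _; rewrite mul1r.
Qed.

Lemma cell_exists (x : V) (k : nat) : exists q : cell,
  [/\ q.1 = k, `|x - cell_ctr q| <= cell_side k & 2^-1 <= cell_bump q x].
Proof.
have s0 := side0 k.
pose q : cell := (k, [ffun i => Num.floor (x ord0 i / cell_side k + 2^-1)]).
have half : `|(cell_side k)^-1 *: (x - cell_ctr q)| <= 2^-1.
  apply: row_norm_le => // i; rewrite !mxE ffunE /=.
  have -> : (cell_side k)^-1 * (x ord0 i - cell_side k * (Num.floor (x ord0 i / cell_side k + 2^-1))%:~R) =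
    x ord0 i / cell_side k - (Num.floor (x ord0 i / cell_side k + 2^-1))%:~R.
    by field; rewrite gt_eqF.
  set y := x ord0 i / _; have := real_floor_itv (num_real (y + 2^-1)).
  rewrite intrD => /andP[]; move: (_%:~R) => z ? ?; rewrite ler_norml; apply/andP; split; lra.
exists q; split => //; last exact: bump_half.
move: half; rewrite normrZ (gtr0_norm (sidei0 _)) mulrC ler_pdivrMr // => H.
by apply: le_trans H _; rewrite ler_piMl ?(ltW s0) // invf_le1 ?ltr0n // ler1n.
Qed.

Section Family.
Variables (U : set V) (rho : V -> R).
Hypothesis rho_pos : forall x, U x -> 0 < rho x <= 1.
Hypothesis rho_slow : forall x y, U x -> U y -> `|x - y| <= rho x ->
  rho y <= 2 * rho x /\ rho x <= 2 * rho y.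

(** Two points within [kap * rho x] of [x] are at most one side of a nearby cell apart. *)
Let kap : R := (64 * n%:R)^-1.
Let kap0 : 0 < kap. Proof. by rewrite invr_gt0; psv. Qed.
Let kap1 : kap <= 64^-1.
Proof. by rewrite /kap lef_pV2 ?posrE; psv; rewrite ler_peMr // ?ler0n // ler1n. Qed.

Definition selected (q : cell) (y : V) : Prop :=
  [/\ U y, (2 ^+ q.1)^-1 <= rho y, rho y < 2 * (2 ^+ q.1)^-1 & `|y - cell_ctr q| <= cell_side q.1].

(** [y] certifies that the size of the cell fits [rho]; the point [w] certifies that its bump is
    felt near [x]. *)
Definition near_cell (x : V) (q : cell) (y : V) : Prop :=
  selected q y /\ exists w, `|w - x| <= kap * rho x /\ cell_bump q w != 0.

Let near_cell_dist x q y : U x -> near_cell x q y ->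
  [/\ `|y - x| <= rho y / 4 + rho x / 64, rho y <= 2 * rho x & rho x <= 2 * rho y].
Proof.
move=> Ux [[Uy k1 k2 yc] [w [wx /cell_bump_neq0 wc]]].
have /andP[rx _] := rho_pos Ux; have /andP[ry _] := rho_pos Uy.
have d : `|y - x| <= rho y / 4 + rho x / 64.
  have -> : y - x = (y - cell_ctr q) - (w - cell_ctr q) + (w - x).
    by apply/rowP => j; rewrite !mxE; ring.
  apply: le_trans (ler_normD _ _) _; apply: lerD; last first.
    by apply: le_trans wx _; rewrite mulrC; apply: ler_wpM2l => //; exact: ltW.
  apply: le_trans (ler_normB _ _) _; apply: le_trans (lerD yc wc) _.
  apply: (@le_trans _ _ (2 * n%:R * cell_side q.1)).
    rewrite -{1}[cell_side q.1]mul1r -mulrDl; apply: ler_wpM2r; first exact: ltW.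
    by have := nR1; lra.
  have -> : 2 * n%:R * cell_side q.1 = 8 * n%:R * cell_side q.1 / 4 by field.
  by rewrite cell_sideE; apply: ler_wpM2r => //; rewrite invr_ge0 ler0n.
(* Slow variation is used at the point with the larger [rho], since the distance is below that
   value. *)
have [xy|yx] := leP (rho x) (rho y).
  have [|r1 r2] := rho_slow Uy Ux; first by apply: le_trans d _; lra.
  by split.
have [|r1 r2] := rho_slow Ux Uy; first by rewrite distrC; apply: le_trans d _; lra.
by split.
Qed.

Let near_cell_scale x q y : U x -> near_cell x q y ->
  (2 ^+ q.1)^-1 <= 2 * rho x /\ rho x < 4 * (2 ^+ q.1)^-1.
Proof.
move=> Ux nc; have [_ r1 r2] := near_cell_dist Ux nc.
by case: nc => [[_ k1 k2 _] _]; split; lra.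
Qed.

(** Both scales are comparable to [rho x], so equal colours force equal exponents by [mod8_inj].
    Different positions would put the centres at least 4 n sides apart, whereas two supports and two
    short moves bridge at most 2 n + 1 sides. *)
Let near_cell_uniq x q y q' y' : U x -> near_cell x q y -> near_cell x q' y' ->
  cell_colour q = cell_colour q' -> q = q'.
Proof.
move=> Ux nc nc' /cell_colour_eq [kk pp].
have [a1 a2] := near_cell_scale Ux nc; have [b1 b2] := near_cell_scale Ux nc'.
have lt8 (k k' : nat) : (2 ^+ k)^-1 <= 2 * rho x -> rho x < 4 * (2 ^+ k')^-1 -> (k' < k + 3)%N.
  move=> h1 h2; have h : (2 ^+ k)^-1 < 8 * (2 ^+ k')^-1 :> R by lra.
  have p0 j : 0 < 2 ^+ j :> R by psv.
  have : 2 ^+ k' < 8 * 2 ^+ k :> R.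
    by move: h; rewrite ltr_pdivlMr // mulrC ltr_pdivrMr.
  have -> : 8 * 2 ^+ k = 2 ^+ (k + 3) :> R by rewrite exprD mulrC; congr (_ * _); ring.
  by rewrite ltr_eXn2l ?ltr1n.
have l1 := lt8 _ _ a1 b2; have l2 := lt8 _ _ b1 a2.
have kE := mod8_inj kk l1 l2.
case: q q' kE nc nc' kk pp a1 a2 {b1 b2 l1 l2} => k p [k' p'] /= <- nc nc' _ pp a1 a2.
congr pair; apply/ffunP => i; apply/eqP; apply/negPn/negP => pn.
have := pp i pn; rewrite leNgt => /negP; apply.
have s0 := side0 k.
have [_ [w [wx /cell_bump_neq0 wc]]] := nc; have [_ [w' [wx' /cell_bump_neq0 wc']]] := nc'.
rewrite /= in wc wc'.
have cc : `|cell_ctr (k, p) - cell_ctr (k, p')| <= 2 * n%:R * cell_side k + 2 * kap * rho x.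
  have -> : cell_ctr (k, p) - cell_ctr (k, p') = (w' - cell_ctr (k, p')) - (w - cell_ctr (k, p)) + ((w - x) - (w' - x)).
    by apply/rowP => j; rewrite !mxE; ring.
  have -> : 2 * n%:R * cell_side k + 2 * kap * rho x = (n%:R * cell_side k + n%:R * cell_side k) + (kap * rho x + kap * rho x) by ring.
  apply: le_trans (ler_normD _ _) _; apply: lerD; apply: le_trans (ler_normB _ _) _; exact: lerD.
have kr : 2 * kap * rho x <= cell_side k.
  have -> : cell_side k = 2 * kap * (4 * (2 ^+ k)^-1).
    by rewrite -cell_sideE /kap; field; rewrite gt_eqF.
  by apply: ler_wpM2l; [nng|exact: ltW].
have := row_norm_coord (cell_ctr (k, p) - cell_ctr (k, p')) i.
rewrite !mxE /= -mulrBr normrM gtr0_norm // => H.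
rewrite -(ltr_pM2l s0); apply: le_lt_trans H _; apply: le_lt_trans cc _.
have nn : 1 <= n%:R :> R by rewrite ler1n.
have : cell_side k <= n%:R * cell_side k by rewrite ler_peMl // ltW.
have -> : cell_side k * (4 * n%:R) = 4 * (n%:R * cell_side k) by ring.
rewrite -mulrA; move: (n%:R * cell_side k) (2 * kap * rho x) kr => u v kr; lra.
Qed.

(** One witness per cell, so that the local functions attached to a cell do not vary with the point
    of evaluation. *)
Let wit (q : cell) : V := xget 0 [set y | selected q y].
Let witP q y : selected q y -> selected q (wit q).
Proof. by move=> sq; apply: (@xgetPex _ 0 [set y | selected q y]); exists y. Qed.

Let pick_cell (c : colour) (x : V) : option cell :=
  match pselect (exists q, [/\ cell_colour q = c, selected q (wit q) & cell_bump q x != 0]) with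
  | left ex => Some (sval (cid ex))
  | right _ => None
  end.

Let pickP c x : match pick_cell c x with
  | Some q => [/\ cell_colour q = c, selected q (wit q) & cell_bump q x != 0]
  | None => forall q, cell_colour q = c -> selected q (wit q) -> cell_bump q x = 0
  end.
Proof.
rewrite /pick_cell; case: pselect => [ex|nex]; first by case: cid.
by move=> q qc sq; apply/eqP; apply/negPn/negP => b0; apply: nex; exists q.
Qed.

Let pick_near c x : U x ->
  (forall w, `|w - x| <= kap * rho x -> pick_cell c w = None) \/
  exists q, [/\ near_cell x q (wit q), cell_colour q = c &
    forall w, `|w - x| <= kap * rho x -> pick_cell c w = if cell_bump q w != 0 then Some q else None].
Proof.
move=> Ux; have [ex|nex] := pselect (exists w q, `|w - x| <= kap * rho x /\ pick_cell c w = Some q).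
  right; case: ex => w [q [wx pw]]; exists q.
  have := pickP c w; rewrite pw => -[qc sq bq].
  have nq : near_cell x q (wit q) by split => //; exists w.
  split => // v vx; have := pickP c v; case: (pick_cell c v) => [q' [qc' sq' bq']|H].
    have E : q' = q.
      apply: (near_cell_uniq (y := wit q') Ux _ nq); last by rewrite qc qc'.
      by split; [exact: sq'|exists v].
    by rewrite -E bq'.
  by rewrite H // eqxx.
left => w wx; case E : (pick_cell c w) => [q|//]; exfalso; apply: nex; by exists w, q.
Qed.

Let psiC c x : R := if pick_cell c x is Some q then cell_bump q x else 0.
Let S x : R := \sum_(c : colour) psiC c x ^+ 2.

Let psiC_near q c w : pick_cell c w = (if cell_bump q w != 0 then Some q else None) ->
  psiC c w = cell_bump q w.
Proof. by rewrite /psiC => ->; case: eqP. Qed.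

Let scale_exists (t : R) : 0 < t <= 1 -> exists k : nat, (2 ^+ k)^-1 <= t /\ t < 2 * (2 ^+ k)^-1.
Proof.
move=> /andP[t0 t1].
have ex : exists k, (2 ^+ k)^-1 <= t.
  exists (Num.bound t^-1).
  have ti : 0 <= t^-1 by rewrite invr_ge0 ltW.
  have H := archi_boundP ti.
  rewrite -[leRHS]invrK lef_pV2 ?posrE ?invr_gt0 ?exprn_gt0 //.
  apply: le_trans (ltW H) _; rewrite -natrX ler_nat; exact/ltnW/ltn_expl.
case: (ex_minnP ex) => k kt kmin; exists k; split => //.
case: k kt kmin => [|k] kt kmin; first by rewrite expr0 invr1; lra.
rewrite ltNge; apply/negP => H; have := kmin k _; rewrite ltnn => F; apply: notF; apply: F.
by apply: le_trans H; rewrite exprS invfM mulrA divff ?mul1r.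
Qed.

Let own_cell x : U x -> exists c q, [/\ pick_cell c x = Some q & 2^-1 <= psiC c x].
Proof.
move=> Ux; have [k [k1 k2]] := scale_exists (rho_pos Ux).
have [q [qk xq bq]] := cell_exists x k.
have sq : selected q x by rewrite /selected qk.
have sw := witP sq; have b0 : cell_bump q x != 0 by apply: lt0r_neq0; apply: lt_le_trans bq; rewrite invr_gt0.
have /andP[rx _] := rho_pos Ux.
have x0 : `|x - x| <= kap * rho x by rewrite subrr normr0; nng.
exists (cell_colour q), q.
have := pickP (cell_colour q) x; case E : (pick_cell _ _) => [q'|]; last first.
  by move=> H; have := H q erefl sw; move/eqP: b0.
case=> qc' sq' bq'.
have qq : q' = q.
  apply: (near_cell_uniq Ux (y := wit q') (y' := wit q)) => //; first by split => //; exists x.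
  by split => //; exists x.
by rewrite /psiC E qq.
Qed.

Let S_low x : U x -> 4^-1 <= S x.
Proof.
move=> Ux; have [c [q [_ h]]] := own_cell Ux.
rewrite /S (bigD1 c) //= -[leLHS]addr0; apply: lerD.
  have -> : (4^-1 : R) = 2^-1 ^+ 2 by field.
  by apply: lerXn2r; rewrite ?nnegrE //; lra.
by apply: sumr_ge0 => i _; exact: sqr_ge0.
Qed.

(** Half the radius of [pick_near]: the base point and the increment use one half each. *)
Let r x : R := kap / 2 * rho x.
Let r0 x : U x -> 0 < r x.
Proof. by move=> Ux; have /andP[rx _] := rho_pos Ux; rewrite /r; psv. Qed.

Let side_r x q y : U x -> near_cell x q y -> r x <= cell_side q.1.
Proof.
move=> Ux nq; have [_ h] := near_cell_scale Ux nq; have /andP[rx _] := rho_pos Ux.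
have : kap * rho x <= kap * (4 * (2 ^+ q.1)^-1) by apply: ler_wpM2l; exact: ltW.
rewrite -cell_sideE; have -> : kap * (4 * (8 * n%:R * cell_side q.1)) = cell_side q.1 / 2.
  by rewrite /kap; field; rewrite gt_eqF.
have := side0 q.1; rewrite /r; have -> : kap / 2 * rho x = kap * rho x / 2 by ring.
have : 0 < kap * rho x by psv.
by move: (kap * rho x) (cell_side q.1) => u v; lra.
Qed.

Variables (Cb : R) (C1 c1 C2 c2 : R).
Hypothesis gap_b : forall q x, gap Cb (cell_side q.1) 2 (cell_bump q) x.
Hypothesis c101 : 0 < c1 <= 1.
Hypothesis c201 : 0 < c2 <= 1.
Hypothesis gap_sq : forall (g : V -> R) (x : V) rho, 0 < rho ->
  gap (6 * (Cb * Cb) *+ size (index_enum colour)) rho 2 g x -> 4^-1 <= g x ->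
  (forall h, `|h| <= rho -> 0 <= g (x + h)) ->
  gap C1 (c1 * rho) 2 (fun y => Num.sqrt (g y)) x.
Hypothesis gap_iv : forall (g : V -> R) (x : V) rho, 0 < rho ->
  gap C1 rho 2 g x -> 2^-1 <= g x -> gap C2 (c2 * rho) 2 (fun y => (g y)^-1) x.

Let ball_half x w h : `|w - x| <= r x -> `|h| <= r x -> `|w + h - x| <= kap * rho x.
Proof.
move=> wx hr; have -> : kap * rho x = r x + r x by rewrite /r; field.
by rewrite addrAC; apply: le_trans (ler_normD _ _) _; apply: lerD.
Qed.

Let gap_psiC c x w : U x -> `|w - x| <= r x -> gap Cb (r x) 2 (psiC c) w.
Proof.
move=> Ux wx; have rx := r0 Ux.
have Cb0 : 0 <= Cb by exact: gap_ge0 (gap_b (0%N, [ffun=> 0]) w).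
have [H|[q [nq qc H]]] := pick_near c Ux.
  apply: (gap_ext (g := fun=> 0)) => // [h hr|]; last by apply: gap_const => //; rewrite normr0.
  by rewrite /psiC H // ball_half.
apply: (gap_ext (g := cell_bump q)) => // [h hr|].
  by rewrite (@psiC_near q) // H // ball_half.
by apply: gap_shrink (gap_b q w) => //; rewrite rx /=; exact: side_r nq.
Qed.

Let gap_iS x w : U x -> (forall w, `|w - x| <= rho x -> U w) -> `|w - x| <= r x ->
  gap C2 (c2 * (c1 * r x)) 2 (fun y => (Num.sqrt (S y))^-1) w.
Proof.
move=> Ux Ub wx; have rx := r0 Ux; have /andP[c10 c11] := c101.
have /andP[rhox _] := rho_pos Ux.
have rr : r x <= rho x / 2.
  have -> : r x = kap * (rho x / 2) by rewrite /r; ring.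
  rewrite -[leRHS]mul1r; apply: ler_wpM2r; first by nng.
  by have := kap1; lra.
have Uw : U w by apply: Ub; apply: le_trans wx _; lra.
apply: gap_iv; first by psv.
  apply: gap_sq => //; last first.
  - move=> h hr; apply: le_trans (S_low _); first by rewrite invr_ge0 ler0n.
    apply: Ub; rewrite addrAC; apply: le_trans (ler_normD _ _) _.
    by apply: le_trans (lerD wx hr) _; lra.
  - exact: S_low.
  apply: (@gap_sum R n colour (index_enum colour) (6 * (Cb * Cb)) (r x) 2 (fun c y => psiC c y ^+ 2) w) => // c.
  have two : 0 < (2 : R) <= 2 by rewrite lexx andbT ltr0n.
  exact: (gap_mul rx two (gap_psiC c Ux wx) (gap_psiC c Ux wx)).
have -> : 2^-1 = Num.sqrt (4^-1 : R).
  have -> : (4^-1 : R) = 2^-1 ^+ 2 by field.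
  by rewrite sqrtr_sqr ger0_norm // invr_ge0 ler0n.
by apply: ler_wsqrtr; exact: S_low.
Qed.

Variables (m : nat) (sg : R) (f : V -> R) (G : V -> 'I_m -> V -> R) (A : V -> R).
Hypothesis sg12 : 0 < sg <= 2.
Hypothesis G_sum : forall y, U y -> forall w, `|w - y| <= rho y -> f w = \sum_(j < m) G y j w ^+ 2.
Hypothesis G_gap : forall y, U y -> forall j w, `|w - y| <= rho y -> gap (A y) (rho y) sg (G y j) w.

Let g (cj : colour * 'I_m) (w : V) : R :=
  if pick_cell cj.1 w is Some q then cell_bump q w * (G (wit q) cj.2 w * (Num.sqrt (S w))^-1) else 0.

Let wit_near x q : U x -> near_cell x q (wit q) -> `|x - wit q| <= rho (wit q) / 2 /\ rho x <= 2 * rho (wit q).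
Proof.
move=> Ux nq; have [d r1 r2] := near_cell_dist Ux nq.
by split => //; rewrite distrC; apply: le_trans d _; lra.
Qed.

(** The bound at [x] carries the constant [A y] of the witness of the cell in question, whose [rho]
    is at most twice that of [x]; so the constants of the local families may vary with the scale.
    Expansions are claimed only at points whose ball of radius [rho x] lies in [U], where the local
    data are available. *)
Lemma glue_in : exists g : colour * 'I_m -> V -> R,
  (forall x, U x -> f x = \sum_(cj : colour * 'I_m) g cj x ^+ 2) /\
  forall x, U x -> (forall w, `|w - x| <= rho x -> U w) -> forall cj, exists2 y, U y /\ rho y <= 2 * rho x &
  forall w, `|w - x| <= r x -> gap (6 * (Cb * (6 * (A y * C2)))) (c2 * (c1 * r x)) sg (g cj) w.
Proof.
have Cb0 : 0 <= Cb by exact: gap_ge0 (gap_b (0%N, [ffun=> 0]) 0).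
have /andP[c10 c11] := c101; have /andP[c20 c21] := c201; have /andP[sg0 sg2] := sg12.
exists g; split => [x Ux|x Ux Ub [c j]].
  have Sx := S_low Ux; have S0 : 0 < S x by apply: lt_le_trans Sx; rewrite invr_gt0.
  have /andP[rx _] := rho_pos Ux.
  rewrite -(pair_big xpredT xpredT (fun c j => g (c, j) x ^+ 2)) /=.
  have E c : \sum_(j < m) g (c, j) x ^+ 2 = psiC c x ^+ 2 * (f x / S x).
    rewrite /g /psiC /=; have := pickP c x; case: (pick_cell c x) => [q [qc sq bq]|_]; last first.
      by rewrite big1 ?expr0n ?mul0r // => j _; rewrite expr0n.
    have Uy : U (wit q) by case: sq.
    have nq : near_cell x q (wit q) by split => //; exists x; split => //; rewrite subrr normr0; nng.
    have [d _] := wit_near Ux nq; have /andP[ry _] := rho_pos Uy.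
    rewrite (G_sum Uy (w := x)); last by apply: le_trans d _; lra.
    rewrite mulr_suml mulr_sumr; apply: eq_bigr => j _.
    by rewrite !exprMn exprVn sqr_sqrtr ?(ltW S0) // mulrA.
  under eq_bigr do rewrite E.
  by rewrite -mulr_suml -/(S x) mulrC divfK // gt_eqF.
have rx := r0 Ux; have [H|[q [nq qc H]]] := pick_near c Ux.
  have /andP[rhox _] := rho_pos Ux.
  exists x; [by split => //; lra|] => w wx; have A0 : 0 <= A x.
    by apply: gap_ge0 (G_gap Ux j (w := x) _); rewrite subrr normr0 ltW.
  have C20 : 0 <= C2 by exact: gap_ge0 (gap_iS Ux Ub wx).
  apply: (gap_ext (g := fun=> 0)); [by psv| |by apply: gap_const; [psv|rewrite normr0; nng]].
  move=> h hr; rewrite /g /= H // ball_half //; apply: le_trans hr _.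
  by rewrite mulrA ler_piMl ?(ltW rx) // mulr_ile1 ?(ltW c10) ?(ltW c20).
have sw : selected q (wit q) by case: nq.
have Uy : U (wit q) by case: sw.
exists (wit q); [by split => //; have [] := near_cell_dist Ux nq|] => w wx; have [d rr] := wit_near Ux nq; have /andP[ry _] := rho_pos Uy.
have cc : c2 * (c1 * r x) <= r x.
  by rewrite mulrA ler_piMl ?(ltW rx) // mulr_ile1 ?(ltW c10) ?(ltW c20).
have cp : 0 < c2 * (c1 * r x) by psv.
apply: (gap_ext (g := fun w => cell_bump q w * (G (wit q) j w * (Num.sqrt (S w))^-1))) => //.
  move=> h hr; rewrite /g /= H; last by apply: ball_half => //; apply: le_trans cc.
  by case: eqP => [->|//]; rewrite mul0r.
have rxy : r x <= rho (wit q) / 2.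
  rewrite /r; apply: (@le_trans _ _ (kap * rho (wit q))).
    have -> : kap / 2 * rho x = kap * (rho x / 2) by ring.
    by apply: ler_wpM2l; [exact: ltW|lra].
  by rewrite [leRHS]mulrC; apply: ler_wpM2r; [exact: ltW|have := kap1; lra].
apply: gap_mul => //.
  apply: gap_ord (gap_shrink _ _ (gap_b q w)) => //.
  by rewrite cp /=; apply: le_trans cc _; exact: side_r nq.
apply: gap_mul => //; last by apply: gap_ord (gap_iS Ux Ub wx).
apply: gap_shrink (G_gap Uy j _); rewrite ?(ltW sg0) //.
  by rewrite cp /=; apply: le_trans cc _; apply: le_trans rxy _; lra.
have -> : w - wit q = (w - x) + (x - wit q) by rewrite addrA subrK.
apply: le_trans (ler_normD _ _) _; apply: le_trans (lerD wx d) _; lra.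
Qed.

End Family.
End Glue.

Lemma glue_squares (R : realType) (n : nat) (hn : (0 < n)%N) :
  exists C c : R, [/\ 0 <= C, 0 < c <= 1 & forall (U : set 'rV[R]_n) (rho : 'rV[R]_n -> R),
  (forall x, U x -> 0 < rho x <= 1) ->
  (forall x y, U x -> U y -> `|x - y| <= rho x -> rho y <= 2 * rho x /\ rho x <= 2 * rho y) ->
  forall (m : nat) (sg : R) (f : 'rV[R]_n -> R) (G : 'rV[R]_n -> 'I_m -> 'rV[R]_n -> R) (A : 'rV[R]_n -> R),
  0 < sg <= 2 ->
  (forall y, U y -> forall w, `|w - y| <= rho y -> f w = \sum_(j < m) G y j w ^+ 2) ->
  (forall y, U y -> forall j w, `|w - y| <= rho y -> gap (A y) (rho y) sg (G y j) w) ->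
  exists g : (@colour n) * 'I_m -> 'rV[R]_n -> R,
  (forall x, U x -> f x = \sum_cj g cj x ^+ 2) /\
  forall x, U x -> (forall w, `|w - x| <= rho x -> U w) -> forall cj, exists2 y, U y /\ rho y <= 2 * rho x &
  forall w, `|w - x| <= c * rho x -> gap (C * A y) (c * rho x) sg (g cj) w].
Proof.
have [Cb Cb0 gap_b] := @gap_cell_bump R n hn.
have q4 : 0 < (4^-1 : R) by rewrite invr_gt0.
have q2 : 0 < (2^-1 : R) by rewrite invr_gt0.
have [C1 [c1 [c101 gap_sq]]] := @gap_sqrt R n (6 * (Cb * Cb) *+ size (index_enum (@colour n))) _ q4.
have [C2 [c2 [c201 gap_iv]]] := @gap_inv R n C1 _ q2.
have /andP[c10 c11] := c101; have /andP[c20 c21] := c201.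
pose k : R := (64 * n%:R)^-1 / 2.
have nR : 1 <= n%:R :> R by rewrite ler1n.
have n0 : 0 < n%:R :> R by lra.
have k0 : 0 < k by rewrite /k; psv.
have k1 : k <= 1.
  rewrite /k -invfM invf_le1; last by psv.
  lra.
exists (36 * (Cb * `|C2|)), (c2 * (c1 * k)); split.
- by nng.
- apply/andP; split; first by psv.
  have ck : c1 * k <= 1 by apply: mulr_ile1 => //; exact: ltW.
  by apply: mulr_ile1 => //; nng.
move=> U rho rho_pos rho_slow m sg f G A sg12 G_sum G_gap.
have [g [g_sum g_gap]] := glue_in hn rho_pos rho_slow gap_b c101 c201 gap_sq gap_iv sg12 G_sum G_gap.
exists g; split => // x Ux Ub cj; have [y [Uy ryx] gy] := g_gap x Ux Ub cj; exists y => // w wx.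
have /andP[rx _] := rho_pos x Ux.
have /andP[ry _] := rho_pos y Uy.
have A0 : 0 <= A y by apply: gap_ge0 (G_gap y Uy cj.2 y _); rewrite subrr normr0 ltW.
have E : c2 * (c1 * k) * rho x = c2 * (c1 * (k * rho x)) by ring.
rewrite E in wx *.
have kr : 0 < k * rho x by psv.
apply: gap_le (gy w _); first by psv.
  have -> : 36 * (Cb * `|C2|) * A y = 6 * (Cb * (6 * (A y * `|C2|))) by ring.
  by do 4 (apply: ler_wpM2l => //); exact: ler_norm.
apply: le_trans wx _; rewrite mulrA ler_piMl ?(ltW kr) // mulr_ile1 ?(ltW c10) ?(ltW c20) //.
Qed.

(** * Decomposition on the unit cube *)

Section UnitLocal.
Context {R : realType} {n : nat}.
Local Notation V := 'rV[R]_n.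
Local Notation e_ i := (delta_mx ord0 i : V).

Definition unit_hyp (s : R) (f : V -> R) : Prop :=
  (forall x, `|x| <= 2 -> 0 <= f x <= 1) /\
  forall x, `|x| <= 1 -> exists J : @jet R n, forall h, `|h| <= 1 ->
    `|f (x + h) - f x - tay J h| <= `|h| `^ s.

Definition inv_off (S : {set 'I_n}) (r : R) (f : V -> R) : Prop :=
  forall i, i \notin S -> forall x t, `|x| <= r -> `|x + t *: e_ i| <= r -> f (x + t *: e_ i) = f x.

(** The induction runs over [d], a bound for the number of coordinates on which [f] depends. The
    minimum along an axis thus stays a function on the same space. *)
Definition decomp_at (s : R) (d m : nat) (C : R) : Prop :=
  forall (f : V -> R) (S : {set 'I_n}), (#|S| <= d)%N -> unit_hyp s f -> inv_off S 2 f ->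
  exists g : 'I_m -> V -> R,
    (forall x, `|x| <= 2^-1 -> f x = \sum_(j < m) g j x ^+ 2) /\
    forall j x, `|x| <= 4^-1 -> gap C 4^-1 (s / 2) (g j) x.

Lemma half_exp (s : R) : 2 < s <= 4 -> [/\ 1 <= s / 2, 0 < s / 2 <= 2 & 2 <= s].
Proof. by move=> /andP[? ?]; split; [lra|apply/andP; split; lra|lra]. Qed.

Lemma pow_half_lt (s : R) : 2 < s -> 2^-1 `^ s < (4^-1 : R).
Proof.
move=> s2; have s20 : 0 < s - 2 by rewrite subr_gt0.
have -> : 2^-1 `^ s = 2^-1 ^+ 2 * 2^-1 `^ (s - 2) :> R.
  rewrite -powR_nat // -powR_addn //; first by congr (_ `^ _); ring.
  by rewrite gt_eqF //; lra.
have -> : (4^-1 : R) = 2^-1 ^+ 2 * 1 `^ (s - 2) by rewrite powR1; field.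
by rewrite ltr_pM2l //; apply: gt0_ltr_powR; rewrite ?nnegrE //; lra.
Qed.

Lemma exists_min4 (a b c d : R) : 0 < a -> 0 < b -> 0 < c -> 0 < d ->
  exists x, [/\ 0 < x, x <= a, x <= b, x <= c & x <= d].
Proof.
move=> a0 b0 c0 d0; exists (Num.min (Num.min a b) (Num.min c d)).
by split; rewrite ?lt_min ?a0 ?b0 ?c0 ?d0 // !ge_min lexx ?orbT.
Qed.

Section LocalHyps.
Variables (s K kap : R) (f : V -> R) (J : V -> @jet R n).
Hypothesis s24 : 2 < s <= 4.
Hypothesis K1 : 1 <= K.
Hypothesis kap01 : 0 < kap <= 4^-1.
Hypothesis f_jet : forall x, `|x| <= kap -> forall h, `|h| <= 1 ->
     `|f (x + h) - f x - tay (J x) h| <= `|h| `^ s.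
Hypothesis J_b : forall x, `|x| <= kap -> jet_bounded K (J x).
Hypothesis f0K : f 0 <= K.

Lemma base_lip (x : V) : `|x| <= 1 -> `|f x - f 0| <= 4 * K * `|x|.
Proof.
move=> x1; have k0 : `|0 : V| <= kap by rewrite normr0 ltW //; case/andP: kap01.
have K0 : 0 <= K by apply: le_trans K1.
have e0 : `|f (0 + x) - f 0 - tay (J 0) x| <= K * `|x| `^ s.
  by apply: le_trans (f_jet k0 x1) _; rewrite ler_peMl ?powR_ge0.
by have /andP[s2 _] := s24; have := jet_lip (ltW s2) K0 (J_b k0) x1 e0; rewrite add0r.
Qed.

Lemma jet_upper (x : V) : `|x| <= 1 -> f x <= 5 * K.
Proof.
move=> x1; have := base_lip x1; have K0 : 0 <= K by apply: le_trans K1.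
have : 4 * K * `|x| <= 4 * K by rewrite ler_piMr //; nng.
by rewrite ler_norml => h1 /andP[_ h2]; have := f0K; lra.
Qed.

(** If [f] did not vary along the i-th axis, adding the expansions with steps 1/2 and -1/2 at 0
    would give q/4 <= 2^-s < 1/4 for the coefficient q of h_i^2. *)
Lemma not_inv_off (S : {set 'I_n}) i : inv_off S 1 f -> 1 <= jq (J 0) (e_ i) (e_ i) -> i \in S.
Proof.
move=> finv q1; apply/negPn/negP => iS.
have k0 : `|0 : V| <= kap by rewrite normr0 ltW //; case/andP: kap01.
have E t : `|t| = 2^-1 ->
    `|t * jl (J 0) (e_ i) + t ^+ 2 * jq (J 0) (e_ i) (e_ i) + t ^+ 3 * jt (J 0) (e_ i) (e_ i) (e_ i)| <= 2^-1 `^ s.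
  move=> t2; have nt : `|t *: e_ i| = 2^-1 by rewrite normrZ norm_delta mulr1.
  have ft : f (0 + t *: e_ i) = f 0.
    by apply: finv; rewrite ?normr0 ?add0r ?nt //; lra.
  have := f_jet k0 (h := t *: e_ i); rewrite nt ft subrr sub0r normrN tayZ; apply.
  by lra.
have E1 := E 2^-1 (ger0_norm _); have E2 := E (- 2^-1).
have {}E1 : `|2^-1 * jl (J 0) (e_ i) + 2^-1 ^+ 2 * jq (J 0) (e_ i) (e_ i) + 2^-1 ^+ 3 * jt (J 0) (e_ i) (e_ i) (e_ i)| <= 2^-1 `^ s.
  by apply: E1; rewrite invr_ge0 ler0n.
have {}E2 := E2 _; rewrite normrN ger0_norm ?invr_ge0 ?ler0n // in E2.
have {}E2 := E2 erefl.
have p2 := pow_half_lt (proj1 (andP s24)).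
move: E1 E2; rewrite !ler_norml => /andP[_ E1] /andP[_ E2].
by move: p2 E1 E2 q1; move: (jl _ _) (jq _ _ _) (jt _ _ _ _) (2^-1 `^ s) => l q t p; lra.
Qed.

End LocalHyps.

(** The Lipschitz constant 4 K keeps [f] above ep/2 on the ball of radius ep/(8 K). There [gap_sqrt]
    applies, and its order 2 is lowered to s/2. *)
Lemma local_root (s K kap ep : R) : 2 < s <= 4 -> 1 <= K -> 0 < kap <= 4^-1 -> 0 < ep ->
  exists c0 A0 : R, [/\ 0 < c0, 0 <= A0 & forall (f : V -> R) (J : V -> @jet R n),
  (forall x, `|x| <= 1 + kap -> 0 <= f x) ->
  (forall x, `|x| <= kap -> forall h, `|h| <= 1 ->
     `|f (x + h) - f x - tay (J x) h| <= `|h| `^ s) ->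
  (forall x, `|x| <= kap -> jet_bounded K (J x)) ->
  f 0 <= K -> ep <= f 0 ->
  forall x, `|x| <= c0 -> gap A0 c0 (s / 2) (fun x => Num.sqrt (f x)) x].
Proof.
move=> s24 K1 kap01 ep0; have /andP[kap0 kap4] := kap01; have [sg1 sg2 s2] := half_exp s24.
have K0 : 0 < K by lra.
have ep20 : 0 < ep / 2 by psv.
have [CA [cA [cA01 gsq]]] := @gap_sqrt R n (3 * (5 * K)) (ep / 2) ep20.
have /andP[cA0 cA1] := cA01.
have cS0 : 0 < ep / (8 * K) by psv.
have [c0 [c00 c0A c0S c0k _]] := exists_min4 cA0 cS0 kap0 kap0.
exists c0, `|CA|; split => // f J f_ge0 f_jet J_b f0K epf x xc.
have xk : `|x| <= kap by apply: le_trans c0k.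
have x1 : `|x| <= 1 by apply: le_trans xk _; lra.
apply: (@gap_le _ _ CA) => //; first exact: ler_norm.
apply: (@gap_ord _ _ CA c0 2) => //.
apply: (@gap_shrink _ _ CA (cA * 1)) => //; first by rewrite c00 mulr1.
apply: gsq => //.
- apply: (@gap_of_jet _ _ f x (J x) (5 * K) s) => //.
  + rewrite ger0_norm; first exact: (jet_upper s24 K1 kap01 f_jet J_b).
    by apply: f_ge0; apply: le_trans x1 _; lra.
  + move=> h; have [L1 L2 L3] := J_b x xk h.
    have K5 : K <= 5 * K by lra.
    by split; [apply: le_trans L1 _|apply: le_trans L2 _|apply: le_trans L3 _]; apply: ler_wpM2r => //; nng.
  + move=> h h1; apply: le_trans (f_jet x xk h h1) _.
    by rewrite ler_peMl ?powR_ge0 //; lra.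
- have xs : `|x| <= ep / (8 * K) by apply: le_trans c0S.
  have H := base_lip s24 K1 kap01 f_jet J_b x1.
  have : 4 * K * `|x| <= ep / 2.
    have -> : ep / 2 = 4 * K * (ep / (8 * K)) by field; rewrite gt_eqF.
    by apply: ler_wpM2l => //; nng.
  by move: H; rewrite ler_norml => /andP[h1 _] h2; lra.
- by move=> h h1; apply: f_ge0; apply: le_trans (ler_normD _ _) _; rewrite addrC; apply: lerD.
Qed.

(** [F] does not depend on the i-th coordinate, so after rescaling the induction hypothesis applies
    to [S :\ i]. The count really drops because [not_inv_off] puts i into [S]. The split-off root
    takes the index [ord0]. *)
Lemma local_split (s K kap C : R) (d m : nat) : 2 < s <= 4 -> 1 <= K -> 0 < kap <= 4^-1 ->
  decomp_at s d m C -> exists ep c0 A0 : R, [/\ 0 < ep, 0 < c0, 0 <= A0 &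
  forall (f : V -> R) (J : V -> @jet R n) (S : {set 'I_n}) (i : 'I_n), (#|S| <= d.+1)%N ->
  (forall x, `|x| <= 1 -> 0 <= f x) ->
  (forall x, `|x| <= kap -> forall h, `|h| <= 1 ->
     `|f (x + h) - f x - tay (J x) h| <= `|h| `^ s) ->
  (forall x, `|x| <= kap -> jet_bounded K (J x)) ->
  f 0 <= K -> f 0 <= ep -> (forall x, `|x| <= kap -> 1 <= jq (J x) (e_ i) (e_ i)) ->
  inv_off S 1 f ->
  exists g : 'I_m.+1 -> V -> R, forall x, `|x| <= c0 ->
    f x = \sum_j g j x ^+ 2 /\ forall j, gap A0 c0 (s / 2) (g j) x].
Proof.
move=> s24 K1 kap01 IH; have /andP[kap0 kap4] := kap01; have [sg1 sg2 s2] := half_exp s24.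
have K0 : 0 < K by lra.
have [ep [rB [CB [ep0 rB01 CB0 split]]]] := @split_off R n K kap s K1 kap01 s24.
have /andP[rB0 rB4] := rB01.
(* [M] dominates the values of [F], by 5 K, and its Taylor constant [CB], the two quantities
   normalised in [unit_hyp]. The next line makes the radius 2 of [unit_hyp] correspond to [rB]. *)
have [M ME] : {M | M = 5 * K + CB} by exists (5 * K + CB).
have M0 : 0 < M by rewrite ME; lra.
have [rho r2] : {rho | rB = 2 * rho} by exists (rB / 2); field.
have rho0 : 0 < rho by lra.
have c00 : 0 < rho / 4 by psv.
have sM := sqrtr_ge0 M.
have [A0 [AM AB]] : exists A0, Num.sqrt M * `|C| <= A0 /\ 2 * (5 * K) + CB <= A0.
  exists (Num.sqrt M * `|C| + (2 * (5 * K) + CB)); split; rewrite ?lerDl ?lerDr; nng.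
have A00 : 0 <= A0 by apply: le_trans AM; nng.
exists ep, (rho / 4), A0; split => //.
move=> f J S i Sd f_ge0 f_jet J_b f0K fep qi finv.
have f_jet' x : `|x| <= kap -> forall h, `|h| <= 2^-1 -> `|f (x + h) - f x - tay (J x) h| <= K * `|h| `^ s.
  move=> xk h h2; apply: le_trans (f_jet x xk h _) _; first by lra.
  by rewrite ler_peMl // powR_ge0.
have fB := jet_upper s24 K1 kap01 f_jet J_b f0K.
have k0 : `|0 : V| <= kap by rewrite normr0 ltW.
have iS := not_inv_off s24 kap01 f_jet finv (qi 0 k0).
have [F [G [HFG HFi HFj HFJ HG]]] := split f J i f_ge0 f_jet' J_b qi fep.
pose Ft (v : V) := M^-1 * F (rho *: v).
have rho1 : rho <= 1 by move: rB4 r2; clear; lra.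
have rho_rB : rho <= rB by move: r2 rho0; clear; lra.
have rho4 : rho / 4 <= rB by move: r2 rho0; clear; lra.
have rB1 : rB <= 1 by move: rB4; clear; lra.
have K5 : 1 <= 5 * K by move: K1; clear; lra.
have K50 : 0 <= 5 * K := le_trans ler01 K5.
have fBr x : `|x| <= rB -> f x <= 5 * K by move=> xr; apply: fB; exact: le_trans xr rB1.
have nr (v : V) : `|rho *: v| = rho * `|v| by rewrite normrZ ger0_norm // ltW.
have FM x : `|x| <= rB -> F x <= M.
  move=> xr; have [E _] := HFG x xr; have fx := fBr x xr.
  by have := sqr_ge0 (G x); rewrite ME; move: fx E CB0; move: (f x) (F x) (G x ^+ 2); clear => a b c; lra.
have Mi0 : 0 <= M^-1 by rewrite invr_ge0 ltW.
have [g [gS gG]] : exists g : 'I_m -> V -> R,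
    (forall x, `|x| <= 2^-1 -> Ft x = \sum_(j < m) g j x ^+ 2) /\
    forall j x, `|x| <= 4^-1 -> gap C 4^-1 (s / 2) (g j) x.
  apply: (IH Ft (S :\ i)).
  - by move: Sd; rewrite (cardsD1 i) iS.
  - split => [v v2|v v1].
      have vr : `|rho *: v| <= rB by rewrite nr r2 mulrC; apply: ler_wpM2r => //; exact: ltW.
      have [_ F0] := HFG _ vr; rewrite /Ft mulr_ge0 //= mulrC ler_pdivrMr // mul1r.
      exact: FM.
    have vr : `|rho *: v| <= rB by rewrite nr; exact: le_trans (ler_piMr (ltW rho0) v1) rho_rB.
    have [J' HJ'] := HFJ _ vr; exists (jmap M^-1 (lin_scale rho) J') => h h1.
    rewrite tay_jmap /Ft scalerDr -!mulrBr normrM ger0_norm //.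
    have hr : `|rho *: h| <= rB by rewrite nr; exact: le_trans (ler_piMr (ltW rho0) h1) rho_rB.
    apply: le_trans (ler_wpM2l Mi0 (HJ' _ hr)) _; rewrite mulrC ler_pdivrMr // [leRHS]mulrC.
    apply: ler_pM; [by []|exact: powR_ge0|by rewrite ME lerDr; nng|].
    apply: powR_mono => //; first exact: le_trans (ler0n _ 2) s2.
    by rewrite nr ler_piMl.
  - move=> j jS x t x2 xt2; rewrite /Ft; congr (_ * _).
    have xr : `|rho *: x| <= rB by rewrite nr r2 mulrC; apply: ler_wpM2r => //; exact: ltW.
    have yr : `|rho *: (x + t *: e_ j)| <= rB by rewrite nr r2 mulrC; apply: ler_wpM2r => //; exact: ltW.
    rewrite scalerDr scalerA in yr *.
    have [->|ji] := eqVneq j i; first exact: HFi.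
    apply: HFj => //; apply: finv.
    by move: jS; rewrite in_setD1 ji.
exists (fun j x => if unlift ord0 j is Some j' then Num.sqrt M * g j' (rho^-1 *: (x - 0)) else G x).
move=> x xc.
have xr4 := xc.
have rn0 : rho != 0 by rewrite gt_eqF.
have xB : `|x| <= rB by exact: le_trans xr4 rho4.
have u4 : `|rho^-1 *: x| <= 4^-1.
  by rewrite normrZ ger0_norm ?invr_ge0 ?(ltW rho0) // mulrC ler_pdivrMr // mulrC.
split.
  rewrite big_ord_recl /= unlift_none.
  have -> : \sum_(j < m) (if unlift ord0 (lift ord0 j) is Some j' then Num.sqrt M * g j' (rho^-1 *: (x - 0)) else G x) ^+ 2
    = M * \sum_(j < m) g j (rho^-1 *: x) ^+ 2.
    rewrite mulr_sumr; apply: eq_bigr => j _.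
    by rewrite liftK subr0 exprMn sqr_sqrtr // ltW.
  rewrite -gS; last by apply: le_trans u4 _; clear; lra.
  rewrite /Ft scalerA divff // scale1r mulrA divff ?gt_eqF // mul1r.
  by have [-> _] := HFG x xB; rewrite addrC.
move=> j; case: unliftP => [j' _|_].
  have q4 : 0 < (4^-1 : R) by rewrite invr_gt0.
  have H := gap_scale (Num.sqrt M) 0 rho0 q4 (gG j' _ u4).
  rewrite add0r scalerA divff // scale1r in H.
  apply: (@gap_le _ _ (Num.sqrt M * `|C|)) => //.
  apply: gap_le H; [by psv|]; rewrite (ger0_norm sM); apply: ler_wpM2l => //; exact: ler_norm.
have [mm [ml Hm]] := HG x xB.
apply: (@gap_le _ _ (2 * (5 * K) + CB)) => //.
apply: (@gap_shrink _ _ _ rho) => //; [by rewrite c00 /=; move: rho0; clear; lra|exact: le_trans ler01 sg1|].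
apply: (@gap_of_affine _ _ G mm) => //; first by rewrite rho0.
  move=> h hr.
  have xh : `|x + h| <= rB by apply: le_trans (ler_normD _ _) _; rewrite r2; move: xr4 hr rho0; clear; lra.
  have [E F0] := HFG _ xh; have fb := fBr _ xh.
  rewrite -(@ler_pXn2r _ 2%N) ?nnegrE ?addr_ge0 //.
  rewrite real_normK ?num_real //; apply: (@le_trans _ _ (5 * K)).
    by move: E F0 fb; move: (f _) (F _) (G _ ^+ 2); clear => a b c; lra.
  by rewrite expr2 ler_peMl.
by move=> h hr; apply: Hm; exact: le_trans hr rho_rB.
Qed.

End UnitLocal.

Lemma sum_enum_val (R : nmodType) (T : finType) (F : T -> R) :
  \sum_t F t = \sum_(i < #|T|) F (enum_val i).
Proof. by rewrite (reindex _ (onW_bij _ (@enum_val_bij T))). Qed.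

(* The maximum of a^(1/s) and of the (q_i/2)^(1/(s-2)), characterised without negative bases. *)
Lemma scale_of (R : realType) (n : nat) (a s : R) (q : 'I_n -> R) : 0 <= a -> 2 < s ->
  exists r : R, [/\ 0 <= r, a <= r `^ s, (forall i, q i <= 2 * r `^ (s - 2)) &
    0 < r -> a = r `^ s \/ exists i, q i = 2 * r `^ (s - 2)].
Proof.
move=> a0 s2; have s20 : 0 < s - 2 by lra.
have s0 : 0 <= s by lra.
suff : forall l : seq 'I_n, exists r : R, [/\ 0 <= r, a <= r `^ s,
    (forall i, i \in l -> q i <= 2 * r `^ (s - 2)) &
    0 < r -> a = r `^ s \/ exists i, q i = 2 * r `^ (s - 2)].
  move=> /(_ (enum 'I_n)) [r [r0 ar qr H]]; exists r; split => // i.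
  by apply: qr; rewrite mem_enum.
elim=> [|i l [r [r0 ar qr H]]].
  exists (a `^ s^-1).
  have E : a = (a `^ s^-1) `^ s by rewrite -powRrM mulVf ?powRr1 // gt_eqF //; lra.
  split => //; [exact: powR_ge0|by rewrite -E|by left].
have [qi|qi] := leP (q i) (2 * r `^ (s - 2)).
  exists r; split => // j; rewrite in_cons => /orP[/eqP->//|]; exact: qr.
pose r' := (q i / 2) `^ (s - 2)^-1.
have q0 : 0 <= q i / 2 by have := powR_ge0 r (s - 2); lra.
have E : r' `^ (s - 2) = q i / 2 by rewrite /r' -powRrM mulVf ?powRr1 // gt_eqF.
have r'0 : 0 <= r' by exact: powR_ge0.
have rr : r <= r'.
  rewrite leNgt; apply/negP => rr; have : r' `^ (s - 2) <= r `^ (s - 2).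
    by apply: powR_mono; [exact: ltW| |exact: ltW].
  by rewrite E; lra.
have Ei : q i = 2 * r' `^ (s - 2) by rewrite E; field.
exists r'; split => //; last by move=> _; right; exists i.
- by apply: le_trans ar _; apply: powR_mono.
- move=> j; rewrite in_cons => /orP[/eqP->|jl]; first by rewrite Ei.
  apply: le_trans (qr j jl) _; apply: ler_wpM2l => //.
  by apply: powR_mono => //; exact: ltW.
Qed.

(** * The intrinsic scale r and the functions rescaled by it *)

Section UnitStep.
Context {R : realType} {n : nat}.
Local Notation V := 'rV[R]_n.
Local Notation e_ i := (delta_mx ord0 i : V).

Section Scaled.
Variables (s K kap : R) (f : V -> R) (J : V -> @jet R n) (r : V -> R).
Hypothesis s24 : 2 < s <= 4.
Hypothesis K1 : 1 <= K.
Hypothesis kap01 : 0 < kap <= 4^-1.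
(** 16 covers all points where r <= 2 t: there f <= (2 t)^s <= 16 t^s, and the diagonal coefficients
    are at most 2 (2 t)^(s-2) <= 8 t^(s-2). *)
Hypothesis K_pos : forall (phi : V -> R) (J : @jet R n),
  (forall h, `|h| <= 1 -> 0 <= phi h) -> phi 0 <= 16 ->
  (forall i, jq J (e_ i) (e_ i) <= 16) ->
  (forall h, `|h| <= 1 -> `|phi h - phi 0 - tay J h| <= 1) ->
  jet_bounded K J.
(** A diagonal coefficient that attains [r] is 2 after rescaling. A variation of at most 1 -
    2^-(s-2) keeps it at least 1, as [split_case] requires, and above twice 2^-(s-2), the largest
    value compatible with [r] being halved. *)
Hypothesis kap_q : forall t, 0 <= t <= kap -> 9 * K * t + 33 * K * t `^ (s - 2) <= 1 - 2^-1 `^ (s - 2).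
Hypothesis kap_K : 16 * K * kap <= 1.
Hypothesis f01 : forall x, `|x| <= 2 -> 0 <= f x <= 1.
Hypothesis f_jet : forall x, `|x| <= 1 -> forall h, `|h| <= 1 ->
  `|f (x + h) - f x - tay (J x) h| <= `|h| `^ s.
Hypothesis r_ge0 : forall x, 0 <= r x.
Hypothesis r_f : forall x, `|x| <= 1 -> f x <= r x `^ s.
Hypothesis r_q : forall x, `|x| <= 1 -> forall i, jq (J x) (e_ i) (e_ i) <= 2 * r x `^ (s - 2).
Hypothesis r_att : forall x, `|x| <= 1 -> 0 < r x ->
  f x = r x `^ s \/ exists i, jq (J x) (e_ i) (e_ i) = 2 * r x `^ (s - 2).

Let s2 : 2 < s. Proof. by case/andP: s24. Qed.
Let s4 : s <= 4. Proof. by case/andP: s24. Qed.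
Let s0 : 0 <= s. Proof. by have := s2; lra. Qed.
Let s20 : 0 < s - 2. Proof. by have := s2; lra. Qed.
Let s02 : 0 <= s - 2 <= 2%:R. Proof. by rewrite (ltW s20) /=; have := s4; lra. Qed.
Let s04 : 0 <= s <= 4%:R. Proof. by rewrite s0 s4. Qed.

(** Division by t^s is the scaling under which the Taylor remainder keeps the constant 1. *)
Definition scaled_fun (x : V) (t : R) (u : V) : R := (t `^ s)^-1 * f (x + t *: u).
Definition scaled_jet (x : V) (t : R) (u : V) : @jet R n :=
  jmap (t `^ s)^-1 (lin_scale t) (J (x + t *: u)).

Let ts t : 0 < t -> 0 < t `^ s. Proof. exact: powR_gt0. Qed.
Let pow_s t : 0 < t -> t `^ s = t ^+ 2 * t `^ (s - 2).
Proof.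
move=> t0; rewrite -powR_nat ?(ltW t0) // -powR_addn ?(ltW t0) //; first by congr (_ `^ _); ring.
by rewrite gt_eqF //; have := s2; lra.
Qed.

Let norm_t (t : R) (u : V) : 0 < t -> `|t *: u| = t * `|u|.
Proof. by move=> t0; rewrite normrZ gtr0_norm. Qed.

Lemma scaled_exp x t u : 0 < t <= 1 -> `|x + t *: u| <= 1 -> forall h, `|h| <= 1 ->
  `|scaled_fun x t (u + h) - scaled_fun x t u - tay (scaled_jet x t u) h| <= `|h| `^ s.
Proof.
move=> /andP[t0 t1] xu h h1; have tp := ts t0.
rewrite /scaled_fun tay_jmap scalerDr addrA -!mulrBr normrM gtr0_norm ?invr_gt0 //.
have th : `|t *: h| <= 1 by rewrite norm_t // mulr_ile1 // ltW.
apply: le_trans (ler_wpM2l _ (f_jet xu th)) _; first by rewrite invr_ge0 ltW.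
by rewrite norm_t // powRM ?(ltW t0) // mulrA mulVf ?mul1r // gt_eqF.
Qed.

Lemma scaled_q x t u i : 0 < t ->
  jq (scaled_jet x t u) (e_ i) (e_ i) = jq (J (x + t *: u)) (e_ i) (e_ i) / t `^ (s - 2).
Proof.
move=> t0; rewrite /= !jetE pow_s //; have p0 := powR_gt0 (s - 2) t0; field.
by rewrite !gt_eqF.
Qed.

Lemma scaled_bound x t u : 0 < t <= 1 -> `|x + t *: u| <= 1 ->
  f (x + t *: u) <= 16 * t `^ s -> (forall i, jq (J (x + t *: u)) (e_ i) (e_ i) <= 16 * t `^ (s - 2)) ->
  jet_bounded K (scaled_jet x t u).
Proof.
move=> t01 xu fu qu; have /andP[t0 t1] := t01; have tp := ts t0.
apply: (K_pos (phi := fun h => scaled_fun x t (u + h))).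
- move=> h h1; rewrite /scaled_fun mulr_ge0 ?invr_ge0 ?(ltW tp) //.
  have th : `|t *: h| <= 1 by rewrite norm_t // mulr_ile1 // ltW.
  have : `|x + t *: (u + h)| <= 2.
    by rewrite scalerDr addrA; apply: le_trans (ler_normD _ _) _; apply: (le_trans (lerD xu th)).
  by move/f01 => /andP[].
- by rewrite addr0 /scaled_fun mulrC ler_pdivrMr.
- move=> i; rewrite scaled_q // ler_pdivrMr //; exact: powR_gt0.
- move=> h h1; rewrite addr0; apply: le_trans (scaled_exp t01 xu h1) _.
  by apply: powR_le1; rewrite ?normr_ge0 ?h1.
Qed.

Lemma scaled_bound_at x t u : 0 < t <= 1 -> `|x + t *: u| <= 1 -> r (x + t *: u) <= 2 * t ->
  jet_bounded K (scaled_jet x t u).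
Proof.
move=> t01 x1 rt; have /andP[t0 t1] := t01.
have two1 : 1 <= (2 : R) by rewrite ler1n.
apply: scaled_bound => //.
  apply: le_trans (r_f x1) _; apply: (@le_trans _ _ ((2 * t) `^ s)); first exact: powR_mono.
  have -> : 16 = (2 : R) ^+ 4 by ring.
  by apply: powR_cM => //; exact: ltW.
move=> i; apply: le_trans (r_q x1 i) _.
apply: (@le_trans _ _ (2 * (2 ^+ 2 * t `^ (s - 2)))).
  apply: ler_wpM2l => //; apply: (@le_trans _ _ ((2 * t) `^ (s - 2))); first by apply: powR_mono => //; exact: ltW.
  by apply: powR_cM => //; exact: ltW.
by rewrite mulrA; apply: ler_wpM2r; [exact: powR_ge0|rewrite expr2; lra].
Qed.

Lemma scaled_bound0 x t : 0 < t <= 1 -> `|x| <= 1 -> r x <= 2 * t ->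
  jet_bounded K (scaled_jet x t 0).
Proof. by move=> t01 x1 rt; apply: scaled_bound_at; rewrite ?scaler0 ?addr0. Qed.

(** A second difference with step 1 of a function with values in [0, 1] and remainders at most 1
    forces q_i <= 2, and f <= 1; so neither quantity that attains [r] allows a value above 1. *)
Lemma r_le1 x : `|x| <= 1 -> r x <= 1.
Proof.
move=> x1; rewrite leNgt; apply/negP => r1; have r0 : 0 < r x by apply: lt_trans r1.
have lt1 p : 0 < p -> 1 < r x `^ p.
  by move=> p0; have := gt0_ltr_powR p0 (x := 1) (y := r x); rewrite powR1; apply; rewrite ?nnegrE.
have x0 : `|x + 1 *: (0 : V)| <= 1 by rewrite scaler0 addr0.
have [E|[i E]] := r_att x1 r0.
  have : f x <= 1 by have /andP[] := f01 (le_trans x1 (ler1n _ 2)).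
  by rewrite E leNgt lt1 //; have := s2; lra.
have nq : jq (J x) (e_ i) (e_ i) <= 2; last first.
  by move: nq; rewrite E; have := lt1 _ s20; lra.
have n1 : `|e_ i| <= 1 by rewrite norm_delta.
have n2 : `|- e_ i| <= 1 by rewrite normrN norm_delta.
have := f_jet x1 n1; have := f_jet x1 n2.
have b (y : V) : `|y| <= 1 -> 0 <= f (x + y) <= 1.
  by move=> y1; apply: f01; apply: le_trans (ler_normD _ _) _; apply: (lerD x1 y1).
have /andP[a1 a2] := b _ n1; have /andP[a3 a4] := b _ n2.
have /andP[a5 a6] := f01 (le_trans x1 (ler1n _ 2)).
rewrite normrN norm_delta powR1 -[- e_ i]scaleN1r tayZ /tay.
rewrite -[- e_ i]scaleN1r in a3 a4.
move: a1 a2 a3 a4 a5 a6; move: (f _) (f (x + _)) (f x) (jl _ _) (jq _ _ _) (jt _ _ _ _) => f1 f2 f3 l q t.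
by rewrite !ler_norml => ? ? ? ? ? ? /andP[? ?] /andP[? ?]; lra.
Qed.

Let half1 : 2^-1 `^ (s - 2) < (1 : R).
Proof.
have := gt0_ltr_powR s20 (x := 2^-1) (y := 1); rewrite powR1; apply; rewrite ?nnegrE ?invr_ge0 ?ler0n //.
by rewrite invf_lt1 ?ltr1n ?ltr0n.
Qed.

Lemma scaled_qvar x t u i : 0 < t <= 1 -> `|x| <= 1 -> r x <= 2 * t -> `|u| <= kap ->
  `|x + t *: u| <= 1 -> u != 0 ->
  `|jq (scaled_jet x t u) (e_ i) (e_ i) - jq (scaled_jet x t 0) (e_ i) (e_ i)| <= 1 - 2^-1 `^ (s - 2).
Proof.
move=> t01 x1 rt uk xu un0; have /andP[kap0 kap4] := kap01.
have x0 : `|x + t *: (0 : V)| <= 1 by rewrite scaler0 addr0.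
have up : 0 < `|u| by rewrite normr_gt0.
have uu : 0 <= `|u| <= kap by rewrite normr_ge0.
apply: le_trans (kap_q uu); apply: (@q_var _ _ (scaled_fun x t) 0).
- exact: s24.
- exact: norm_delta.
- by rewrite up (le_trans uk).
- move=> w w2; rewrite -[X in scaled_fun _ _ X]/(0 + w); apply: le_trans (scaled_exp t01 x0 _) _; first by lra.
  by rewrite ler_peMl ?powR_ge0.
- move=> w w2; rewrite add0r; apply: le_trans (scaled_exp t01 xu _) _; first by lra.
  by rewrite ler_peMl ?powR_ge0.
- by move=> w; have [] := scaled_bound0 t01 x1 rt w.
Qed.

Lemma scaled_lip0 x t : 0 < t <= 1 -> `|x| <= 1 -> r x <= 2 * t -> forall u, `|u| <= 1 ->
  `|scaled_fun x t u - scaled_fun x t 0| <= 4 * K * `|u|.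
Proof.
move=> t01 x1 rt u u1.
have x0 : `|x + t *: (0 : V)| <= 1 by rewrite scaler0 addr0.
have K0 : 0 <= K by apply: le_trans K1.
have e0 : `|scaled_fun x t (0 + u) - scaled_fun x t 0 - tay (scaled_jet x t 0) u| <= K * `|u| `^ s.
  by apply: le_trans (scaled_exp t01 x0 u1) _; rewrite ler_peMl ?powR_ge0.
by have := jet_lip (ltW s2) K0 (scaled_bound0 t01 x1 rt) u1 e0; rewrite add0r.
Qed.

(** If f attains [r x], the Lipschitz bound keeps the rescaled f at least 3/4, whereas r y < r x / 2
    would make it at most 2^-s < 1/4. If some q_i attains it, [scaled_qvar] excludes the drop that
    halving would cause. *)
Lemma slow_half x y : `|x| <= 1 -> `|y| <= 1 -> 0 < r x -> `|y - x| <= kap * r x -> r x / 2 <= r y.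
Proof.
move=> x1 y1 rx yx; rewrite leNgt; apply/negP => ryx.
have t01 : 0 < r x <= 1 by rewrite rx r_le1.
have [t tE] : {t | r x = t} by exists (r x).
rewrite tE in t01 ryx yx rx; have rt : r x <= 2 * t by rewrite tE; lra.
pose u := t^-1 *: (y - x); have tn0 : t != 0 by rewrite gt_eqF.
have yE : y = x + t *: u by rewrite /u scalerA divff // scale1r addrC subrK.
have uk : `|u| <= kap.
  by rewrite /u normrZ gtr0_norm ?invr_gt0 // mulrC ler_pdivrMr.
have /andP[kap0 kap4] := kap01.
have two0 : 0 <= t / 2 by nng.
have tsp := powR_gt0 s rx; have ts2p := powR_gt0 (s - 2) rx.
have fy : f y <= 2^-1 `^ s * t `^ s.
  apply: le_trans (r_f y1) _; rewrite -powRM ?invr_ge0 ?ler0n ?(ltW rx) // mulrC.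
  by apply: powR_mono => //; exact: ltW.
have [E|[i E]] := r_att x1 (eq_ind_r (fun z => 0 < z) rx tE).
  have u1 : `|u| <= 1 by lra.
  have := scaled_lip0 t01 x1 rt u1; rewrite /scaled_fun -yE scaler0 addr0 E tE mulVf ?gt_eqF //.
  have p4 := pow_half_lt s2.
  have Kk : 4 * K * `|u| <= 4^-1.
    have : 4 * K * `|u| <= 4 * K * kap by apply: ler_wpM2l => //; have := K1; nng; lra.
    by have := kap_K; lra.
  have : (t `^ s)^-1 * f y <= 2^-1 `^ s by rewrite mulrC ler_pdivrMr.
  by rewrite ler_norml; move: p4 Kk; move: (_ * f y) (2^-1 `^ s) (4 * K * _) => a b c; lra.
have un0 : u != 0.
  apply/negP => /eqP u0; move: ryx; rewrite yE u0 scaler0 addr0 tE; lra.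
have xu : `|x + t *: u| <= 1 by rewrite -yE.
have := scaled_qvar i t01 x1 rt uk xu un0.
rewrite !scaled_q // -yE scaler0 addr0 E tE.
have -> : 2 * t `^ (s - 2) / t `^ (s - 2) = 2 by field; rewrite gt_eqF.
have qy : jq (J y) (e_ i) (e_ i) / t `^ (s - 2) <= 2 * 2^-1 `^ (s - 2).
  rewrite ler_pdivrMr // -mulrA -powRM ?invr_ge0 ?ler0n ?(ltW rx) // mulrC.
  apply: le_trans (r_q y1 i) _; rewrite [leRHS]mulrC; apply: ler_wpM2l => //.
  by rewrite mulrC; apply: powR_mono => //; exact: ltW.
rewrite ler_norml => /andP[h _]; have := half1.
by move: h qy; move: (2^-1 `^ (s - 2)) (_ / _) => a b; lra.
Qed.

(** The upper bound is [slow_half] with the points exchanged: a larger [r y] makes the points closer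
    in the scale of [y]. *)
Lemma slow_both x y : `|x| <= 1 -> `|y| <= 1 -> 0 < r x -> `|x - y| <= kap * r x ->
  r y <= 2 * r x /\ r x <= 2 * r y.
Proof.
move=> x1 y1 rx xy; have h : r x / 2 <= r y by apply: slow_half => //; rewrite distrC.
split; last by lra.
rewrite leNgt; apply/negP => ry; have ry0 : 0 < r y by lra.
have /andP[kap0 _] := kap01.
have : r y / 2 <= r x.
  apply: slow_half => //; apply: le_trans xy _; apply: ler_wpM2l; first exact: ltW.
  by lra.
by lra.
Qed.

(** After rescaling by the larger of [r x] and |h| the function is at most 1 at [x] and its
    increments are at most 4 K. Since each summand has square at most f, this controls the summands
    beyond the scale [r x]. *)
Lemma far_bound x h : `|x| <= 1 -> `|h| <= 1 -> f (x + h) <= 5 * K * Num.max (r x) `|h| `^ s.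
Proof.
move=> x1 h1; set t := Num.max _ _.
have rt : r x <= t by rewrite le_max lexx.
have ht : `|h| <= t by rewrite le_max lexx orbT.
have t1 : t <= 1 by rewrite ge_max r_le1.
have K0 : 0 <= K by apply: le_trans K1.
have [t0|t0] := leP t 0.
  have h0 : h = 0 by apply/eqP; rewrite -normr_le0; apply: le_trans t0.
  have rx : r x = 0 by apply/eqP; rewrite eq_le r_ge0 andbT; apply: le_trans t0.
  rewrite h0 addr0; apply: le_trans (r_f x1) _; rewrite rx powR0; last by rewrite gt_eqF //; have := s2; lra.
  by nng.
have t01 : 0 < t <= 1 by rewrite t0.
have tn0 : t != 0 by rewrite gt_eqF.
have rt2 : r x <= 2 * t by lra.
pose u := t^-1 *: h; have hE : h = t *: u by rewrite /u scalerA divff // scale1r.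
have u1 : `|u| <= 1.
  by rewrite /u normrZ gtr0_norm ?invr_gt0 // mulrC ler_pdivrMr // mul1r.
have := scaled_lip0 t01 x1 rt2 u1; rewrite /scaled_fun -hE scaler0 addr0.
have tsp := powR_gt0 s t0.
have fx : (t `^ s)^-1 * f x <= 1.
  rewrite mulrC ler_pdivrMr // mul1r; apply: le_trans (r_f x1) _; exact: powR_mono.
have Ku : 4 * K * `|u| <= 4 * K by rewrite ler_piMr //; nng.
have -> : (f (x + h) <= 5 * K * t `^ s) = ((t `^ s)^-1 * f (x + h) <= 5 * K).
  by rewrite [in RHS]mulrC ler_pdivrMr.
rewrite ler_norml; have := K1.
by move: fx Ku; move: (_ * f x) (_ * f (x + h)) (4 * K * `|u|) => a b c; lra.
Qed.

Section LocalFamily.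
Variables (S : {set 'I_n}) (d m : nat) (c0 A0 ep : R).
Hypothesis Sd : (#|S| <= d.+1)%N.
Hypothesis f_inv : inv_off S 2 f.
Hypothesis c00 : 0 < c0.
Hypothesis ep1 : ep < 1.
Hypothesis root_case : forall (f : V -> R) (J : V -> @jet R n),
  (forall x, `|x| <= 1 + kap -> 0 <= f x) ->
  (forall x, `|x| <= kap -> forall h, `|h| <= 1 ->
     `|f (x + h) - f x - tay (J x) h| <= `|h| `^ s) ->
  (forall x, `|x| <= kap -> jet_bounded K (J x)) ->
  f 0 <= K -> ep <= f 0 ->
  forall x, `|x| <= c0 -> gap A0 c0 (s / 2) (fun x => Num.sqrt (f x)) x.
Hypothesis split_case : forall (f : V -> R) (J : V -> @jet R n) (S : {set 'I_n}) (i : 'I_n), (#|S| <= d.+1)%N ->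
  (forall x, `|x| <= 1 -> 0 <= f x) ->
  (forall x, `|x| <= kap -> forall h, `|h| <= 1 ->
     `|f (x + h) - f x - tay (J x) h| <= `|h| `^ s) ->
  (forall x, `|x| <= kap -> jet_bounded K (J x)) ->
  f 0 <= K -> f 0 <= ep -> (forall x, `|x| <= kap -> 1 <= jq (J x) (e_ i) (e_ i)) ->
  inv_off S 1 f ->
  exists g : 'I_m.+1 -> V -> R, forall x, `|x| <= c0 ->
    f x = \sum_j g j x ^+ 2 /\ forall j, gap A0 c0 (s / 2) (g j) x.
Hypothesis c0k : c0 <= kap.
Hypothesis A00 : 0 <= A0.

(** If the rescaled value at 0 is at least [ep], a single root suffices and is padded with zeros.
    Otherwise the value is below 1, so [r y] is attained by some q_i, which becomes 2 after
    rescaling, and a square is split off along that axis. *)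
Lemma unit_family y : `|y| <= 2^-1 -> 0 < r y -> exists G : 'I_m.+1 -> V -> R, forall u, `|u| <= c0 ->
  scaled_fun y (r y) u = \sum_j G j u ^+ 2 /\ forall j, gap A0 c0 (s / 2) (G j) u.
Proof.
move=> y2 ry; have y1 : `|y| <= 1 by apply: le_trans y2 _; lra.
have t01 : 0 < r y <= 1 by rewrite ry r_le1.
have [t tE] : {t | r y = t} by exists (r y).
have rt : r y <= 2 * t by rewrite tE in ry *; lra.
have E := r_att y1 ry; rewrite tE in t01 ry E *.
have /andP[_ t1] := t01; have /andP[kap0 kap4] := kap01.
have [tsp ts2p] := (powR_gt0 s ry, powR_gt0 (s - 2) ry).
have nx (u : V) a : `|u| <= a -> `|y + t *: u| <= 2^-1 + a.
  move=> ua; apply: le_trans (ler_normD _ _) _; apply: lerD => //.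
  by rewrite norm_t // (le_trans _ ua) // ler_piMl.
have xk (u : V) : `|u| <= kap -> `|y + t *: u| <= 1 by move=> /nx; lra.
have phi0 (u : V) : `|u| <= 1 + kap -> 0 <= scaled_fun y t u.
  move=> /nx uk; rewrite /scaled_fun mulr_ge0 ?invr_ge0 ?(ltW tsp) //.
  have : `|y + t *: u| <= 2 by lra.
  by move=> /f01 /andP[].
have phi_jet u : `|u| <= kap -> forall h, `|h| <= 1 ->
    `|scaled_fun y t (u + h) - scaled_fun y t u - tay (scaled_jet y t u) h| <= `|h| `^ s.
  by move=> uk; apply: scaled_exp => //; exact: xk.
have rtu u : `|u| <= kap -> r (y + t *: u) <= 2 * t.
  move=> uk; rewrite -tE; apply: (proj1 (slow_both y1 _ _ _)); rewrite tE ?xk //.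
  by rewrite opprD addrA subrr sub0r normrN norm_t // mulrC ler_pM2r.
have phi_b u : `|u| <= kap -> jet_bounded K (scaled_jet y t u).
  by move=> uk; apply: scaled_bound_at; [exact: t01|exact: xk|exact: rtu].
have phiK : scaled_fun y t 0 <= K.
  rewrite /scaled_fun scaler0 addr0 mulrC ler_pdivrMr //.
  by apply: le_trans (r_f y1) _; rewrite tE ler_peMl // ltW.
have [epf|/ltW epf] := leP ep (scaled_fun y t 0).
  exists (fun j => if j == ord0 then (fun u => Num.sqrt (scaled_fun y t u)) else fun=> 0) => u uc.
  split.
    rewrite big_ord_recl /= big1 ?addr0 => [|i _]; last by rewrite expr0n.
    by rewrite sqr_sqrtr // phi0 //; have := c0k; lra.
  move=> j; case: ifP => _; first exact: (root_case phi0 phi_jet phi_b).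
  by apply: gap_const => //; rewrite normr0.
have [i Ei] : exists i, jq (J y) (e_ i) (e_ i) = 2 * t `^ (s - 2).
  case: E => // E; move: epf; rewrite /scaled_fun scaler0 addr0 E mulVf ?gt_eqF //.
  by have := ep1; lra.
apply: (split_case (J := scaled_jet y t) (S := S) (i := i)) => //.
- by move=> u u1; apply: phi0; lra.
- have q0 : jq (scaled_jet y t 0) (e_ i) (e_ i) = 2.
    by rewrite scaled_q // scaler0 addr0 Ei; field; rewrite gt_eqF.
  move=> u uk; have [->|un0] := eqVneq u 0; first by rewrite q0; lra.
  have := scaled_qvar i t01 y1 rt uk (xk u uk) un0; rewrite q0 ler_norml => /andP[+ _].
  by have := powR_ge0 2^-1 (s - 2); move: (_ `^ _) (jq _ _ _) => a b; lra.
- move=> j jS u a u1 ua1; rewrite /scaled_fun scalerDr addrA scalerA; congr (_ * _).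
  have n2 v : `|v| <= 1 -> `|y + t *: v| <= 2 by move=> /nx; lra.
  by apply: f_inv; rewrite ?n2 // -scalerA -addrA -scalerDr n2.
Qed.

Lemma unit_family_at y : `|y| <= 2^-1 -> 0 < r y -> exists G : 'I_m.+1 -> V -> R,
  forall w, `|w - y| <= c0 * r y -> f w = \sum_j G j w ^+ 2 /\
    forall j, gap (r y `^ (s / 2) * A0) (c0 * r y) (s / 2) (G j) w.
Proof.
move=> y2 ry; have [G HG] := unit_family y2 ry.
have [t tE] : {t | r y = t} by exists (r y).
rewrite tE in ry HG *; have tn0 : t != 0 by rewrite gt_eqF.
exists (fun j w => t `^ (s / 2) * G j (t^-1 *: (w - y))) => w wy.
have [u wE] : exists u, w = y + t *: u.
  by exists (t^-1 *: (w - y)); rewrite scalerA divff // scale1r addrC subrK.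
have uE : t^-1 *: (w - y) = u by rewrite wE addrAC subrr add0r scalerA mulVf // scale1r.
have uc : `|u| <= c0.
  by rewrite -uE normrZ gtr0_norm ?invr_gt0 // mulrC ler_pdivrMr.
have [Gs Gg] := HG u uc; split.
  under eq_bigr => j _ do rewrite exprMn uE.
  rewrite -mulr_sumr -Gs powR_sq ?(ltW ry) // /scaled_fun -wE.
  by rewrite mulrA divff ?mul1r // gt_eqF // powR_gt0.
move=> j; have := gap_scale (t `^ (s / 2)) y ry c00 (Gg j).
by rewrite -wE ger0_norm ?powR_ge0 // [t * c0]mulrC.
Qed.

End LocalFamily.
End Scaled.
End UnitStep.

(** * The induction on the number of variables *)

Section UnitDecomp.
Context {R : realType} {n : nat}.
Local Notation V := 'rV[R]_n.
Local Notation e_ i := (delta_mx ord0 i : V).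

Lemma small_scale (K s : R) : 1 <= K -> 2 < s <= 4 -> exists kap : R, [/\ 0 < kap <= 4^-1,
  forall t, 0 <= t <= kap -> 9 * K * t + 33 * K * t `^ (s - 2) <= 1 - 2^-1 `^ (s - 2) &
  16 * K * kap <= 1].
Proof.
move=> K1 /andP[s2 s4]; have K0 : 0 < K by lra.
have s20 : 0 < s - 2 by lra.
have half1 : 2^-1 `^ (s - 2) < (1 : R).
  have := gt0_ltr_powR s20 (x := 2^-1) (y := 1); rewrite powR1; apply; rewrite ?nnegrE ?invr_ge0 ?ler0n //.
  by rewrite invf_lt1 ?ltr1n ?ltr0n.
have [eta etaE] : {e | 1 - 2^-1 `^ (s - 2) = e} by exists (1 - 2^-1 `^ (s - 2)).
have eta0 : 0 < eta by rewrite -etaE; lra.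
have e1 : 0 < eta / (66 * K) by psv.
have e2 : 0 < eta / (18 * K) by psv.
have [k1 /andP[k10 _] H1] := powR_small s20 e1.
have q4 : 0 < (4^-1 : R) by rewrite invr_gt0.
have q16 : 0 < (16 * K)^-1 by psv.
have [kap [kap0 kapk1 kape kap4 kap16]] := exists_min4 k10 e2 q4 q16.
exists kap; split; first by rewrite kap0.
- move=> t /andP[t0 tk]; rewrite etaE.
  have T1 : t `^ (s - 2) <= eta / (66 * K) by apply: H1; rewrite t0 (le_trans tk).
  have T2 : t <= eta / (18 * K) by apply: le_trans kape.
  have -> : eta = 9 * K * (eta / (18 * K)) + 33 * K * (eta / (66 * K)) by field; rewrite gt_eqF.
  by apply: lerD; apply: ler_wpM2l => //; nng.
- by rewrite mulrC -ler_pdivlMr ?div1r //; psv.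
Qed.

(** Here [t] stands for r(x). For |h| >= t/N the bound g^2 = O(|h|^s) says that 0 is an affine
    approximation, and inside [l] gives one; [affine_patch] joins them. If t = 0 the outer region is
    everything and g vanishes at [x]. *)
Lemma patch_gap (s K N M t : R) (x : V) (g : V -> R) : 2 < s <= 4 -> 1 <= K -> 4 <= N ->
  0 <= t <= 1 -> 0 <= M ->
  (forall h, `|h| <= 4^-1 -> g (x + h) ^+ 2 <= 5 * K * Num.max t `|h| `^ s) ->
  (forall h, `|h| <= 4^-1 -> `|g (x + h)| <= 1) ->
  (0 < t -> exists2 l, linr l & forall h, `|h| <= t / N -> `|g (x + h) - (g x + l h)| <= M * `|h| `^ (s / 2)) ->
  gap (2 * 1 + 5 * (M + 5 * K * N ^+ 2)) 4^-1 (s / 2) g x.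
Proof.
move=> s24 K1 N4 /andP[t0 t1] M0 gf g1 gl; have [sg1 /andP[sg0 sg2] s2] := half_exp s24.
have N0 : 0 < N by lra.
have K0 : 0 <= K by lra.
have N2 : 0 <= 5 * K * N ^+ 2 by rewrite !mulr_ge0 // ?exprn_ge0 // ltW.
have M'0 : 0 <= M + 5 * K * N ^+ 2 by exact: addr_ge0.
have q4 : 0 < (4^-1 : R) <= 1 by rewrite invr_gt0 ltr0n /= invf_le1 ?ler1n ?ltr0n.
have zero_lin : linr (fun _ : V => 0 : R) by move=> c u v; ring.
have far h : t / N <= `|h| <= 4^-1 -> `|g (x + h)| <= (M + 5 * K * N ^+ 2) * `|h| `^ (s / 2).
  move=> /andP[th h4]; apply: (@le_trans _ _ (5 * K * N ^+ 2 * `|h| `^ (s / 2))); last first.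
    by apply: ler_wpM2r; rewrite ?powR_ge0 // lerDr.
  rewrite -(@ler_pXn2r _ 2%N) // ?nnegrE //; last by rewrite mulr_ge0 // powR_ge0.
  rewrite real_normK ?num_real // [leRHS]exprMn powR_sq //; apply: le_trans (gf h h4) _.
  have mx : Num.max t `|h| <= N * `|h|.
    by rewrite ge_max mulrC -ler_pdivrMr // th ler_peMr // ; lra.
  apply: (@le_trans _ _ (5 * K * (N ^+ 4 * `|h| `^ s))).
    apply: ler_wpM2l; first by lra.
    apply: (@le_trans _ _ ((N * `|h|) `^ s)); first by apply: powR_mono => //; rewrite ?le_max ?t0 //; lra.
    by apply: powR_cM => //; have /andP[] := s24; lra.
  rewrite mulrA; apply: ler_wpM2r; first exact: powR_ge0.
  have -> : (5 * K * N ^+ 2) ^+ 2 = 5 * K * (5 * K) * N ^+ 4 by ring.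
  by apply: ler_wpM2r; [nng|rewrite ler_peMr //; lra].
have near0 : t = 0 -> gap (2 * 1 + 5 * (M + 5 * K * N ^+ 2)) 4^-1 (s / 2) g x.
  move=> t00; have far0 h : `|h| <= 4^-1 -> `|g (x + h)| <= (M + 5 * K * N ^+ 2) * `|h| `^ (s / 2).
    by move=> h4; apply: far; rewrite t00 mul0r normr_ge0.
  have gx : g x = 0.
    have := far0 0; rewrite normr0 addr0 powR0 ?mulr0; last by rewrite gt_eqF.
    by rewrite invr_ge0 ler0n => /(_ isT); rewrite normr_le0 => /eqP.
  apply: (gap_of_affine (l := fun=> 0)) => //; first by rewrite mulr_ge0.
  move=> h h4; rewrite gx addr0 subr0; apply: le_trans (far0 h h4) _.
  by apply: ler_wpM2r; [exact: powR_ge0|rewrite ler_peMl //; lra].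
have [tp|tn] := ltP 0 t; last by apply: near0; apply/eqP; rewrite eq_le tn t0.
have [l ll gl'] := gl tp.
apply: (gap_of_affine (l := l)) => //; first by rewrite mulr_ge0.
apply: (affine_patch (rho := t / N) (b := 0) (m := fun=> 0)) => //.
- rewrite divr_gt0 //= ler_pdivrMr //; lra.
- move=> h /gl' H; apply: le_trans H _; apply: ler_wpM2r; first exact: powR_ge0.
  by rewrite lerDl.
- by move=> h /far; rewrite addr0 subr0.
Qed.

Lemma unit_step (s C : R) (d m : nat) : (0 < n)%N -> 2 < s <= 4 -> decomp_at (n := n) s d m C ->
  exists C', decomp_at (n := n) s d.+1 #|{: @colour n * 'I_m.+1}| C'.
Proof.
move=> n0 s24 IH; have [sg1 sg02 s2] := half_exp s24; have /andP[sg0 sg2] := sg02.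
have [Cp Cp1 pos] := @jet_pos_bound R n 16 (ler0n _ _).
have [K KE] : {K | Cp + 16 = K} by exists (Cp + 16).
have K1 : 1 <= K by lra.
have CpK : Cp <= K by lra.
have K_pos (phi : V -> R) (J : @jet R n) : (forall h, `|h| <= 1 -> 0 <= phi h) -> phi 0 <= 16 ->
    (forall i, jq J (e_ i) (e_ i) <= 16) -> (forall h, `|h| <= 1 -> `|phi h - phi 0 - tay J h| <= 1) ->
    jet_bounded K J.
  move=> H1 H2 H3 H4 h; have [L1 L2 L3] := pos phi J H1 H2 H3 H4 h.
  by split; [apply: le_trans L1 _|apply: le_trans L2 _|apply: le_trans L3 _]; apply: ler_wpM2r => //; nng.
clear KE CpK pos Cp1 Cp; have [kap [kap01 kap_q kap_K]] := small_scale K1 s24.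
have /andP[kap0 kap4] := kap01.
have [epB [cB [AB [epB0 cB0 AB0 split_case]]]] := local_split s24 K1 kap01 IH.
have h2 : 0 < (2^-1 : R) by rewrite invr_gt0.
have [ep [ep0 epB' ep2 _ _]] := exists_min4 epB0 h2 h2 h2.
have [cA [AA [cA0 AA0 root_case]]] := @local_root R n s K kap ep s24 K1 kap01 ep0.
have [c0 [c00 c0A c0B c0k _]] := exists_min4 cA0 cB0 kap0 kap0.
have [A0 [A00 AAA ABA]] : exists A0, [/\ 0 <= A0, AA <= A0 & AB <= A0].
  by exists (AA + AB); split; rewrite ?lerDl ?lerDr ?addr_ge0.
have [Cg [cg [Cg0 /andP[cg0 cg1] glued]]] := glue_squares R n0.
(* With this [N], the radius r x / N is exactly the one on which the glued functions have their
   expansion. *)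
have [N NE] : {N | (cg * c0)^-1 = N} by exists (cg * c0)^-1.
have N4 : 4 <= N.
  rewrite -NE -[leLHS]invrK lef_pV2 ?posrE ?invr_gt0 ?mulr_gt0 //.
  by apply: le_trans (ler_piMl _ cg1) _; rewrite ?(ltW c00) // (le_trans c0k).
(* The factor 4 bounds (r y / r x)^(s/2), because r y <= 2 r x and s/2 <= 2; [N ^+ 2] bounds
   N^(s/2). *)
have [M ME] : {M | 4 * Cg * A0 * N ^+ 2 = M} by exists (4 * Cg * A0 * N ^+ 2).
have N0 : 0 < N by apply: lt_le_trans N4; rewrite ltr0n.
have M0 : 0 <= M by rewrite -ME !mulr_ge0 ?exprn_ge0 // ltW.
exists (2 * 1 + 5 * (M + 5 * K * N ^+ 2)) => f S Sd [f01 f_jetE] f_inv.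
have [J f_jet] : {J : V -> @jet R n & forall x, `|x| <= 1 -> forall h, `|h| <= 1 ->
    `|f (x + h) - f x - tay (J x) h| <= `|h| `^ s}.
  apply: (@boolp.choice _ _ (fun x J => `|x| <= 1 -> forall h, `|h| <= 1 ->
    `|f (x + h) - f x - tay J h| <= `|h| `^ s)) => x.
  have [x1|x1] := boolP (`|x| <= 1); first by have [J HJ] := f_jetE x x1; exists J.
  by have [J _] := f_jetE 0 (eq_ind_r (fun z => z <= 1) ler01 (normr0 _)); exists J.
have [r rP] : {r : V -> R & forall x, [/\ 0 <= r x, `|x| <= 1 -> f x <= r x `^ s,
    `|x| <= 1 -> forall i, jq (J x) (e_ i) (e_ i) <= 2 * r x `^ (s - 2) &
    `|x| <= 1 -> 0 < r x -> f x = r x `^ s \/ exists i, jq (J x) (e_ i) (e_ i) = 2 * r x `^ (s - 2)]}.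
  apply: (@boolp.choice _ _ (fun x r => [/\ 0 <= r, `|x| <= 1 -> f x <= r `^ s,
    `|x| <= 1 -> forall i, jq (J x) (e_ i) (e_ i) <= 2 * r `^ (s - 2) &
    `|x| <= 1 -> 0 < r -> f x = r `^ s \/ exists i, jq (J x) (e_ i) (e_ i) = 2 * r `^ (s - 2)])) => x.
  have [x1|x1] := boolP (`|x| <= 1); last by exists 0.
  have fx0 : 0 <= f x by have /andP[] := f01 x (le_trans x1 (ler1n _ 2)).
  have s2' : 2 < s by case/andP: s24.
  have [r [r0 rf rq rE]] := scale_of (fun i => jq (J x) (e_ i) (e_ i)) fx0 s2'.
  by exists r.
have r_ge0 x : 0 <= r x by have [] := rP x.
have r_f x : `|x| <= 1 -> f x <= r x `^ s by have [] := rP x.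
have r_q x : `|x| <= 1 -> forall i, jq (J x) (e_ i) (e_ i) <= 2 * r x `^ (s - 2) by have [] := rP x.
have r_att x : `|x| <= 1 -> 0 < r x ->
  f x = r x `^ s \/ exists i, jq (J x) (e_ i) (e_ i) = 2 * r x `^ (s - 2) by have [] := rP x.
have rle1 := r_le1 s24 f01 f_jet r_ge0 r_att.
have slow := slow_both s24 K1 kap01 K_pos kap_q kap_K f01 f_jet r_ge0 r_f r_q r_att.
have farb := far_bound s24 K1 K_pos f01 f_jet r_ge0 r_f r_q r_att.
have le21 (x : V) : `|x| <= 2^-1 -> `|x| <= 1.
  by move=> xx; apply: le_trans xx _; rewrite invf_le1 ?ler1n ?ltr0n.
have ep1 : ep < 1 by apply: le_lt_trans ep2 _; rewrite invf_lt1 ?ltr1n ?ltr0n.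
have sg0' : 0 <= s / 2 by exact: ltW.
have root_case' (phi : V -> R) (JJ : V -> @jet R n) : (forall x, `|x| <= 1 + kap -> 0 <= phi x) ->
    (forall x, `|x| <= kap -> forall h, `|h| <= 1 -> `|phi (x + h) - phi x - tay (JJ x) h| <= `|h| `^ s) ->
    (forall x, `|x| <= kap -> jet_bounded K (JJ x)) ->
    phi 0 <= K -> ep <= phi 0 -> forall x, `|x| <= c0 -> gap A0 c0 (s / 2) (fun x => Num.sqrt (phi x)) x.
  move=> H1 H2 H3 H4 H5 x xc; apply: (gap_le c00 AAA); apply: (gap_shrink (rho := cA)) => //; first by rewrite c00.
  by apply: (root_case phi JJ) => //; exact: le_trans c0A.
have split_case' (phi : V -> R) (JJ : V -> @jet R n) (S' : {set 'I_n}) (i : 'I_n) : (#|S'| <= d.+1)%N ->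
    (forall x, `|x| <= 1 -> 0 <= phi x) ->
    (forall x, `|x| <= kap -> forall h, `|h| <= 1 -> `|phi (x + h) - phi x - tay (JJ x) h| <= `|h| `^ s) ->
    (forall x, `|x| <= kap -> jet_bounded K (JJ x)) ->
    phi 0 <= K -> phi 0 <= ep -> (forall x, `|x| <= kap -> 1 <= jq (JJ x) (e_ i) (e_ i)) ->
    inv_off S' 1 phi ->
    exists g : 'I_m.+1 -> V -> R, forall x, `|x| <= c0 ->
      phi x = \sum_j g j x ^+ 2 /\ forall j, gap A0 c0 (s / 2) (g j) x.
  move=> H1 H2 H3 H4 H5 H6 H7 H8.
  have [g Hg] := split_case phi JJ S' i H1 H2 H3 H4 H5 (le_trans H6 epB') H7 H8; exists g => x xc.
  have [gs gg] := Hg x (le_trans xc c0B); split => // j.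
  by apply: (gap_le c00 ABA); apply: (gap_shrink (rho := cB)) => //; rewrite c00.
have fam := unit_family_at s24 K1 kap01 K_pos kap_q kap_K f01 f_jet r_ge0 r_f r_q r_att
  Sd f_inv c00 ep1 root_case' split_case' c0k A00.
have [G GP] : {G : V -> 'I_m.+1 -> V -> R & forall y, `|y| <= 2^-1 -> 0 < r y ->
    forall w, `|w - y| <= c0 * r y -> f w = \sum_j G y j w ^+ 2 /\
    forall j, gap (r y `^ (s / 2) * A0) (c0 * r y) (s / 2) (G y j) w}.
  apply: (@boolp.choice _ _ (fun y G => `|y| <= 2^-1 -> 0 < r y ->
    forall w, `|w - y| <= c0 * r y -> f w = \sum_j G j w ^+ 2 /\
    forall j, gap (r y `^ (s / 2) * A0) (c0 * r y) (s / 2) (G j) w)) => y.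
  have [[y2 ry]|no] := boolp.pselect (`|y| <= 2^-1 /\ 0 < r y); last by exists (fun _ _ => 0) => y2 ry; case: no.
  by have [G HG] := fam y y2 ry; exists G.
clear fam split_case' root_case' split_case root_case.
pose U : set V := [set x | `|x| <= 2^-1 /\ 0 < r x].
have c01 : c0 <= 1 by apply: le_trans c0k (le_trans kap4 _); rewrite invf_le1 ?ler1n ?ltr0n.
have rho_pos x : U x -> 0 < c0 * r x <= 1.
  by move=> [x2 rx]; rewrite mulr_gt0 //= mulr_ile1 ?(ltW c00) ?r_ge0 ?rle1 ?le21.
have rho_slow x y : U x -> U y -> `|x - y| <= c0 * r x -> c0 * r y <= 2 * (c0 * r x) /\ c0 * r x <= 2 * (c0 * r y).
  move=> [x2 rx] [y2 ry] xy.
  have [||||q1 q2] := slow x y; rewrite ?le21 //.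
    by apply: le_trans xy _; apply: ler_wpM2r => //; exact: ltW.
  by rewrite ![2 * (c0 * _)]mulrCA !ler_pM2l.
have [g [g_sum g_gap]] := glued U (fun x => c0 * r x) rho_pos rho_slow _ (s / 2) f G
  (fun y => r y `^ (s / 2) * A0) sg02 (fun y Uy w wy => proj1 (GP y Uy.1 Uy.2 w wy))
  (fun y Uy j w wy => proj2 (GP y Uy.1 Uy.2 w wy) j).
clear glued GP G rho_pos rho_slow.
pose gf (j : @colour n * 'I_m.+1) (x : V) : R := if 0 < r x then g j x else 0.
have gf_sum x : `|x| <= 2^-1 -> f x = \sum_j gf j x ^+ 2.
  move=> x2; rewrite /gf; have [rx|rx] := ltP 0 (r x); first exact: g_sum.
  rewrite big1 => [|j _]; last by rewrite expr0n.
  have r0 : r x = 0 by apply/eqP; rewrite eq_le rx r_ge0.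
  have x22 : `|x| <= 2 by apply: le_trans (le21 x x2) _; rewrite ler1n.
  have /andP[fx0 _] := f01 x x22; have := r_f x (le21 x x2); rewrite r0 powR0; last first.
    by rewrite gt_eqF // (lt_le_trans _ s2).
  by move=> fx; apply/eqP; rewrite eq_le fx fx0.
have gf_sq j x : `|x| <= 2^-1 -> gf j x ^+ 2 <= f x.
  move=> x2; rewrite gf_sum // (bigD1 j) //= lerDl sumr_ge0 // => i _; exact: sqr_ge0.
have gap_f j x : `|x| <= 4^-1 -> gap (2 * 1 + 5 * (M + 5 * K * N ^+ 2)) 4^-1 (s / 2) (gf j) x.
  move=> x4; have x1 : `|x| <= 1 by apply: le_trans x4 _; rewrite invf_le1 ?ler1n ?ltr0n.
  have xh h : `|h| <= 4^-1 -> `|x + h| <= 2^-1.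
    by move=> h4; apply: le_trans (ler_normD _ _) _; apply: le_trans (lerD x4 h4) _; clear; lra.
  apply: (@patch_gap s K N M (r x)) => //; first by rewrite r_ge0 rle1.
  - move=> h h4; apply: le_trans (gf_sq j _ (xh h h4)) _; apply: farb => //.
    by apply: le_trans h4 _; rewrite invf_le1 ?ler1n ?ltr0n.
  - move=> h h4; have xh2 := xh h h4.
    have xh22 : `|x + h| <= 2 by apply: le_trans (le21 _ xh2) _; rewrite ler1n.
    have /andP[_ fx1] := f01 _ xh22; rewrite -(@ler_pXn2r _ 2%N) // ?nnegrE //.
    by rewrite real_normK ?num_real // expr1n; apply: le_trans (gf_sq j _ xh2) fx1.
  - move=> rx; have Ux : U x by split=> //; apply: le_trans x4 _; clear; lra.
    have rx1 := rle1 x x1.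
    have Ub w : `|w - x| <= c0 * r x -> U w.
      move=> wx; have wk : `|w - x| <= kap * r x by apply: le_trans wx _; apply: ler_wpM2r.
      have wx4 : `|w - x| <= 4^-1.
        by apply: le_trans wk _; apply: le_trans kap4; rewrite ler_piMr // ltW.
      have w2 : `|w| <= 2^-1 by have := xh _ wx4; rewrite addrC subrK.
      have xw : `|x - w| <= kap * r x by rewrite distrC.
      split => //; have [_ q] := slow x w x1 (le21 w w2) rx xw.
      by move: q rx; clear; lra.
    have [y [[y2 ry] ryx] /(_ x)] := g_gap x Ux Ub j.
    have ryx' : r y <= 2 * r x by move: ryx; rewrite mulrCA ler_pM2l.
    rewrite subrr normr0 => /(_ _)[|l [ll _ _ el]]; first by rewrite !mulr_ge0 ?(ltW cg0) ?(ltW c00).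
    exists l => // h hN.
    have cgr0 : 0 < cg * (c0 * r x) by rewrite !mulr_gt0.
    have tN : r x / N = cg * (c0 * r x) by rewrite -NE invrK mulrC mulrA.
    have hN' : `|h| <= cg * (c0 * r x) by rewrite -tN.
    (* The default value 0 of [gf] does not occur on this ball, so [gf] is the glued function
       there. *)
    have rh : r (x + h) > 0.
      have [] // := Ub (x + h); rewrite addrAC subrr add0r; apply: le_trans hN' _.
      by rewrite ler_piMl // mulr_ge0 // ltW.
    rewrite /gf rx rh opprD addrA; apply: le_trans (el h hN') _.
    have -> : `|h| / (cg * (c0 * r x)) = (N * `|h|) / r x.
      by rewrite -NE; field; rewrite !gt_eqF.
    rewrite powRM ?invr_ge0 ?(ltW rx) //; last by rewrite mulr_ge0 // ltW.
    have Hr : r y `^ (s / 2) * (r x)^-1 `^ (s / 2) <= 4.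
      rewrite -powRM ?invr_ge0 ?r_ge0 //; apply: (@le_trans _ _ (2 `^ (s / 2))).
        by apply: powR_mono => //; [rewrite mulr_ge0 ?invr_ge0|rewrite ler_pdivrMr].
      apply: (@le_trans _ _ (2 `^ 2)); last by rewrite (powR_nat 2%N) // expr2; clear; lra.
      by apply: ler_powR => //; rewrite ler1n.
    have HN : (N * `|h|) `^ (s / 2) <= N ^+ 2 * `|h| `^ (s / 2).
      by apply: powR_cM; rewrite ?sg0' //; exact: le_trans (ler1n _ 4) N4.
    have p0 := powR_ge0 (r x)^-1 (s / 2); have p1 := powR_ge0 (r y) (s / 2).
    rewrite -ME; have -> : 4 * Cg * A0 * N ^+ 2 * `|h| `^ (s / 2) = Cg * A0 * (4 * (N ^+ 2 * `|h| `^ (s / 2))) by ring.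
    move: Hr HN p0 p1 (powR_ge0 (N * `|h|) (s / 2)).
    move: (r y `^ _) (_^-1 `^ _) ((_ * _) `^ _) (N ^+ 2 * _) => a b c e.
    move=> Hr HN p0 p1 p2.
    have -> : Cg * (a * A0) * (c * b) = Cg * A0 * ((a * b) * c) by ring.
    apply: ler_wpM2l; first exact: mulr_ge0.
    apply: ler_pM => //; exact: mulr_ge0.
exists (fun k => gf (enum_val k)); split => [x x2|k x x4]; last exact: gap_f.
by rewrite gf_sum // sum_enum_val.
Qed.

(** Without active coordinates [f] is constant on the cube, by walking along the staircase
    [rowtrunc]. *)
Lemma unit_base (s : R) : 0 < s -> decomp_at (n := n) s 0 1 1.
Proof.
move=> s0 f S; rewrite leqn0 cards_eq0 => /eqP -> [f01 _] f_inv.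
have fc x : `|x| <= 2 -> f x = f 0.
  move=> x2; apply: (@rowtrunc_ind _ _ x (fun y => f y = f 0)) => // i <-.
  apply: f_inv; first by rewrite inE.
    by apply: le_trans x2; exact: norm_rowtrunc.
  by apply: le_trans x2; exact: norm_rowtruncD.
have /andP[f00 f011] : 0 <= f 0 <= 1 by apply: f01; rewrite normr0.
exists (fun _ _ => Num.sqrt (f 0)); split => [x x2|_ x x4].
  by rewrite big_ord1 sqr_sqrtr // fc //; lra.
apply: gap_const; first by rewrite invr_gt0.
by rewrite ger0_norm ?sqrtr_ge0 // -sqrtr1 ler_sqrt.
Qed.

(** [m] is chosen before [s]: each step replaces m by the number of colours times m + 1, which
    involves only [n]. The constant [C] may depend on [s]. *)
Lemma unit_decomp (d : nat) : (0 < n)%N -> exists2 m : nat, (0 < m)%N &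
  forall s : R, 2 < s <= 4 -> exists C : R, decomp_at (n := n) s d m C.
Proof.
move=> n0; elim: d => [|d [m m0 IH]].
  by exists 1%N => // s /andP[s2 _]; exists 1; apply: unit_base; lra.
exists #|{: @colour n * 'I_m.+1}|.
  by apply/card_gt0P; exists (ord0, [ffun=> ord0], ord0).
by move=> s s24; have [C IHC] := IH s s24; exact: (unit_step n0 s24 IHC).
Qed.

End UnitDecomp.

(** * Taylor expansion of functions with Hoelder derivatives *)

Section Lines.
Context {R : realType} {n : nat}.
Local Notation V := 'rV[R]_n.
Local Notation e_ i := (delta_mx ord0 i : V).

Lemma add_subK (W : zmodType) (a b : W) : a + b - a = b.
Proof. by rewrite addrAC subrr add0r. Qed.

Lemma is_derive_dist (W : normedModType R) (f : W -> R) (x v : W) (d : R) :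
  (forall ep, 0 < ep -> exists2 del, 0 < del & forall h : R, `|h| <= del ->
    `|f (x + h *: v) - f x - h * d| <= ep * `|h|) -> is_derive x v f d.
Proof.
move=> H; suff C : (fun h : R => h^-1 *: ((f \o shift x) (h *: v) - f x)) @ 0^' --> d.
  by apply: DeriveDef; [apply/cvg_ex; exists d|exact: cvg_lim].
apply/cvgrPdist_le => ep ep0; have [del del0 Hd] := H ep ep0.
near=> h; have hn0 : h != 0 by near: h; exact: nbhs_dnbhs_neq.
have hd : `|h| <= del by near: h; apply: dnbhs0_le.
have -> : d - h^-1 *: ((f \o shift x) (h *: v) - f x) = - (h^-1 * (f (x + h *: v) - f x - h * d)).
  rewrite /= [h *: v + x]addrC /GRing.scale /=; by field.
rewrite normrN normrM normfV mulrC ler_pdivrMr ?normr_gt0 //; exact: Hd.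
Unshelve. all: by end_near.
Qed.

Lemma derive_line (f : V -> R) (v x : V) (t : R) : derivable f (x + t *: v) v ->
  is_derive t (1 : R) (fun s : R => f (x + s *: v)) ('D_v f (x + t *: v)).
Proof.
have E : (fun h : R => h^-1 *: (((fun s : R => f (x + s *: v)) \o shift t) (h *: (1 : R)) - f (x + t *: v))) =
    (fun h : R => h^-1 *: ((f \o shift (x + t *: v)) (h *: v) - f (x + t *: v))).
  apply/funext => h /=; congr (_ *: (f _ - _)).
  by rewrite scalerDl addrCA /GRing.scale /= mulr1.
by move=> D; apply: DeriveDef; rewrite /derivable /derive E.
Qed.

(** The intermediate point is written as a fraction [th] of the step [c], which treats both signs of
    [c] at once. *)
Lemma mvt_dir (f : V -> R) (v x : V) (c : R) :
  (forall th : R, 0 <= th <= 1 -> derivable f (x + (th * c) *: v) v) ->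
  exists2 th : R, 0 <= th <= 1 & f (x + c *: v) - f x = c * 'D_v f (x + (th * c) *: v).
Proof.
move=> D.
have dg (s : R) : 0 <= s <= 1 -> is_derive s (1 : R) (fun s : R => f (x + (s * c) *: v)) (c * 'D_v f (x + (s * c) *: v)).
  move=> s01; have H1 := derive_line (D s s01).
  have H2 : is_derive s (1 : R) (fun s : R => s * c) c.
    apply: is_derive_eq; rewrite /GRing.scale /=; by ring.
  have := @is_derive1_comp _ _ _ s _ _ H1 H2; rewrite mulrC; apply.
have [||th] := @MVT _ (fun s : R => f (x + (s * c) *: v)) (fun s => c * 'D_v f (x + (s * c) *: v)) 0 1 ltr01.
- by move=> s; rewrite in_itv /= => /andP[s0 s1]; apply: dg; rewrite !ltW.
- apply: derivable_within_continuous => s; rewrite in_itv /= => s01.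
  by have [] := dg s s01.
rewrite in_itv /= => /andP[t0 t1]; rewrite mul1r mul0r scale0r addr0 subr0 mulr1 => E.
by exists th => //; rewrite !ltW.
Qed.


Lemma continuous_dist (g : V -> R) (x : V) : {for x, continuous g} -> forall ep, 0 < ep ->
  exists2 d : R, 0 < d & forall y, `|y - x| <= d -> `|g y - g x| <= ep.
Proof.
move=> /cvgrPdist_le H ep ep0; have /nbhs_normP[d /= d0 Hd] := H ep ep0.
exists (d / 2); first by rewrite divr_gt0.
move=> y yx; rewrite distrC; apply: Hd => /=.
rewrite distrC; apply: (le_lt_trans yx); lra.
Qed.

Lemma open_dist (Om : set V) (x : V) : open Om -> Om x ->
  exists2 d : R, 0 < d & forall y, `|y - x| <= d -> Om y.
Proof.
move=> oO Ox; have /nbhs_normP[d /= d0 Hd] := open_nbhs_nbhs (conj oO Ox).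
exists (d / 2); first by rewrite divr_gt0.
move=> y yx; apply: Hd => /=.
rewrite distrC; apply: (le_lt_trans yx); lra.
Qed.

(** The mean value theorem on each edge of the staircase from [y] to [y + k], which stays in the
    cube of radius |k| about [y]. *)
Lemma increment_bound (f : V -> R) (y k : V) (ep : R) :
  (forall i z, `|z - y| <= `|k| -> derivable f z (e_ i)) ->
  (forall i z, `|z - y| <= `|k| -> `|partial i f z - partial i f y| <= ep) ->
  `|f (y + k) - f y - \sum_i k ord0 i * partial i f y| <= n%:R * ep * `|k|.
Proof.
move=> D H.
have -> : f (y + k) - f y = \sum_(i < n) (f (y + rowtrunc k i.+1) - f (y + rowtrunc k i)).
  rewrite -(big_mkord xpredT (fun i => f (y + rowtrunc k i.+1) - f (y + rowtrunc k i))).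
  by rewrite telescope_sumr // rowtrunc_all rowtrunc0 addr0.
rewrite -sumrB; apply: le_trans (ler_norm_sum _ _ _) _.
have -> : n%:R * ep * `|k| = \sum_(i < n) ep * `|k|.
  by rewrite sumr_const card_ord -mulrA mulr_natl.
apply: ler_sum => i _; rewrite rowtruncS addrA.
have zb (th : R) : 0 <= th <= 1 -> `|y + rowtrunc k i + (th * k ord0 i) *: e_ i - y| <= `|k|.
  move=> /andP[t0 t1]; rewrite -[y + _ + _]addrA add_subK; apply: norm_rowtruncD.
  by rewrite normrM (ger0_norm t0) ler_piMl.
have [th t01 ->] := mvt_dir (fun th t01 => D i _ (zb th t01)).
rewrite -mulrBr normrM mulrC; apply: ler_pM => //; first exact: H (zb th t01).
exact: row_norm_coord.
Qed.

(* Continuity of the partial derivatives gives differentiability, hence the chain rule. *)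
Lemma chain_line (Om : set V) (f : V -> R) (x h : V) (t : R) : open Om -> Om (x + t *: h) ->
  is_Ck 1 Om f ->
  is_derive t (1 : R) (fun s : R => f (x + s *: h)) (\sum_i h ord0 i * partial i f (x + t *: h)).
Proof.
move=> oO Ox [_ f1]; set y := x + t *: h.
have [->|h0] := eqVneq h 0.
  have -> : (fun s : R => f (x + s *: 0)) = cst (f x) by apply/funext => s; rewrite scaler0 addr0.
  by apply: is_derive_eq; rewrite big1 // => i _; rewrite mxE mul0r.
have hp : 0 < `|h| by rewrite normr_gt0.
apply: (@is_derive_dist R^o) => ep ep0.
have [d0 d00 Hd0] := open_dist oO Ox.
have n1 : 0 < n%:R + 1 :> R by apply: ltr_wpDl.
have e0 : 0 < ep / ((n%:R + 1) * `|h|) by rewrite divr_gt0 // mulr_gt0.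
have Hc i : exists2 d : R, 0 < d & forall z, `|z - y| <= d -> `|partial i f z - partial i f y| <= ep / ((n%:R + 1) * `|h|).
  by apply: continuous_dist => //; have [_ [+ _]] := f1 i; apply.
have [d dP] : exists2 d : R, 0 < d <= d0 & forall i z, `|z - y| <= d -> `|partial i f z - partial i f y| <= ep / ((n%:R + 1) * `|h|).
  suff : forall l : seq 'I_n, exists2 d : R, 0 < d <= d0 & forall i, i \in l -> forall z, `|z - y| <= d ->
      `|partial i f z - partial i f y| <= ep / ((n%:R + 1) * `|h|).
    by move=> /(_ (enum 'I_n)) [d dP H]; exists d => // i; apply: H; rewrite mem_enum.
  elim=> [|i l [d /andP[d1 d2] IH]]; first by exists d0; rewrite ?d00 /=.
  have [d' d'0 Hd'] := Hc i; exists (Num.min d d').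
    by rewrite lt_min d1 d'0 ge_min d2.
  move=> j; rewrite in_cons => /orP[/eqP->|jl] z; rewrite le_min => /andP[zd zd'].
    exact: Hd'.
  exact: IH.
move=> Hd; have /andP[d1 d2] := dP; exists (d / `|h|); first by rewrite divr_gt0.
move=> s sd; have sh : `|s *: h| <= d by rewrite normrZ -ler_pdivlMr.
have -> : s *: (1 : R^o) = s by rewrite /GRing.scale /= mulr1.
rewrite scalerDl addrA -/y.
have -> : s * (\sum_i h ord0 i * partial i f y) = \sum_i (s *: h) ord0 i * partial i f y.
  by rewrite mulr_sumr; apply: eq_bigr => i _; rewrite mxE mulrA.
apply: le_trans (@increment_bound f y (s *: h) (ep / ((n%:R + 1) * `|h|)) _ _) _.
- by move=> i z zy; have [+ _] := f1 i; apply; apply: Hd0; apply: (le_trans zy); exact: le_trans sh d2.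
- by move=> i z zy; apply: Hd; exact: le_trans sh.
rewrite normrZ.
have -> : n%:R * (ep / ((n%:R + 1) * `|h|)) * (`|s| * `|h|) = n%:R / (n%:R + 1) * (ep * `|s|).
  by field; rewrite !gt_eqF.
rewrite ler_piMl ?ler_pdivrMr // ?mul1r ?lerDl //.
by rewrite mulr_ge0 // ltW.
Qed.

Lemma derive_shift (g : V -> R) (w z v : V) : derivable g (z + w) v ->
  is_derive z v (fun y => g (y + w)) ('D_v g (z + w)).
Proof.
have E : (fun h : R => h^-1 *: (((fun y => g (y + w)) \o shift z) (h *: v) - g (z + w))) =
    (fun h : R => h^-1 *: ((g \o shift (z + w)) (h *: v) - g (z + w))).
  by apply/funext => h /=; rewrite addrA.
by move=> D; apply: DeriveDef; rewrite /derivable /derive E.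
Qed.

Lemma second_difference (g : V -> R) (i j : 'I_n) (x : V) (t : R) : 0 <= t ->
  (forall z, `|z - x| <= 2 * t -> derivable g z (e_ i) /\ derivable (partial i g) z (e_ j)) ->
  exists2 z, `|z - x| <= 2 * t &
    g (x + t *: e_ i + t *: e_ j) - g (x + t *: e_ i) - (g (x + t *: e_ j) - g x) =
    t ^+ 2 * partial j (partial i g) z.
Proof.
move=> t0 D.
have te k th : 0 <= th <= 1 -> `|(th * t) *: e_ k| <= t.
  move=> /andP[a0 a1]; rewrite normrZ norm_delta mulr1 ger0_norm ?mulr_ge0 //.
  by rewrite ler_piMl.
have b0 th : 0 <= th <= 1 -> `|x + (th * t) *: e_ i - x| <= 2 * t.
  by move=> /te h; rewrite addrAC subrr add0r; apply: le_trans (h _) _; lra.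
have b1 th th' : 0 <= th <= 1 -> 0 <= th' <= 1 -> `|x + (th * t) *: e_ i + (th' * t) *: e_ j - x| <= 2 * t.
  move=> /te h /te h'; rewrite -[x + _ + _]addrA add_subK; apply: le_trans (ler_normD _ _) _.
  by have := h i; have := h' j; lra.
have one : (0 : R) <= 1 <= (1 : R) by rewrite ler01 /=.
have dF th : 0 <= th <= 1 -> is_derive (x + (th * t) *: e_ i) (e_ i) (fun y => g (y + t *: e_ j) - g y)
    (partial i g (x + (th * t) *: e_ i + t *: e_ j) - partial i g (x + (th * t) *: e_ i)).
  move=> th01; have [d1 _] := D _ (b0 th th01); have [d2 _] := D _ (b1 th 1 th01 one).
  rewrite mul1r in d2; have D2 := derive_shift d2; have D1 := DeriveDef d1 erefl.
  exact: is_deriveB.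
have [th th01] := @mvt_dir (fun y => g (y + t *: e_ j) - g y) (e_ i) x t (fun th th01 => let: DeriveDef e _ := dF th th01 in e).
have [_ ->] := dF th th01 => ->.
have [th' th'01 ->] := @mvt_dir (partial i g) (e_ j) (x + (th * t) *: e_ i) t (fun th' h => (D _ (b1 th th' th01 h)).2).
by exists (x + (th * t) *: e_ i + (th' * t) *: e_ j); [exact: b1|rewrite mulrA expr2].
Qed.

Lemma close2 (a b c e : R) : `|c - a| <= e / 2 -> `|c - b| <= e / 2 -> `|a - b| <= e.
Proof. by rewrite !ler_norml => /andP[? ?] /andP[? ?]; apply/andP; split; lra. Qed.

(** Schwarz's theorem. The second difference is symmetric in i and j, so the two mixed derivatives
    take a common value at points arbitrarily close to [x]; continuity concludes. *)
Lemma partialC (Om : set V) (g : V -> R) (i j : 'I_n) (x : V) : open Om -> is_Ck 2 Om g -> Om x ->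
  partial i (partial j g) x = partial j (partial i g) x.
Proof.
move=> oO [_ g2] Ox; have [d0 d00 Hd0] := open_dist oO Ox.
have D k l z : Om z -> derivable g z (e_ k) /\ derivable (partial k g) z (e_ l).
  by move=> Oz; have [h1 [_ /(_ l) [h2 _]]] := g2 k; split; [apply: h1|apply: h2].
have C k l : {for x, continuous (partial l (partial k g))}.
  by have [_ [_ /(_ l) [_ [h _]]]] := g2 k; apply: h.
apply/eqP; rewrite -subr_eq0 -normr_le0; apply/ler_addgt0Pr => ep ep0; rewrite add0r.
have ep2 : 0 < ep / 2 by rewrite divr_gt0.
have [d1 d10 H1] := continuous_dist (C j i) ep2.
have [d2 d20 H2] := continuous_dist (C i j) ep2.
have [t [t0 td0 td1 td2]] : exists t : R, [/\ 0 < t, 2 * t <= d0, 2 * t <= d1 & 2 * t <= d2].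
  exists (Num.min d0 (Num.min d1 d2) / 2).
  have -> : 2 * (Num.min d0 (Num.min d1 d2) / 2) = Num.min d0 (Num.min d1 d2) by field.
  by split; rewrite ?ge_min ?lexx ?orbT // divr_gt0 // !lt_min d00 d10 d20.
have Db k l z : `|z - x| <= 2 * t -> derivable g z (e_ k) /\ derivable (partial k g) z (e_ l).
  by move=> zt; apply: D; apply: Hd0; exact: le_trans td0.
have [z1 zb1 E1] := @second_difference g j i x t (ltW t0) (Db j i).
have [z2 zb2 E2] := @second_difference g i j x t (ltW t0) (Db i j).
have E : partial i (partial j g) z1 = partial j (partial i g) z2.
  apply: (@mulfI _ (t ^+ 2)); first by rewrite expf_neq0 // gt_eqF.
  apply: etrans (esym E1) (etrans _ E2); rewrite [x + t *: e_ j + _]addrAC.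
  by move: (g _) (g (x + t *: e_ j)) (g (x + t *: e_ i)) (g x) => a b c d; ring.
have h1 := H1 z1 (le_trans zb1 td1); have h2 := H2 z2 (le_trans zb2 td2); rewrite E in h1.
exact: close2 h1 h2.
Qed.

End Lines.

Section Words.
Context {R : realType} {n : nat}.
Local Notation V := 'rV[R]_n.
Local Notation e_ i := (delta_mx ord0 i : V).

(** Words record derivatives in the order in which Taylor's formula produces them, whereas
    [mpartial] follows the enumeration of the variables; [word_perm] identifies the two. *)
Definition wpartial (w : seq 'I_n) (f : V -> R) : V -> R := foldr (@partial R n) f w.

Lemma Ck_pred k (Om : set V) (f : V -> R) : is_Ck k.+1 Om f -> is_Ck k Om f.
Proof.
elim: k f => [|k IH] f [c H]; first by split.
by split => // i; have [d /IH h] := H i.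
Qed.

Lemma Ck_le k m (Om : set V) (f : V -> R) : (k <= m)%N -> is_Ck m Om f -> is_Ck k Om f.
Proof. by move=> /subnK <-; elim: (m - k)%N => // d IH; rewrite addSn => /Ck_pred. Qed.

Lemma Ck_word k (Om : set V) w (f : V -> R) : is_Ck (size w + k) Om f -> is_Ck k Om (wpartial w f).
Proof.
elim/last_ind: w f => // w i IH f; rewrite size_rcons /wpartial foldr_rcons => -[_ /(_ i) [_ h]].
exact: IH.
Qed.

Lemma partial_ext (Om : set V) (f g : V -> R) i x : open Om -> (forall y, Om y -> f y = g y) -> Om x ->
  partial i f x = partial i g x.
Proof.
move=> oO fg Ox; apply: near_eq_derive.
by have := open_nbhs_nbhs (conj oO Ox); apply: filterS.
Qed.

Lemma word_move (Om : set V) (f : V -> R) i u v x : open Om -> is_Ck (size (u ++ v)).+1 Om f -> Om x ->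
  wpartial (i :: u ++ v) f x = wpartial (u ++ i :: v) f x.
Proof.
move=> oO; elim: u x => [|j u IH] x // C Ox.
have CW : is_Ck 2 Om (wpartial (u ++ v) f) by apply: Ck_word; rewrite addn2.
apply: (etrans (partialC i j oO CW Ox)).
by apply: (partial_ext _ oO) => // y Oy; apply: IH => //; exact: Ck_pred C.
Qed.

Lemma word_perm (Om : set V) (f : V -> R) w w' x : open Om -> perm_eq w w' -> is_Ck (size w) Om f -> Om x ->
  wpartial w f x = wpartial w' f x.
Proof.
move=> oO; elim: w w' x => [|i w IH] w' x pw C Ox.
  by move: pw; rewrite perm_sym => /perm_nilP ->.
have : i \in w' by rewrite -(perm_mem pw) mem_head.
move=> iw; case/splitPr: iw pw => u v pw.
have pw' : perm_eq w (u ++ v).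
  by rewrite -(perm_cons i); apply: (perm_trans pw); rewrite -cat1s perm_catCA.
have Cm : is_Ck (size (u ++ v)).+1 Om f by rewrite -(perm_size pw').
apply: (etrans _ (word_move i oO Cm Ox)).
by apply: (partial_ext _ oO) => // y Oy; apply: IH => //; exact: Ck_pred C.
Qed.

Lemma mpartial_word (beta : 'I_n -> nat) (f : V -> R) :
  mpartial beta f = wpartial (flatten [seq nseq (beta i) i | i <- enum 'I_n]) f.
Proof.
rewrite /mpartial /wpartial; elim: (enum 'I_n) => //= i l ->; rewrite foldr_cat.
by elim: (beta i) => //= m ->.
Qed.

Lemma perm_sorted_word (w : seq 'I_n) :
  perm_eq w (flatten [seq nseq (count_mem i w) i | i <- enum 'I_n]).
Proof.
apply/allP => j _ /=; rewrite count_flatten -map_comp sumnE big_map big_enum /=.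
rewrite (bigD1 j) //= big1 ?addn0 => [|i ij]; last by rewrite count_nseq /= (negbTE ij).
by rewrite count_nseq /= eqxx mul1n.
Qed.

Lemma mdegree_count (w : seq 'I_n) : mdegree (fun i => count_mem i w) = size w.
Proof.
rewrite (perm_size (perm_sorted_word w)) size_flatten /shape -map_comp sumnE big_map big_enum /=.
by apply: eq_bigr => i _; rewrite size_nseq.
Qed.

End Words.

Section Taylor.
Context {R : realType} {n : nat}.
Local Notation V := 'rV[R]_n.
Local Notation e_ i := (delta_mx ord0 i : V).

Definition jet_deg (p : nat) (J : @jet R n) : Prop :=
  [/\ (p < 3)%N -> forall u v w, jt J u v w = 0, (p < 2)%N -> forall u v, jq J u v = 0 &
      (p < 1)%N -> forall u, jl J u = 0].

Lemma linr_coord (c : 'I_n -> R) (k : R) : linr (fun u : V => k * \sum_i u ord0 i * c i).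
Proof.
move=> a u v; rewrite mulrCA -mulrDr; congr (_ * _); rewrite mulr_sumr -big_split /=.
by apply: eq_bigr => i _; rewrite !mxE; ring.
Qed.

Lemma linr_comb (c : 'I_n -> R) (k : R) (l : 'I_n -> V -> R) : (forall i, linr (l i)) ->
  linr (fun v : V => k * \sum_i c i * l i v).
Proof.
move=> ll a u v; rewrite mulrCA -mulrDr; congr (_ * _); rewrite mulr_sumr -big_split /=.
by apply: eq_bigr => i _; rewrite ll; ring.
Qed.

Lemma linr_zero : linr (fun _ : V => 0 : R).
Proof. by move=> c u v; rewrite mulr0 addr0. Qed.

Definition jet0 : @jet R n := @Jet R n (fun=> 0) (fun _ _ => 0) (fun _ _ _ => 0) linr_zero
  (fun=> linr_zero) (fun=> linr_zero) (fun _ _ => linr_zero) (fun _ _ => linr_zero) (fun _ _ => linr_zero).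

(* The jet whose derivative along h is sum_i h_i (a_i + J_i), up to the cubic terms of J_i. *)
Definition int_jet (a : 'I_n -> R) (J : 'I_n -> @jet R n) : @jet R n :=
  @Jet R n (fun u => 1 * \sum_i u ord0 i * a i)
    (fun u v => 2^-1 * \sum_i u ord0 i * jl (J i) v)
    (fun u v w => 3^-1 * \sum_i u ord0 i * jq (J i) v w)
    (linr_coord a 1)
    (fun v => linr_coord (fun i => jl (J i) v) _)
    (fun u => linr_comb (fun i => u ord0 i) _ (fun i => jl_lin (J i)))
    (fun v w => linr_coord (fun i => jq (J i) v w) _)
    (fun u w => linr_comb (fun i => u ord0 i) _ (fun i => jq_lin1 (J i) w))
    (fun u v => linr_comb (fun i => u ord0 i) _ (fun i => jq_lin2 (J i) v)).

Lemma is_derive_cubic (a b c t : R) :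
  is_derive t (1 : R) (fun t : R => t * a + t ^+ 2 * b + t ^+ 3 * c) (a + 2 * t * b + 3 * t ^+ 2 * c).
Proof. apply: is_derive_eq; rewrite /GRing.scale /=; by ring. Qed.

(** Along the segment from [x] to [x + h], the difference of [f] and the integrated jet has as
    derivative the sum of h_i times the remainders of the partial derivatives. The mean value
    theorem then gains one order. Since [p < 3] the jets of the derivatives have no cubic part, so
    no quartic term is lost. *)
Lemma integrate_jet (Om : set V) (f : V -> R) (x : V) (p : nat) (rho M sg : R) : open Om -> is_Ck 1 Om f ->
  (forall h, `|h| <= rho -> Om (x + h)) -> (p < 3)%N -> 0 <= M -> 0 <= sg ->
  (forall i, exists J : @jet R n, jet_deg p J /\ forall h, `|h| <= rho ->
    `|partial i f (x + h) - partial i f x - tay J h| <= M * `|h| `^ sg) ->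
  exists J : @jet R n, jet_deg p.+1 J /\ forall h, `|h| <= rho ->
    `|f (x + h) - f x - tay J h| <= n%:R * M * `|h| `^ (sg + 1).
Proof.
move=> oO C Ob p3 M0 sg0 /boolp.choice [J HJ].
exists (int_jet (fun i => partial i f x) J); split.
  split => [p2 u v w|p1 u v|//] /=; rewrite big1 ?mulr0 // => i _; have [[_ h1 h2] _] := HJ i.
    by rewrite h1 ?mulr0.
  by rewrite h2 ?mulr0.
move=> h hr; set T := int_jet _ _.
have tr (t : R) : 0 <= t <= 1 -> `|t *: h| <= `|h|.
  by move=> /andP[t0 t1]; rewrite normrZ ger0_norm // ler_piMl.
have trO (t : R) : 0 <= t <= 1 -> Om (x + t *: h).
  by move=> /tr th; apply: Ob; apply: le_trans th hr.
pose phi (t : R) := f (x + t *: h) - (t * jl T h + t ^+ 2 * jq T h h + t ^+ 3 * jt T h h h).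
pose dphi (t : R) := \sum_i h ord0 i * partial i f (x + t *: h) - (jl T h + 2 * t * jq T h h + 3 * t ^+ 2 * jt T h h h).
have dphiP (t : R) : 0 <= t <= 1 -> is_derive t (1 : R) phi (dphi t).
  by move=> t01; apply: is_deriveB; [exact: chain_line oO (trO t t01) C|exact: is_derive_cubic].
have dphiE t : 0 <= t <= 1 -> dphi t = \sum_i h ord0 i * (partial i f (x + t *: h) - partial i f x - tay (J i) (t *: h)).
  move=> t01; under [RHS]eq_bigr => i _.
    have [[jt0 _ _] _] := HJ i; rewrite tayZ jt0 // mulr0 addr0.
    have -> : h ord0 i * (partial i f (x + t *: h) - partial i f x - (t * jl (J i) h + t ^+ 2 * jq (J i) h h)) =
      h ord0 i * partial i f (x + t *: h) - (h ord0 i * partial i f x + t * (h ord0 i * jl (J i) h) + t ^+ 2 * (h ord0 i * jq (J i) h h)).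
      by ring.
    over.
  rewrite sumrB !big_split /= -!mulr_sumr /dphi /=; by field.
have bd (t : R) : 0 <= t <= 1 -> `|dphi t| <= n%:R * M * `|h| `^ (sg + 1).
  move=> t01; rewrite dphiE //; apply: le_trans (ler_norm_sum _ _ _) _.
  rewrite powR_addn // ?powRr1 //; last by rewrite gt_eqF // ltr_wpDl.
  have -> : n%:R * M * (`|h| `^ sg * `|h|) = \sum_(i < n) `|h| * (M * `|h| `^ sg).
    by rewrite sumr_const card_ord -mulr_natl; ring.
  apply: ler_sum => i _; rewrite normrM; apply: ler_pM => //; first exact: row_norm_coord.
  have [_ Hi] := HJ i; apply: le_trans (Hi _ (le_trans (tr t t01) hr)) _.
  by apply: ler_wpM2l => //; apply: powR_mono => //; exact: tr.
have [||th] := @MVT _ phi dphi 0 1 ltr01.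
- by move=> t; rewrite in_itv /= => /andP[t0 t1]; apply: dphiP; rewrite !ltW.
- apply: derivable_within_continuous => t; rewrite in_itv /= => t01.
  by have [] := dphiP t t01.
rewrite in_itv /= => /andP[t0 t1]; rewrite subr0 mulr1 => E.
have -> : f (x + h) - f x - tay T h = dphi th.
  by rewrite -E /phi scale1r scale0r addr0 /tay; ring.
by apply: bd; rewrite !ltW.
Qed.

Lemma taylor_jet (Om Q : set V) (x : V) (rho M al : R) (p : nat) (f : V -> R) : open Om -> Q `<=` Om ->
  (forall h, `|h| <= rho -> Q (x + h)) -> 0 <= rho -> 0 <= M -> 0 < al -> (p <= 3)%N -> is_Ck p Om f ->
  (forall w, size w = p -> forall y z, Q y -> Q z -> `|wpartial w f y - wpartial w f z| <= M * `|y - z| `^ al) ->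
  exists J : @jet R n, jet_deg p J /\ forall h, `|h| <= rho ->
    `|f (x + h) - f x - tay J h| <= n%:R ^+ p * M * `|h| `^ (al + p%:R).
Proof.
move=> oO QO Qb rho0 M0 al0; elim: p f => [|p IH] f p3 C H.
  exists jet0; split=> [|h hr]; first by split.
  rewrite /tay /= !addr0 subr0 expr0 mul1r; apply: le_trans (H [::] erefl (x + h) x _ _) _.
  - exact: Qb.
  - by rewrite -[x]addr0; apply: Qb; rewrite normr0.
  - by rewrite add_subK.
have [J [Jd HJ]] : exists J : @jet R n, jet_deg p.+1 J /\ forall h, `|h| <= rho ->
    `|f (x + h) - f x - tay J h| <= n%:R * (n%:R ^+ p * M) * `|h| `^ (al + p%:R + 1).
  apply: (integrate_jet oO (Ck_le _ C)) => //.
  - by move=> h hr; apply: QO; exact: Qb.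
  - by rewrite mulr_ge0 // exprn_ge0.
  - by rewrite addr_ge0 // ltW.
  move=> i; have [_ /(_ i) [_ Ci]] := C; apply: (IH _ (ltnW p3) Ci) => w wp y z Qy Qz.
  by have := H (rcons w i); rewrite size_rcons wp /wpartial foldr_rcons => /(_ erefl y z Qy Qz).
by exists J; split => // h hr; rewrite exprS -[n%:R * _ * M]mulrA -natr1 addrA; exact: HJ.
Qed.
End Taylor.

(** * Decomposition on open sets *)

Section Compact.
Context {R : realType} {n : nat}.
Local Notation V := 'rV[R]_n.
Local Notation e_ i := (delta_mx ord0 i : V).

Lemma norm_le_enorm (x : V) : `|x| <= enorm x.
Proof.
apply: row_norm_le; first exact: sqrtr_ge0.
move=> i; rewrite -sqrtr_sqr /enorm ler_sqrt ?sumr_ge0 // => [|j _]; last exact: sqr_ge0.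
by rewrite (bigD1 i) //= lerDl sumr_ge0 // => j _; exact: sqr_ge0.
Qed.

Lemma enorm_le_norm (x : V) : enorm x <= n%:R * `|x|.
Proof.
rewrite -(@ler_pXn2r _ 2%N) ?nnegrE ?sqrtr_ge0 ?mulr_ge0 //.
rewrite /enorm sqr_sqrtr ?sumr_ge0 // => [|i _]; last exact: sqr_ge0.
apply: (@le_trans _ _ (n%:R * `|x| ^+ 2)).
  rewrite mulr_natl -[X in _ *+ X](card_ord n) -sumr_const.
  apply: ler_sum => i _; rewrite -real_normK ?num_real // ler_pXn2r ?nnegrE //.
  exact: row_norm_coord.
rewrite exprMn; apply: ler_wpM2r; first exact: exprn_ge0.
by rewrite -natrX ler_nat; case: (n) => // m; rewrite leq_pmulr.
Qed.

Lemma nbhs_cube (x : V) (r : R) : 0 < r -> nbhs x [set w | `|w - x| <= r].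
Proof.
move=> r0; apply: filterS (nbhsx_ballx x r r0) => y.
by rewrite -ball_normE /= distrC; exact: ltW.
Qed.

(** Near each point the property holds for all large constants; compactness as near-covering, with
    the filter at infinity for the constant, yields a common one. *)
Lemma compact_uniform (K : set V) (P : R -> V -> Prop) : compact K ->
  (forall x, K x -> exists r C0 : R, 0 < r /\ forall C w, C0 <= C -> `|w - x| <= r -> P C w) ->
  exists2 C : R, 0 < C & forall w, K w -> P C w.
Proof.
move=> /compact_near_coveringP cK H.
have [] := cK R +oo%R P _ _.
  move=> x Kx; have [r [C0 [r0 HC]]] := H x Kx.
  exists ([set w | `|w - x| <= r], [set C | C0 <= C]) => /=.
    split; last by apply: nbhs_pinfty_ge; rewrite num_real.
    exact: nbhs_cube.
  by move=> [w C] /= [wr CC]; exact: HC.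
move=> C [Cr HC]; exists (Num.max C 0 + 1); first by rewrite ltr_wpDl // le_max lexx orbT.
by apply: HC; rewrite ltr_pwDr // le_max lexx.
Qed.

Lemma compact_cube (x : V) (r : R) : 0 < r -> compact [set y | `|y - x| <= r].
Proof.
move=> r0; apply: bounded_closed_compact.
  exists (`|x| + r); split; first exact: num_real.
  move=> M xM y /= yr; rewrite -[y](subrK x); apply: le_trans (ler_normD _ _) _.
  by rewrite addrC; apply: le_trans (lerD (lexx _) yr) _; exact: ltW.
have -> : [set y | `|y - x| <= r] = closed_ball x r.
  by rewrite closed_ballE //; apply/seteqP; split => y; rewrite /closed_ball_ /= distrC.
exact: closed_ball_closed.
Qed.

Lemma word_holder (k : nat) (al : R) (Om Q : set V) (f : V -> R) : open Om -> 0 < al <= 1 ->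
  holder_loc k al Om f -> compact Q -> Q `<=` Om ->
  exists2 M : R, 0 <= M & forall w : seq 'I_n, size w = k -> forall y z, Q y -> Q z ->
    `|wpartial w f y - wpartial w f z| <= M * `|y - z| `^ al.
Proof.
move=> oO /andP[al0 al1] [C H] cQ QO.
have Hw (t : k.-tuple 'I_n) : exists M : R, forall y z, Q y -> Q z ->
    `|wpartial t f y - wpartial t f z| <= M * `|y - z| `^ al.
  have [|M HM] := H Q cQ QO (fun i => count_mem i t); first by rewrite mdegree_count size_tuple.
  exists (`|M| * n%:R `^ al) => y z Qy Qz.
  have [->|yz] := eqVneq y z; first by rewrite subrr normr0 mulr_ge0 ?mulr_ge0 ?powR_ge0.
  have yz0 : 0 < `|y - z| by rewrite normr_gt0 subr_eq0.
  have e0 : 0 < enorm (y - z) by apply: lt_le_trans (norm_le_enorm _).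
  have ep := powR_gt0 al e0.
  have E u : Q u -> wpartial t f u = mpartial (fun i => count_mem i t) f u.
    move=> Qu; rewrite mpartial_word; apply: (word_perm oO (perm_sorted_word t)); last exact: QO.
    by rewrite size_tuple.
  have : `|mpartial (fun i => count_mem i t) f y - mpartial (fun i => count_mem i t) f z| / enorm (y - z) `^ al <= M.
    by apply: HM; exists y, z.
  rewrite -!E // ler_pdivrMr // => h; apply: le_trans h _.
  rewrite -mulrA -powRM //; apply: (@le_trans _ _ (`|M| * enorm (y - z) `^ al)).
    by apply: ler_wpM2r; [exact: ltW|exact: ler_norm].
  apply: ler_wpM2l => //; apply: powR_mono; [exact: ltW|exact: ltW|exact: enorm_le_norm].
have /boolp.choice[M HM] := Hw; exists (\sum_t `|M t|); first by apply: sumr_ge0.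
move=> w /eqP wk y z Qy Qz; apply: le_trans (HM (Tuple wk) y z Qy Qz) _.
apply: ler_wpM2r; first exact: powR_ge0.
by rewrite (bigD1 (Tuple wk)) //=; apply: le_trans (ler_norm _) _; rewrite lerDl sumr_ge0.
Qed.

Lemma locally_bounded (Q : set V) (f : V -> R) : compact Q -> (forall x, Q x -> {for x, continuous f}) ->
  exists2 B : R, 0 < B & forall x, Q x -> `|f x| <= B.
Proof.
move=> cQ Cf; apply: (@compact_uniform Q (fun B x => `|f x| <= B)) => // x Qx.
have [d d0 Hd] := continuous_dist (Cf x Qx) ltr01.
exists d, (`|f x| + 1); split => // B w BC wx.
by rewrite -[f w](subrK (f x)) addrC; apply: le_trans (ler_normD _ _) (le_trans (lerD (lexx _) (Hd w wx)) BC).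
Qed.

(** [c] is the inverse of a bound for [f] on the cube of radius 2 t plus the Taylor constant
    measured at the scale t, the two quantities that [unit_hyp] normalises. *)
Lemma unit_scaling (k : nat) (al : R) (Om : set V) (f : V -> R) (y : V) (t : R) : open Om -> 0 < al <= 1 ->
  (k <= 3)%N -> holder_loc k al Om f -> (forall x, Om x -> 0 <= f x) -> 0 < t ->
  (forall w, `|w - y| <= 2 * t -> Om w) ->
  exists2 c : R, 0 < c & unit_hyp (al + k%:R) (fun u => c * f (y + t *: u)).
Proof.
move=> oO al01 k3 hf f0 t0 Ob; have [Cf _] := hf; have /andP[al0 al1] := al01.
have cQ := @compact_cube y (2 * t) (mulr_gt0 (ltr0Sn R 1) t0).
have QO : [set w | `|w - y| <= 2 * t] `<=` Om by [].
have [B B0 HB] := locally_bounded cQ (fun x Qx => (Ck_le (leq0n k) Cf).1 x (QO x Qx)).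
have [M M0 HM] := word_holder oO al01 hf cQ QO.
have s0 : 0 <= al + k%:R by rewrite addr_ge0 // ltW.
have [C CE] : {C | n%:R ^+ k * M * t `^ (al + k%:R) = C} by exists (n%:R ^+ k * M * t `^ (al + k%:R)).
have C0 : 0 <= C by rewrite -CE !mulr_ge0 ?exprn_ge0 ?powR_ge0.
have BC : 0 < B + C by apply: ltr_pwDl.
exists (B + C)^-1; first by rewrite invr_gt0.
have nt (u : V) : `|t *: u| = t * `|u| by rewrite normrZ gtr0_norm.
split => [u u2|x x1].
  have Qu : `|y + t *: u - y| <= 2 * t by rewrite add_subK nt mulrC; apply: ler_wpM2r => //; exact: ltW.
  have fu := f0 _ (QO _ Qu); rewrite mulr_ge0 ?invr_ge0 ?(ltW BC) //= mulrC ler_pdivrMr // mul1r.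
  apply: le_trans (ler_norm _) (le_trans (HB _ Qu) _); by rewrite lerDl.
have Qb h : `|h| <= t -> `|y + t *: x + h - y| <= 2 * t.
  move=> ht; rewrite -[y + _ + _]addrA add_subK; apply: le_trans (ler_normD _ _) _.
  by rewrite nt mulrDl mul1r; apply: lerD => //; rewrite ler_piMr // ltW.
have [J [_ HJ]] := taylor_jet oO QO Qb (ltW t0) M0 al0 k3 Cf HM.
exists (jmap (B + C)^-1 (lin_scale t) J) => h h1; rewrite tay_jmap scalerDr addrA -!mulrBr normrM.
have th : `|t *: h| <= t by rewrite nt ler_piMr // ltW.
rewrite gtr0_norm ?invr_gt0 // mulrC ler_pdivrMr //; apply: le_trans (HJ _ th) _.
rewrite nt powRM ?(ltW t0) // mulrA CE mulrC; apply: ler_wpM2l; first exact: powR_ge0.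
by rewrite lerDr ltW.
Qed.

(** The sup-norm distance to the complement, cut at 1 so that it is finite when [Om] is the whole
    space. *)
Lemma open_radius (Om : set V) : open Om -> exists d : V -> R,
  [/\ forall x, Om x -> 0 < d x <= 1, forall x y, Om x -> `|y - x| < d x -> Om y &
     forall x y, Om x -> Om y -> d x <= d y + `|x - y|].
Proof.
move=> oO; pose S (x : V) := [set d : R | 0 <= d <= 1 /\ forall y, `|y - x| <= d -> Om y].
have S0 x : Om x -> S x 0.
  move=> Ox; split; first by rewrite lexx ler01.
  by move=> y; rewrite normr_le0 subr_eq0 => /eqP ->.
have Sb x : has_ubound (S x) by exists 1 => d [/andP[_ ?] _].
exists (fun x => sup (S x)); split => [x Ox|x y Ox yx|x y Ox Oy].
- apply/andP; split; last by apply: ge_sup; [exists 0; exact: S0|move=> d [/andP[_ ?] _]].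
  have [d d0 Hd] := open_dist oO Ox; apply: (@lt_le_trans _ _ (Num.min d 1)); first by rewrite lt_min d0 ltr01.
  apply: ub_le_sup => //; split; first by rewrite le_min ler01 (ltW d0) ge_min lexx orbT.
  by move=> y; rewrite le_min => /andP[/Hd].
- have [d [_ Hd] yd] := sup_gt (ex_intro _ 0 (S0 x Ox)) yx.
  by apply: Hd; exact: ltW.
- apply: ge_sup; first by exists 0; exact: S0.
  move=> d [/andP[d0 d1] Hd]; rewrite -lerBlDr.
  have [h|/ltW h] := leP (d - `|x - y|) 0.
    by apply: le_trans h _; apply: ub_le_sup => //; exact: S0.
  apply: ub_le_sup => //; split; first by rewrite h; apply: le_trans d1; rewrite lerBlDr lerDl.
  move=> z zy; apply: Hd; rewrite -(subrK y z) -addrA; apply: le_trans (ler_normD _ _) _.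
  by rewrite -lerBrDr [`|y - x|]distrC.
Qed.

End Compact.

Section OpenDecomp.
Context {R : realType} {n : nat}.
Local Notation V := 'rV[R]_n.
Local Notation e_ i := (delta_mx ord0 i : V).

Lemma cube_decomp (s : R) (m : nat) (C : R) (f : V -> R) (y : V) (t c : R) : 0 < s ->
  decomp_at (n := n) s n m C -> 0 < t -> 0 < c -> unit_hyp s (fun u => c * f (y + t *: u)) ->
  exists A (G : 'I_m -> V -> R), forall w, `|w - y| <= t / 4 ->
    f w = \sum_j G j w ^+ 2 /\ forall j, gap A (t / 4) (s / 2) (G j) w.
Proof.
move=> s0 dec t0 c0 hyp; have q4 : 0 < (4^-1 : R) by rewrite invr_gt0.
have card : (#|[set: 'I_n]%SET| <= n)%N by rewrite cardsT card_ord.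
have inv : inv_off [set: 'I_n]%SET 2 (fun u => c * f (y + t *: u)) by move=> i; rewrite inE.
have [g [gs gg]] := dec _ _ card hyp inv.
exists (`|(Num.sqrt c)^-1| * C), (fun j w => (Num.sqrt c)^-1 * g j (t^-1 *: (w - y))) => w wy.
have tn0 : t != 0 by rewrite gt_eqF.
have [u wE] : exists u, w = y + t *: u.
  by exists (t^-1 *: (w - y)); rewrite scalerA divff // scale1r addrC subrK.
have uE : t^-1 *: (w - y) = u by rewrite wE add_subK scalerA mulVf // scale1r.
have u4 : `|u| <= 4^-1.
  by rewrite -uE normrZ gtr0_norm ?invr_gt0 // mulrC ler_pdivrMr // mulrC.
split.
  under eq_bigr => j _ do rewrite exprMn uE.
  have u2 : `|u| <= 2^-1 by apply: le_trans u4 _; lra.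
  rewrite -mulr_sumr -gs // exprVn sqr_sqrtr ?(ltW c0) // -wE mulrA mulVf ?mul1r // gt_eqF //.
by move=> j; have := gap_scale (Num.sqrt c)^-1 y t0 q4 (gg j u u4); rewrite -wE.
Qed.

(** The constants of the local decompositions are not uniform in the point. [glue_squares] carries
    them along cell by cell, which suffices for local bounds. *)
Lemma open_decomp : (0 < n)%N -> exists2 m : nat, (0 < m)%N &
  forall (Om : set V) (k : nat) (al : R) (f : V -> R), open Om -> (2 <= k <= 3)%N -> 0 < al <= 1 ->
  holder_loc k al Om f -> (forall x, Om x -> 0 <= f x) ->
  exists g : 'I_m -> V -> R, (forall x, Om x -> f x = \sum_j g j x ^+ 2) /\
    forall j x, Om x -> exists r A : R, 0 < r <= 1 /\
      forall w, `|w - x| <= r -> gap A r ((al + k%:R) / 2) (g j) w.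
Proof.
move=> n0; have [m m0 dec] := @unit_decomp R n n n0.
have [Cg [cg [Cg0 /andP[cg0 cg1] glued]]] := glue_squares R n0.
exists #|{: @colour n * 'I_m}|.
  by case: m m0 {dec} => // m _; apply/card_gt0P; exists (ord0, [ffun=> ord0], ord0).
move=> Om k al f oO /andP[k2 k3] al01 hf f0; have /andP[al0 al1] := al01.
have s24 : 2 < al + k%:R <= 4.
  have h2 : (2 : R) <= k%:R by rewrite ler_nat.
  have h3 : k%:R <= (3 : R) by rewrite ler_nat.
  by apply/andP; split; lra.
have [C decC] := dec _ s24; have [sg1 sg02 s2] := half_exp s24.
have [d [dP dO dL]] := open_radius oO.
(* One quarter makes the cube of radius 2 (d x / 4), on which f is normalised, lie in [Om]; the
   other is the quarter of the unit cube where [decomp_at] gives expansions. *)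
pose rho (x : V) := d x / 4 / 4.
have rhoE x : d x = 16 * rho x by rewrite /rho; field.
have rho_pos x : Om x -> 0 < rho x <= 1.
  by move=> Ox; have /andP[h1 h2] := dP x Ox; rewrite rhoE in h1 h2; move: h1 h2; clear => h1 h2; apply/andP; split; lra.
have rho_slow x y : Om x -> Om y -> `|x - y| <= rho x -> rho y <= 2 * rho x /\ rho x <= 2 * rho y.
  move=> Ox Oy xy; have h1 := dL x y Ox Oy; have h2 := dL y x Oy Ox.
  rewrite distrC in h2; rewrite !rhoE in h1 h2; have /andP[r0 _] := rho_pos x Ox.
  by move: xy h1 h2 r0; move: `|x - y| (rho x) (rho y); clear => a b c; split; lra.
have Gex y : exists AG : R * ('I_m -> V -> R), Om y -> forall w, `|w - y| <= rho y ->
    f w = \sum_j AG.2 j w ^+ 2 /\ forall j, gap AG.1 (rho y) ((al + k%:R) / 2) (AG.2 j) w.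
  have [Oy|nO] := boolp.pselect (Om y); last by exists (0, fun _ _ => 0).
  have /andP[d0 d1] := dP y Oy; have t0 : 0 < d y / 4 by rewrite divr_gt0.
  have Ob w : `|w - y| <= 2 * (d y / 4) -> Om w.
    by move=> wy; apply: (dO y) => //; apply: le_lt_trans wy _; move: d0; clear; lra.
  have [c c0 hyp] := unit_scaling oO al01 k3 hf f0 t0 Ob.
  have s0 : 0 < al + k%:R by exact: ltr_wpDr.
  have [A [G HG]] := cube_decomp s0 decC t0 c0 hyp.
  by exists (A, G).
have /boolp.choice[AG HAG] := Gex.
have [g [gs gg]] := glued Om rho rho_pos rho_slow m _ f (fun y => (AG y).2) (fun y => (AG y).1) sg02
  (fun y Oy w wy => proj1 (HAG y Oy w wy)) (fun y Oy j w wy => proj2 (HAG y Oy w wy) j).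
exists (fun i => g (enum_val i)); split => [x Ox|i x Ox]; first by rewrite gs // sum_enum_val.
have Ub w : `|w - x| <= rho x -> Om w.
  move=> wx; apply: (dO x) => //; apply: le_lt_trans wx _; rewrite rhoE.
  by have /andP[r0 _] := rho_pos x Ox; move: r0; clear; lra.
have [y _ gy] := gg x Ox Ub (enum_val i); have /andP[r0 r1] := rho_pos x Ox.
exists (cg * rho x), (Cg * (AG y).1); split => //.
by rewrite mulr_gt0 //= mulr_ile1 // ltW.
Qed.

End OpenDecomp.

(** * From pointwise expansions to Hoelder classes *)

Section Regularity.
Context {R : realType} {n : nat}.
Local Notation V := 'rV[R]_n.
Local Notation e_ i := (delta_mx ord0 i : V).

Lemma holder_quotients_ub (K : set V) (ga M : R) (p : V -> R) : 0 <= ga -> 0 <= M ->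
  (forall x y, K x -> K y -> `|p x - p y| <= M * `|x - y| `^ ga) ->
  has_ubound (holder_quotients ga K p).
Proof.
move=> ga0 M0 H; exists M => _ [x [y [Kx Ky xy ->]]].
have xy0 : 0 < `|x - y| by rewrite normr_gt0 subr_eq0.
have e0 : 0 < enorm (x - y) by apply: lt_le_trans (norm_le_enorm _).
rewrite ler_pdivrMr ?powR_gt0 //; apply: le_trans (H x y Kx Ky) _.
by apply: ler_wpM2l => //; apply: powR_mono => //; exact: norm_le_enorm.
Qed.

Lemma locally_holder_ub (K : set V) (ga : R) (p : V -> R) : compact K -> 0 < ga ->
  (forall x, K x -> exists r C : R, 0 < r /\ forall w w', `|w - x| <= r -> `|w' - x| <= r ->
    `|p w - p w'| <= C * `|w - w'| `^ ga) ->
  has_ubound (holder_quotients ga K p).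
Proof.
move=> cK ga0 H.
have [x Kx|C C0 HC] := @compact_uniform _ _ K (fun C w => `|p w| <= C /\
    forall w', `|w' - w| <= C^-1 -> `|p w - p w'| <= C * `|w - w'| `^ ga) cK.
  have [r [C [r0 HC]]] := H x Kx.
  have rp := powR_ge0 r ga.
  have a1 : 0 <= `|C| * r `^ ga by exact: mulr_ge0.
  have a2 : 0 < 2 / r by exact: divr_gt0.
  exists (r / 2), (`|p x| + `|C| * r `^ ga + `|C| + 2 / r); split; first by rewrite divr_gt0.
  move=> B w B0 wx; have wr : `|w - x| <= r by apply: le_trans wx _; lra.
  have nC := normr_ge0 C; have npx := normr_ge0 (p x).
  split.
    have xx : `|x - x| <= r by rewrite subrr normr0 ltW.
    have h1 := HC w x wr xx.
    have h2 : C * `|w - x| `^ ga <= `|C| * r `^ ga.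
      apply: le_trans (ler_wpM2r (powR_ge0 _ _) (ler_norm C)) _.
      by apply: ler_wpM2l => //; apply: powR_mono => //; exact: ltW.
    rewrite -[p w](subrK (p x)); apply: le_trans (ler_normD _ _) _.
    by move: h1 h2 B0 nC a1 a2; clear; lra.
  move=> w' w'w; have B1 : 2 / r <= B by move: B0 nC a1 npx; clear; lra.
  have Bp : 0 < B by apply: lt_le_trans B1.
  have w'r : `|w' - x| <= r.
    rewrite -(subrK w w') -addrA; apply: le_trans (ler_normD _ _) _.
    have : B^-1 <= r / 2 by rewrite -[r / 2]invrK lef_pV2 ?posrE ?invr_gt0 ?divr_gt0 // invf_div.
    by move: w'w wx; clear; lra.
  apply: le_trans (HC w w' wr w'r) _; apply: ler_wpM2r; first exact: powR_ge0.
  by apply: le_trans (ler_norm _) _; move: B0 npx a1 a2; clear; lra.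
apply: (@holder_quotients_ub K ga (C + 2 * C * C `^ ga)); first exact: ltW.
  by rewrite addr_ge0 ?mulr_ge0 ?powR_ge0 // ltW.
move=> x y Kx Ky; have [px Hx] := HC x Kx; have [py _] := HC y Ky.
have xyp := powR_ge0 `|x - y| ga; have Cp := powR_ge0 C ga.
have [xy|/ltW xy] := leP `|y - x| C^-1.
  apply: le_trans (Hx y xy) _; apply: ler_wpM2r => //.
  by rewrite lerDl !mulr_ge0 // ltW.
apply: (@le_trans _ _ (2 * C)); first by apply: le_trans (ler_normB _ _) _; rewrite mulrDl mul1r lerD.
have h : 1 <= C `^ ga * `|x - y| `^ ga.
  have h1 : 1 <= C * `|x - y| by rewrite mulrC -ler_pdivrMr // div1r distrC.
  by have := powR_mono (ltW ga0) ler01 h1; rewrite powR1 powRM // ltW.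
rewrite [leRHS]mulrDl; apply: (@le_trans _ _ (2 * C * C `^ ga * `|x - y| `^ ga)); last first.
  by rewrite lerDr mulr_ge0 // ltW.
by rewrite -[leRHS]mulrA ler_peMr // mulr_ge0 // ltW.
Qed.

Lemma holder_continuous (U : normedModType R) (p : U -> R) (x : U) (r C ga : R) : 0 < r -> 0 < ga ->
  (forall w, `|w - x| <= r -> `|p w - p x| <= C * `|w - x| `^ ga) -> {for x, continuous p}.
Proof.
move=> r0 ga0 H; apply/cvgrPdist_le => ep ep0.
have C1 : 0 < `|C| + 1 by rewrite ltr_wpDl.
have e1 : 0 < ep / (`|C| + 1) by rewrite divr_gt0.
have [d /andP[d0 _] Hd] := powR_small ga0 e1.
have m0 : 0 < Num.min r d by rewrite lt_min r0.
near=> w; have : `|x - w| < Num.min r d by near: w; exact: cvgr_dist_lt.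
rewrite distrC lt_min => /andP[/ltW wr /ltW wd].
rewrite distrC; apply: le_trans (H w wr) _.
have := Hd `|w - x|; rewrite normr_ge0 wd => /(_ isT); rewrite ler_pdivlMr // => h.
apply: le_trans h; rewrite mulrC; apply: ler_wpM2l; first exact: powR_ge0.
by apply: le_trans (ler_norm _) _; rewrite lerDl.
Unshelve. all: by end_near.
Qed.

Lemma gap_derive (g : V -> R) (w : V) (A r ga : R) (l : V -> R) : 0 < r -> 0 < ga -> 0 <= A -> linr l ->
  (forall h, `|h| <= r -> `|g (w + h) - g w - l h| <= A * (`|h| / r) `^ (1 + ga)) ->
  forall i, is_derive w (e_ i) g (l (e_ i)).
Proof.
move=> r0 ga0 A0 ll H i; apply: is_derive_dist => ep ep0.
have [N NE] : {N | A * r^-1 `^ (1 + ga) = N} by exists (A * r^-1 `^ (1 + ga)).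
have N0 : 0 <= N by rewrite -NE mulr_ge0 // powR_ge0.
have N1 : 0 < N + 1 by lra.
have e1 : 0 < ep / (N + 1) by rewrite divr_gt0.
have [d /andP[d0 _] Hd] := powR_small ga0 e1.
exists (Num.min r d); first by rewrite lt_min r0.
move=> h; rewrite le_min => /andP[hr hd].
have he : `|h *: e_ i| = `|h| by rewrite normrZ norm_delta mulr1.
have := H (h *: e_ i); rewrite he (linrZ _ _ ll) => /(_ hr) E; apply: le_trans E _.
rewrite powRM ?invr_ge0 ?(ltW r0) // [_ * r^-1 `^ _]mulrC mulrA NE powR_addn ?powRr1 //; last first.
  by rewrite gt_eqF // ltr_wpDl.
have := Hd `|h|; rewrite normr_ge0 hd => /(_ isT); rewrite ler_pdivlMr // => hh.
rewrite mulrCA mulrC; apply: ler_wpM2r => //; apply: le_trans hh.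
by rewrite mulrC; apply: ler_wpM2l; [exact: powR_ge0|rewrite lerDl].
Qed.

(** With dl = |w - w'|, the expansions at [w] and at [w'] are compared at the points [w'] and
    [w' + dl e_i]. The difference of the two slopes times dl is then bounded by three remainders of
    order dl^(1 + ga). *)
Lemma gap_partial_holder (g : V -> R) (x : V) (A r ga : R) : 0 < r -> 0 < ga ->
  (forall w, `|w - x| <= r -> gap A r (1 + ga) g w) ->
  forall i w w', `|w - x| <= r / 4 -> `|w' - x| <= r / 4 ->
  `|partial i g w - partial i g w'| <= 3 * A * (2 / r) `^ (1 + ga) * `|w - w'| `^ ga.
Proof.
move=> r0 ga0 H i w w' wx w'x; have ga1 : 0 < 1 + ga by rewrite ltr_pwDl // ltW.
have r4 : r / 4 <= r by lra.
have gw := H w (le_trans wx r4); have A0 := gap_ge0 gw; have gw' := H w' (le_trans w'x r4).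
have [l [ll _ _ el]] := gw; have [l' [ll' _ _ el']] := gw'.
have [_ E] := gap_derive r0 ga0 A0 ll el i; have [_ E'] := gap_derive r0 ga0 A0 ll' el' i.
rewrite /partial E E'.
have [v vE] : {v | w' - w = v} by exists (w' - w).
have [dl dE] : {dl | `|v| = dl} by exists `|v|.
have dl0 : 0 <= dl by rewrite -dE.
have dr : 2 * dl <= r.
  rewrite -dE -vE (_ : w' - w = (w' - x) - (w - x)); last by rewrite opprB addrA subrK.
  apply: le_trans (ler_wpM2l _ (ler_normB _ _)) _ => //.
  by move: wx w'x; clear; lra.
have hn : `|dl *: e_ i| = dl by rewrite normrZ norm_delta mulr1 ger0_norm.
have dr1 : dl <= r by lra.
have E1 := el (v + dl *: e_ i); have E2 := el v; have E3 := el' (dl *: e_ i).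
rewrite hn in E3; rewrite dE in E2.
have vh : `|v + dl *: e_ i| <= 2 * dl by apply: le_trans (ler_normD _ _) _; rewrite hn dE; lra.
have {}E1 := E1 (le_trans vh dr); have {}E2 := E2 dr1; have {}E3 := E3 dr1.
have pw a : 0 <= a -> a <= 2 * dl -> A * (a / r) `^ (1 + ga) <= A * (2 * dl / r) `^ (1 + ga).
  move=> a0 ad; apply: ler_wpM2l => //; apply: powR_mono; [exact: ltW|by rewrite divr_ge0 // ltW|].
  by rewrite ler_pM2r // invr_gt0.
have d2 : dl <= 2 * dl by lra.
have {}E1 := le_trans E1 (pw _ (normr_ge0 _) vh).
have {}E2 := le_trans E2 (pw _ dl0 d2); have {}E3 := le_trans E3 (pw _ dl0 d2).
have wv : w + v = w' by rewrite -vE addrC subrK.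
rewrite addrA wv (linrD _ _ ll) !(linrZ _ _ ll) in E1; rewrite wv in E2.
rewrite !(linrZ _ _ ll') in E3.
have -> : `|w - w'| = dl by rewrite distrC vE.
have pE : A * (2 * dl / r) `^ (1 + ga) = A * (2 / r) `^ (1 + ga) * dl `^ ga * dl.
  have -> : 2 * dl / r = 2 / r * dl by rewrite mulrAC.
  rewrite powRM //; last by rewrite divr_ge0 // ltW.
  have pd : dl `^ (1 + ga) = dl `^ ga * dl.
    by rewrite addrC powR_addn // ?powRr1 // gt_eqF // addrC.
  by rewrite pd; ring.
have key : dl * `|l (e_ i) - l' (e_ i)| <= 3 * A * (2 / r) `^ (1 + ga) * dl `^ ga * dl.
  have -> : 3 * A * (2 / r) `^ (1 + ga) * dl `^ ga * dl = 3 * (A * (2 * dl / r) `^ (1 + ga)) by rewrite pE; ring.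
  rewrite -[X in X * _](ger0_norm dl0) -normrM.
  move: E1 E2 E3; move: (A * _) (g (w' + _)) (g w) (g w') (l v) (l (e_ i)) (l' (e_ i)); clear => B a b c e x y.
  rewrite !ler_norml => /andP[? ?] /andP[? ?] /andP[? ?]; apply/andP; split; lra.
have [d0|d0] := ltP 0 dl; first by rewrite -(ler_pM2l d0) [leRHS]mulrC.
have v0 : v = 0 by apply/eqP; rewrite -normr_le0 dE.
have w'w : w' = w by rewrite -wv v0 addr0.
by move: E E'; rewrite w'w => <- <-; rewrite subrr normr0 !mulr_ge0 ?powR_ge0.
Qed.

End Regularity.

Section Final.
Context {R : realType} {n : nat}.
Local Notation V := 'rV[R]_n.
Local Notation e_ i := (delta_mx ord0 i : V).

Lemma mpartial0 (beta : 'I_n -> nat) (g : V -> R) : mdegree beta = 0%N -> mpartial beta g = g.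
Proof.
rewrite mpartial_word /mdegree => b0; set w := flatten _.
suff : size w = 0%N by case: w.
rewrite size_flatten /shape -map_comp sumnE big_map big_enum /= -[RHS]b0.
by apply: eq_bigr => i _; rewrite size_nseq.
Qed.

Lemma mpartial1 (beta : 'I_n -> nat) (g : V -> R) : mdegree beta = 1%N ->
  exists i, mpartial beta g = partial i g.
Proof.
rewrite mpartial_word /mdegree => b1; set w := flatten _.
suff : size w = 1%N by case: w => // i [] // _; exists i.
rewrite size_flatten /shape -map_comp sumnE big_map big_enum /= -[RHS]b1.
by apply: eq_bigr => i _; rewrite size_nseq.
Qed.

Lemma gap_holder_loc (Om : set V) (g : V -> R) (ga : R) : 0 < ga ->
  (forall x, Om x -> exists r A : R, 0 < r <= 1 /\ forall w, `|w - x| <= r -> gap A r (1 + ga) g w) ->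
  holder_loc 1 ga Om g.
Proof.
move=> ga0 H; have ga1 : 0 < 1 + ga by rewrite ltr_wpDr // ltW.
have HP i x : Om x -> exists r C : R, 0 < r /\ forall w w', `|w - x| <= r -> `|w' - x| <= r ->
    `|partial i g w - partial i g w'| <= C * `|w - w'| `^ ga.
  move=> Ox; have [r [A [/andP[r0 _] gA]]] := H x Ox.
  exists (r / 4), (3 * A * (2 / r) `^ (1 + ga)); split; first by rewrite divr_gt0.
  by move=> w w'; exact: (gap_partial_holder r0 ga0 gA).
split; last first.
  move=> K cK KO beta /mpartial1 b1; have [i ->] := b1 g.
  by apply: locally_holder_ub => // x /KO; exact: HP.
have Hx x : Om x -> exists r A : R, exists2 l : V -> R, [/\ 0 < r, 0 <= A & linr l] &
    (forall h, `|l h| <= A * (`|h| / r)) /\ forall h, `|h| <= r -> `|g (x + h) - g x - l h| <= A * (`|h| / r) `^ (1 + ga).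
  move=> Ox; have [r [A [/andP[r0 _] gA]]] := H x Ox.
  have /gA gx : `|x - x| <= r by rewrite subrr normr0 ltW.
  have A0 := gap_ge0 gx; have [l [ll _ lA el]] := gx; by exists r, A, l.
split => [x Ox|i].
  have [r [A [l [r0 A0 ll] [lA el]]]] := Hx x Ox.
  apply: (@holder_continuous R V g x r (2 * A / r) 1) => // w wx.
  have := el (w - x) wx; rewrite (addrC x) subrK => E; rewrite powRr1 //.
  have -> : g w - g x = (g w - g x - l (w - x)) + l (w - x) by ring.
  apply: le_trans (ler_normD _ _) _; apply: le_trans (lerD E (lA _)) _.
  have z1 : `|w - x| / r <= 1 by rewrite ler_pdivrMr // mul1r.
  have z0 : 0 <= `|w - x| / r by rewrite divr_ge0 // ltW.
  have h : (`|w - x| / r) `^ (1 + ga) <= `|w - x| / r.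
    rewrite -[leRHS]powRr1 //; apply: powR_antimono; first by rewrite z0.
    by rewrite ltr01 lerDl ltW.
  have -> : 2 * A / r * `|w - x| = A * (`|w - x| / r) + A * (`|w - x| / r) by field; rewrite gt_eqF.
  by apply: lerD => //; apply: ler_wpM2l.
split => [x Ox|]; last split => // x Ox.
  have [r [A [l [r0 A0 ll] [lA el]]]] := Hx x Ox.
  by have [] := gap_derive r0 ga0 A0 ll el i.
have [r [C [r0 HC]]] := HP i x Ox.
apply: (@holder_continuous R V (partial i g) x r C ga) => // w wx.
by apply: HC => //; rewrite subrr normr0 ltW.
Qed.

Lemma sqrt_dist (a b : R) : 0 <= a -> 0 <= b -> `|Num.sqrt a - Num.sqrt b| <= Num.sqrt `|a - b|.
Proof.
wlog ab : a b / b <= a => [hw a0 b0|a0 b0].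
  have [/hw|/ltW /hw] := leP b a; first exact.
  by rewrite distrC [`|a - b|]distrC; apply.
have ab0 : 0 <= a - b by rewrite subr_ge0.
have sab : Num.sqrt b <= Num.sqrt a by rewrite ler_sqrt.
rewrite !ger0_norm ?subr_ge0 // -(@ler_pXn2r _ 2%N) ?nnegrE ?subr_ge0 ?sqrtr_ge0 //.
rewrite sqr_sqrtr // sqrrB !sqr_sqrtr //.
have : Num.sqrt b * Num.sqrt b <= Num.sqrt a * Num.sqrt b by apply: ler_wpM2r; rewrite ?sqrtr_ge0.
by rewrite -expr2 sqr_sqrtr //; move: (_ * _) => c; lra.
Qed.

Lemma sqrt_dist_mul (a b : R) : 0 <= a -> 0 <= b -> Num.sqrt a * `|Num.sqrt b - Num.sqrt a| <= `|b - a|.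
Proof.
move=> a0 b0; have sa := sqrtr_ge0 a; have sb := sqrtr_ge0 b.
have -> : b - a = (Num.sqrt b - Num.sqrt a) * (Num.sqrt b + Num.sqrt a).
  by rewrite -subr_sqr !sqr_sqrtr.
rewrite normrM mulrC; apply: ler_wpM2l => //.
by rewrite ger0_norm ?addr_ge0 // lerDr.
Qed.

Lemma sqrt_holder0 (Om : set V) (f : V -> R) (al : R) : 0 < al -> (forall x, Om x -> 0 <= f x) ->
  holder_loc 0 al Om f -> holder_loc 0 (al / 2) Om (fun x => Num.sqrt (f x)).
Proof.
move=> al0 f0 [[Cf _] H]; split.
  split => // x Ox; apply: continuous_comp; [exact: Cf|exact: sqrt_continuous].
move=> K cK KO beta b0; have [M HM] := H K cK KO beta b0; rewrite mpartial0 //.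
rewrite mpartial0 // in HM; exists (Num.sqrt `|M|) => _ [x [y [Kx Ky xy ->]]].
have e0 : 0 < enorm (x - y) by apply: lt_le_trans (norm_le_enorm _); rewrite normr_gt0 subr_eq0.
have ep := powR_gt0 al e0.
rewrite -sqrt_powR ?(ltW e0) // ler_pdivrMr ?sqrtr_gt0 // -sqrtrM //.
apply: le_trans (sqrt_dist (f0 _ (KO _ Kx)) (f0 _ (KO _ Ky))) _.
rewrite ler_sqrt; last by rewrite mulr_ge0 // ltW.
rewrite -ler_pdivrMr //; apply: le_trans (ler_norm M).
by apply: HM; exists x, y.
Qed.

(** The intrinsic scale at [w] is t with t^s proportional to f(w). If |h| >= t, both values are
    O(|h|^s). If |h| < t, positivity on the sphere of radius t bounds the slope by a multiple of
    t^(s-1), so the increment of f is O(t^(s/2) |h|^(s/2)), and dividing by the root of f(w), of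
    size t^(s/2), gives the claim. *)
Lemma sqrt_jet (M B rho s : R) : 0 <= M -> 0 < B -> 0 < rho -> 1 < s <= 2 -> exists2 C : R, 0 <= C &
  forall (f l : V -> R) (w : V), linr l -> f w <= B ->
  (forall h, `|h| <= rho -> 0 <= f (w + h)) ->
  (forall h, `|h| <= rho -> `|f (w + h) - f w - l h| <= M * `|h| `^ s) ->
  forall h, `|h| <= rho -> `|Num.sqrt (f (w + h)) - Num.sqrt (f w)| <= C * `|h| `^ (s / 2).
Proof.
move=> M0 B0 rho0 /andP[s1 s2]; have s0 : 0 < s by lra.
have s20 : 0 <= s / 2 by lra.
have s21 : 0 < s / 2 <= 1 by apply/andP; split; lra.
(* This factor makes the intrinsic scale at most [rho], because f(w) <= B. *)
have [lam lamE] : {lam | rho `^ s / B = lam} by exists (rho `^ s / B).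
have lam0 : 0 < lam by rewrite -lamE divr_gt0 // powR_gt0.
have [N NE] : {N | lam^-1 + M = N} by exists (lam^-1 + M).
have li0 : 0 < lam^-1 by rewrite invr_gt0.
have N0 : 0 <= N by lra.
have N30 : 0 <= 3 * N by rewrite mulr_ge0.
have MN : M <= N by lra.
have c1 := sqrtr_ge0 (3 * N); have c2 : 0 <= Num.sqrt lam * (2 * N) by rewrite mulr_ge0 ?sqrtr_ge0 //; lra.
exists (Num.sqrt (3 * N) + Num.sqrt lam * (2 * N)); first exact: addr_ge0.
move=> f l w ll fB f0 fl h hr.
have [dl dE] : {dl | `|h| = dl} by exists `|h|.
have dl0 : 0 <= dl by rewrite -dE.
have [a aE] : {a | f w = a} by exists (f w).
have [b bE] : {b | f (w + h) = b} by exists (f (w + h)).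
have a0 : 0 <= a by have := f0 0; rewrite normr0 addr0 aE; apply; exact: ltW.
have b0 : 0 <= b by rewrite -bE; exact: f0.
have lb u : `|u| <= rho -> `|l u| <= a + M * `|u| `^ s.
  move=> ur; have h1 := fl u ur; have h2 := fl (- u); rewrite normrN in h2; have {}h2 := h2 ur.
  have p1 := f0 u ur; have p2 := f0 (- u); rewrite normrN in p2; have {}p2 := p2 ur.
  rewrite (linrN _ ll) in h2; rewrite aE in h1 h2.
  move: h1 h2 p1 p2; move: (M * _) (f _) (f _) (l u); clear => c x y z.
  by rewrite !ler_norml => /andP[? ?] /andP[? ?] ? ?; apply/andP; split; lra.
have ab : `|b - a| <= `|l h| + M * dl `^ s.
  have := fl h hr; rewrite bE aE dE => E.
  have -> : b - a = (b - a - l h) + l h by ring.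
  by apply: le_trans (ler_normD _ _) _; rewrite addrC lerD2l.
have dsp := powR_ge0 dl s; have dsp2 := powR_ge0 dl (s / 2).
have [t tE] : {t | (lam * a) `^ s^-1 = t} by exists ((lam * a) `^ s^-1).
have la0 : 0 <= lam * a by rewrite mulr_ge0 // ltW.
have t0 : 0 <= t by rewrite -tE powR_ge0.
have ts : t `^ s = lam * a by rewrite -tE -powRrM mulVf ?powRr1 // gt_eqF.
have tr : t <= rho.
  rewrite leNgt; apply/negP => rt; have : rho `^ s < t `^ s.
    by apply: gt0_ltr_powR => //; rewrite nnegrE // ltW.
  rewrite ts -lamE mulrAC -mulrA ltr_pMr ?powR_gt0 // ltr_pdivlMr // mul1r.
  by rewrite ltNge -aE fB.
rewrite bE aE dE.
have aL : a = lam^-1 * t `^ s by rewrite ts mulrA mulVf ?mul1r // gt_eqF.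
have [td|td] := leP t dl.
  have tsd : t `^ s <= dl `^ s by apply: powR_mono => //; exact: ltW.
  have al : a <= lam^-1 * dl `^ s by rewrite aL; apply: ler_wpM2l => //; exact: ltW.
  have bl : `|b - a| <= 3 * N * dl `^ s.
    have := lb h hr; rewrite dE => E; apply: le_trans ab _; apply: le_trans (lerD E (lexx _)) _.
    have -> : 3 * N * dl `^ s = 3 * (lam^-1 * dl `^ s) + 3 * (M * dl `^ s) by rewrite -NE; ring.
    have p1 : 0 <= lam^-1 * dl `^ s by rewrite mulr_ge0 // ltW.
    have p2 : 0 <= M * dl `^ s by exact: mulr_ge0.
    by move: al p1 p2; move: (lam^-1 * _) (M * _); clear => *; lra.
  apply: (@le_trans _ _ (Num.sqrt (3 * N) * dl `^ (s / 2))).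
    apply: le_trans (sqrt_dist b0 a0) _; rewrite -sqrt_powR // -sqrtrM ?ler_sqrt //.
      exact: mulr_ge0.
  by apply: ler_wpM2r => //; rewrite lerDl.
have tp : 0 < t by apply: le_lt_trans td.
have [x xE] : {x | t `^ (s / 2) = x} by exists (t `^ (s / 2)).
have [y yE] : {y | dl `^ (s / 2) = y} by exists (dl `^ (s / 2)).
have x0 : 0 < x by rewrite -xE powR_gt0.
have y0 : 0 <= y by rewrite -yE powR_ge0.
have xx : t `^ s = x * x by rewrite -xE -expr2 powR_sq.
have yy : dl `^ s = y * y by rewrite -yE -expr2 powR_sq.
have yx : y <= x by rewrite -xE -yE; apply: powR_mono => //; exact: ltW.
have z01 : 0 <= dl / t <= 1 by rewrite divr_ge0 // ler_pdivrMr // mul1r ltW.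
have zx : dl / t * x <= y.
  have -> : y = (dl / t) `^ (s / 2) * x.
    by rewrite -xE -yE -powRM ?divfK ?gt_eqF //; case/andP: z01.
  apply: ler_wpM2r; first exact: ltW.
  have /andP[z0 z1] := z01; rewrite -[leLHS]powRr1 //; by apply: powR_antimono; rewrite ?z0.
have lh : `|l h| <= N * (x * y).
  have E := @lin_bound R n l (N * (x * x)) t tp ll _ h; apply: le_trans (E _) _.
    move=> u ut; have := lb u; rewrite ut => /(_ tr) E'; apply: le_trans E' _.
    by rewrite xx in aL *; rewrite -NE mulrDl -aL.
  rewrite dE -mulrA; apply: ler_wpM2l => //; rewrite -mulrA; apply: ler_wpM2l; first exact: ltW.
  by rewrite mulrC.
have sx : Num.sqrt lam * Num.sqrt a = x.
  by rewrite -sqrtrM ?(ltW lam0) // -ts xx -expr2 sqrtr_sqr ger0_norm // ltW.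
rewrite yE; apply: (@le_trans _ _ (Num.sqrt lam * (2 * N) * y)); last by apply: ler_wpM2r => //; rewrite lerDr.
rewrite -(ler_pM2l x0).
have -> : x * (Num.sqrt lam * (2 * N) * y) = Num.sqrt lam * (N * (x * y) + N * (x * y)) by ring.
rewrite -{1}sx -[leLHS]mulrA.
apply: ler_wpM2l; first exact: sqrtr_ge0.
apply: le_trans (sqrt_dist_mul a0 b0) _; apply: le_trans ab _; apply: lerD => //.
rewrite yy; apply: ler_pM => //; [exact: mulr_ge0|exact: ler_wpM2r].
Qed.

Lemma sqrt_holder1 (Om : set V) (f : V -> R) (al : R) : open Om -> 0 < al <= 1 ->
  (forall x, Om x -> 0 <= f x) -> holder_loc 1 al Om f ->
  holder_loc 0 ((1 + al) / 2) Om (fun x => Num.sqrt (f x)).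
Proof.
move=> oO al01 f0 hf; have [Cf _] := hf; have /andP[al0 al1] := al01.
split.
  by split => // x Ox; apply: continuous_comp; [exact: Cf.1|exact: sqrt_continuous].
move=> K cK KO beta /mpartial0 b0; rewrite b0; apply: locally_holder_ub => // [|x Kx]; first by lra.
have Ox := KO x Kx; have [d d0 Hd] := open_dist oO Ox.
(* One third for the base point and two thirds for the increment between two points of the smaller
   cube. *)
have [t tE] : {t | d = 3 * t} by exists (d / 3); field.
have t0 : 0 < t by lra.
have cQ := @compact_cube R n x d d0; have QO : [set y | `|y - x| <= d] `<=` Om by [].
have [B B0 HB] := locally_bounded cQ (fun y Qy => Cf.1 y (QO y Qy)).
have [M M0 HM] := word_holder oO al01 hf cQ QO.
have s12 : 1 < al + 1 <= 2 by apply/andP; split; lra.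
have t20 : 0 < 2 * t by lra.
have nM0 : 0 <= n%:R ^+ 1 * M by rewrite mulr_ge0.
have [C C0 HC] := sqrt_jet nM0 B0 t20 s12.
exists t, C; split => // w w' wt w't.
have Qw h : `|h| <= 2 * t -> [set y | `|y - x| <= d] (w + h).
  move=> ht /=; rewrite addrAC; apply: le_trans (ler_normD _ _) _; rewrite tE.
  by move: wt ht; clear; lra.
have [J [[jt0 jq0 _] HJ]] := taylor_jet oO QO Qw (ltW t20) M0 al0 (isT : (1 <= 3)%N) Cf HM.
have w'w : `|w' - w| <= 2 * t.
  have -> : w' - w = (w' - x) - (w - x) by rewrite opprB addrA subrK.
  by apply: le_trans (ler_normB _ _) _; move: wt w't; clear; lra.
have ww : `|0 : V| <= 2 * t by rewrite normr0 ltW.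
rewrite distrC [`|w - w'|]distrC [1 + al]addrC -[in X in `|X|](subrK w w') [w' - w + w]addrC.
apply: (HC f (jl J) w (jl_lin J)) => //.
- by have := HB _ (Qw 0 ww); rewrite addr0; apply: le_trans; exact: ler_norm.
- by move=> h /Qw /QO; exact: f0.
- by move=> h /HJ; rewrite /tay jt0 // jq0 // !addr0.
Qed.

Lemma half_holder_zero (k : nat) (al : R) (Om : set V) : (k < 2)%N ->
  half_holder_loc k al Om (fun=> 0).
Proof.
have H (ga : R) : holder_loc 0 ga Om (fun=> 0 : R).
  split; first by split => // x _; exact: cst_continuous.
  move=> K _ _ beta /mpartial0 ->; exists 0 => _ [x [y [_ _ _ ->]]].
  by rewrite subrr normr0 mul0r.
by case: k => [|[|k]] // _; exact: H.
Qed.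

End Final.

Theorem theorem3p16 (R : realType) (n : nat) (hn : (1 <= n)%N) :
  exists m : nat, (0 < m)%N /\
    forall (Omega : set 'rV[R]_n) (k : nat) (alpha : R) (f : 'rV[R]_n -> R),
      open Omega -> (k <= 3)%N -> 0 < alpha -> alpha <= 1 ->
      holder_loc k alpha Omega f ->
      (forall x, Omega x -> 0 <= f x) ->
      exists g : 'I_m -> 'rV[R]_n -> R,
        (forall j : 'I_m, half_holder_loc k alpha Omega (g j)) /\
        (forall x, Omega x -> f x = \sum_(j < m) g j x ^+ 2).
Proof.
have [m m0 dec] := @open_decomp R n hn; exists m; split => // Omega k alpha f oO k3 al0 al1 hf f0.
have al01 : 0 < alpha <= 1 by rewrite al0.
have [k2|k2] := ltnP k 2.
  (* For k <= 1 one root suffices; it is padded with zeros to the common number [m]. *)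
  case: m m0 {dec} => // m _.
  exists (fun j => if j == ord0 then fun x => Num.sqrt (f x) else fun=> 0); split => [j|x Ox].
    case: ifP => _; last exact: half_holder_zero.
    case: k k2 {k3} hf => [|[|//]] _ hf; first exact: sqrt_holder0.
    exact: sqrt_holder1.
  rewrite big_ord_recl /= big1 ?addr0 => [|i _]; last by rewrite expr0n.
  by rewrite sqr_sqrtr // f0.
have [g [gs gg]] := dec Omega k alpha f oO (introT andP (conj k2 k3)) al01 hf f0.
(* For k = 2 and k = 3 the order (alpha + k)/2 is 1 plus alpha/2, respectively 1 plus (1 + alpha)/2,
   so both cases ask for one derivative with that Hoelder exponent. *)
exists g; split => // j; case: k k2 k3 hf gg => [|[|[|[|//]]]] // _ _ _ gg; apply: gap_holder_loc.
- by rewrite divr_gt0.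
- by move=> x /(gg j) H; have -> : 1 + alpha / 2 = (alpha + 2) / 2 by field.
- by rewrite divr_gt0 // addr_gt0.
- by move=> x /(gg j) H; have -> : 1 + (1 + alpha) / 2 = (alpha + 3) / 2 by field.
Qed.
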